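(* Let $\epsilon>0$. Assume that there is a random variable $X_n$ such that the following holds: for any non-self-conjugate word $w\in\{a,b\}^*$ of length $(1+\epsilon)\log_2(n)$ (rounded down to an integer), the height $H_n$ of a uniformly random $0$-shifted marked $w$-tree on $[n]$ is stochastically dominated by $X_n$. Then the length of the shortest synchronizing word of a uniformly random automaton with $n$ states on the alphabet $\{a,b\}$ is stochastically dominated by $(1+\epsilon)X_n\log_2(n)$.
   Context: An automaton on $[n]$ is a pair of maps $a,b:[n]\to[n]$; a uniformly random one is uniform among the $n^{2n}$ pairs. A word $w=w^1\cdots w^k$ acts on states by $w(u)=w^k(\cdots w^1(u)\cdots)$, and $A_w$ is the induced map $[n]\to[n]$. A word is synchronizing for $A$ if it sends all states to one same state. $A$ is a $w$-tree if $A_w$ has a unique cyclic point (a point $x$ with $A_w^m(x)=x$ for some $m\ge1$), called the root. A word is self-conjugate if it is nontrivially conjugate to itself (by a cyclic permutation of its letters), equivalently if it is a power $u^p$, $p>1$, of a shorter word $u$. For a word $w$ of length $k$ and $v\in[n]$, consider the infinite sequence $u_0=v$, $u_i=w^{i}(u_{i-1})$ for $i\ge1$, where letter indices are taken modulo $k$ (in $\{1,\dots,k\}$) and a letter acts by its transition map; let $T=\min\{j\ge1:\exists\, i<j,\ u_i=u_j,\ i\equiv j \bmod k\}$. A $0$-shifted marked $w$-tree on $[n]$ is a pair $(A,v)$, with $v\in[n]$ and $A$ a $w$-tree on $[n]$, such that $T\equiv0\bmod k$; a uniformly random one is uniform on the finite set of such pairs. Its height is the maximum over vertices $x\in[n]$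 of the distance from $x$ to the root in the tree $A_w$. $Y$ is stochastically dominated by $Z$ if $\mathbb{P}(Y>t)\le\mathbb{P}(Z>t)$ for all $t\in\mathbb{R}$.
   Formalization: The domination of the shortest synchronizing length is stated up to an additive probability error tending to 0, depending only on ε and n; exact domination fails for n≥2, since with positive probability (e.g. a=b=id) the automaton has no synchronizing word. *)

(* Defs.v *)
From HB Require Import structures.
From mathcomp Require Import all_boot all_order all_algebra.
From mathcomp Require Import all_classical all_reals all_analysis.
Set Implicit Arguments.
Unset Strict Implicit.
Unset Printing Implicit Defensive.
Import Order.TTheory GRing.Theory Num.Theory.
Import numFieldNormedType.Exports.
Local Open Scope ring_scope.

(* The letters a and b are encoded by [false] and [true]. *)
Definition letter := bool.
Definition word := seq letter.

(* The pair (a, b) of transition maps; the state set [n] is ['I_n]. *)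
Definition automaton (n : nat) : finType :=
  ({ffun 'I_n -> 'I_n} * {ffun 'I_n -> 'I_n})%type.

Definition letter_act n (A : automaton n) (x : letter) : 'I_n -> 'I_n :=
  if x then A.2 else A.1.

Definition word_act n (A : automaton n) (w : word) (u : 'I_n) : 'I_n :=
  foldl (fun u x => letter_act A x u) u w.

Definition synchronizing n (A : automaton n) (w : word) : Prop :=
  exists s : 'I_n, forall u : 'I_n, word_act A w u = s.

(* +oo when [A] has no synchronizing word. *)
Definition shortest_sync (R : realType) n (A : automaton n) : \bar R :=
  ereal_inf [set (size w)%:R%:E | w in [set w : word | synchronizing A w]]%classic.

Definition self_conjugate (w : word) : Prop :=
  exists i : nat, (0 < i < size w)%N /\ rot i w = w.

Definition cyclic_point n (f : 'I_n -> 'I_n) (x : 'I_n) : Prop :=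
  exists m : nat, (0 < m)%N /\ iter m f x = x.

Definition is_wtree n (w : word) (A : automaton n) : Prop :=
  exists! x : 'I_n, cyclic_point (word_act A w) x.

(* u_0 = v and u_(i+1) = w^(i+1) (u_i). As [nth] counts from 0, the letter
   w^(i+1), with index read modulo k in {1, ..., k}, is at position i mod k. *)
Fixpoint letter_orbit n (A : automaton n) (w : word) (v : 'I_n) (i : nat) : 'I_n :=
  if i is j.+1
  then letter_act A (nth false w (j %% size w)%N) (letter_orbit A w v j)
  else v.

Definition repeats_at n (A : automaton n) (w : word) (v : 'I_n) (j : nat) : Prop :=
  (1 <= j)%N /\
  exists i : nat, [/\ (i < j)%N, letter_orbit A w v i = letter_orbit A w v j
                    & (i = j %[mod size w])%N].

Definition first_repeat n (A : automaton n) (w : word) (v : 'I_n) (T : nat) : Prop :=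
  repeats_at A w v T /\ (forall j, repeats_at A w v j -> (T <= j)%N).

Definition marked_wtree0 n (w : word) (Av : automaton n * 'I_n) : Prop :=
  is_wtree w Av.1 /\
  exists T : nat, first_repeat Av.1 w Av.2 T /\ (T = 0 %[mod size w])%N.

(* The mark is only the default value of [xget]: in a w-tree the set of cyclic
   points is a singleton. *)
Definition wtree_root n (w : word) (Av : automaton n * 'I_n) : 'I_n :=
  xget Av.2 (cyclic_point (word_act Av.1 w)).

(* [findex f x r] is the least m such that f^m x = r, which is the distance from
   x to the root r in the tree of edges x -- f x. *)
Definition height n (w : word) (Av : automaton n * 'I_n) : nat :=
  \max_(x : 'I_n) findex (word_act Av.1 w) x (wtree_root w Av).

Definition log2 (R : realType) (x : R) : R := ln x / ln 2.

(* P(Y > t) as a function of t, for Y defined on the finite set E endowed with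
   the uniform distribution. *)
Definition unif_tail (R : realType) (T : finType) (E : T -> Prop)
    (Y : T -> \bar R) (t : R) : \bar R :=
  (#|[pred x | `[< E x >] && (t%:E < Y x)%E]|%:R / #|[pred x | `[< E x >]]|%:R)%:E.

(* P(Y > t) as a function of t, for Y defined on a probability space. *)
Definition rv_tail (R : realType) (d : measure_display) (T : measurableType d)
    (P : probability T R) (Y : T -> R) (t : R) : \bar R :=
  P [set x | t < Y x]%classic.

Definition stoch_dominated (R : realType) (F G : R -> \bar R) : Prop :=
  forall t : R, (F t <= G t)%E.

(* Stochastic domination up to an error e in probability, uniformly in t. For
   real variables Y and Z, it amounts to the existence of a coupling under which
   Y <= Z outside an event of probability at most e. *)
Definition stoch_dominated_upto (R : realType) (e : R) (F G : R -> \bar R) : Prop :=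
  forall t : R, (F t <= G t + e%:E)%E.

(* Main.v *)
(* For a word w of length k, let D_w(A) be the number of marks v making (A, v) a 0-shifted marked
   w-tree. If some A-orbit of blocks of w starting from v ends at a fixed point, its blocks and the
   permutation closing them up form a signed configuration, and a determinant shows that the signed
   configurations of v sum to 1 when (A, v) is a marked tree and to 0 otherwise. Hence the sum over A
   of D_w (or of D_w D_w') counts signed configurations. Exchanging the targets of two last arcs that
   are read only once reverses the sign, so only the residual configurations, with at most one such
   arc per word, remain. Among them, the main ones consist of single closed blocks: there are about
   n^(2n) of them. In the others, some vertices are left by both letters. They are rare: the few arcs
   near these vertices determine the small ones, while the large ones need long cycles, which are
   exponentially unlikely unless there are many cycles, and few automata have many cycles.

   So D_w has mean 1 + o(1) and the D_w are asymptotically uncorrelated, for words of length about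
   (1 + eps) log2 n taken in a family of more than n words that begin with a long run of the letter a
   occurring nowhere else. By Chebyshev the average Y of D_w over the family is close to 1 with high
   probability. If A is a w-tree of height H then w^H is synchronizing; thus if A has no
   synchronizing word of length at most t, then all the trees counted by Y have height more than
   t / ((1 + eps) log2 n), and the expected number of those is at most about P(X > t / ((1 + eps) log2 n)). *)
Require Import Defs.
From mathcomp Require Import all_boot all_order all_algebra all_fingroup.
From mathcomp Require Import zify ring lra.
From mathcomp Require Import boolp.
Set Implicit Arguments.
Unset Strict Implicit.
Unset Printing Implicit Defensive.
Import Order.TTheory GRing.Theory Num.Theory.

(** * Walks *)

(** Uniqueness of the cyclic point is a global condition; the determinant trades it for conditions
    on the arcs of some blocks, at the price of signs. A vertex left by both letters can be chosen
    in n ways, but the paths that leave it by either letter must end at known vertices: when there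
    are q such vertices, each contributes a factor of order q/n, up to powers of log n and of 2^m,
    where m is the length of the initial run of letters a. This suffices until q gets close to n,
    where cycles must be controlled.

    The bound on the number of cycles has an exponent about 2^kap, where kap bounds the number of
    letters b in two words, so kap must stay below log2 n. But D_w is only known to be at most n, so
    the diagonal terms of the variance require more than n words. Words of length log2 n with as
    many a as b would just fail; the extra eps log2 n letters leave more than n words with slightly
    fewer than (log2 n)/2 letters b each.

    Errors are compared through S = 2^m, where n is about S^M for a constant M that depends on eps;
    quantities of order log n are bounded by P, with P^30 <= S. *)

Notation transitions n := {ffun 'I_n * bool -> 'I_n}.

Section Walk.
Variable n : nat.
Implicit Types (A : transitions n) (l : nat -> bool).

Fixpoint walk A l s x m : 'I_n :=
  if m is m'.+1 then A (walk A l s x m', l (s + m')) else x.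

Lemma walkD A l s x m m' :
  walk A l s x (m + m') = walk A l (s + m) (walk A l s x m) m'.
Proof.
by elim: m' => [|m' IH]; rewrite ?addn0 // addnS /= IH addnA.
Qed.

Lemma walk1 A l s x m : walk A l s x m.+1 = walk A l s.+1 (A (x, l s)) m.
Proof. by rewrite -add1n walkD /= addn0 addn1. Qed.

Lemma eq_walk A l l' s s' x m :
  (forall j, j < m -> l (s + j) = l' (s' + j)) ->
  walk A l s x m = walk A l' s' x m.
Proof.
elim: m => //= m IH H; rewrite IH ?H // => j jm; apply: H; exact: ltnW.
Qed.

Lemma eq_walk_transitions A A' l s x m :
  (forall j, j < m -> A' (walk A l s x j, l (s + j)) = A (walk A l s x j, l (s + j))) ->
  walk A' l s x m = walk A l s x m.
Proof.
elim: m => //= m IH H; rewrite IH ?H // => j jm; apply: H; exact: ltnW.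
Qed.

Variables (k : nat) (l : nat -> bool).
Hypothesis l_per : forall j, l (j + k) = l j.

Lemma per_mul q j : l (j + q * k) = l j.
Proof. by elim: q => [|q IH]; rewrite ?addn0 // mulSn addnCA addnC l_per. Qed.

Lemma per_mod j : l (j %% k) = l j.
Proof. by rewrite [in RHS](divn_eq j k) addnC per_mul. Qed.

Lemma walk_per A q s x m : walk A l (s + q * k) x m = walk A l s x m.
Proof. by apply: eq_walk => j _; rewrite addnAC per_mul. Qed.

Lemma walk_phase_mod A s x m : walk A l (s %% k) x m = walk A l s x m.
Proof. by rewrite [in RHS](divn_eq s k) addnC walk_per. Qed.

Lemma walk_iter A x q : walk A l 0 x (q * k) = iter q (fun y => walk A l 0 y k) x.
Proof.
elim: q => //= q IH; rewrite mulSn addnC walkD IH.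
by rewrite -[0 + _]/(0 + q * k) walk_per.
Qed.

End Walk.

Lemma card_fiber (T U : finType) (f : T -> U) (P : pred T) (Q : pred U) b :
  (forall x, P x -> Q (f x)) ->
  (forall y, Q y -> #|[pred x | P x && (f x == y)]| <= b) ->
  #|P| <= #|Q| * b.
Proof.
move=> PQ Hb; rewrite -sum1_card (partition_big f Q) //=.
rewrite -sum_nat_const; apply: leq_sum => y Qy.
by rewrite sum1_card; exact: Hb.
Qed.

Lemma card_prescribed (E V : finType) (D : {set E}) (phi : E -> V) :
  #|[pred A : {ffun E -> V} | [forall e in D, A e == phi e]]| = #|V| ^ (#|E| - #|D|).
Proof.
pose F e := [pred t : V | (e \in D) ==> (t == phi e)].
rewrite (@eq_card _ _ (family F)); last first.
  by move=> A; rewrite !inE.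
rewrite card_family foldrE big_map big_enum /=.
rewrite (bigID (mem D)) /= big1 ?mul1n => [|e eD]; last first.
  by rewrite (@eq_card _ _ (pred1 (phi e))) ?card1 // => t; rewrite !inE eD.
rewrite (eq_bigr (fun=> #|V|)) => [|e eD]; last first.
  by apply: eq_card => t; rewrite !inE (negbTE eD).
by rewrite prod_nat_const; congr (_ ^ _);
  rewrite -(cardC D) addKn.
Qed.

(** * Signed configurations of one map *)

Section SignedSum.
Variables (n : nat) (v : 'I_n).
Implicit Types (G : {set 'I_n}) (s : {perm 'I_n}).

Definition target s x := if s x == v then x else s x.

Section Fun.
Variables (g h : 'I_n -> 'I_n).

(* [G] is the set of the starting points of the blocks of an orbit: [s] maps each of them to the
   next one, except the last one, a fixed point of [g], which it maps to the mark [v]. *)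
Definition cfg0 G s :=
  [&& v \in G, perm_on G s & [forall x in G, g x == target s x]].

(** In the applications [h] reads all the letters of the word but the last one: distinct blocks then
    have distinct last arcs. *)
Definition inj_on G := [forall x in G, forall y in G, (h x == h y) ==> (x == y)].

(** For [s] supported on [G], this is (-1)^(c - 1), where c is the number of cycles of [s] on [G],
    fixed points included. *)
Definition sign G s : int := ((-1) ^+ (s + #|G| + 1))%R.

Local Notation F := (fun x y => (g x == if y == v then x else y)%:R%R : int).

(* In the expansion of the determinant, [G] is the set of the rows where [F] is taken instead of
   the identity. *)
Definition cfg_mx : 'M[int]_n :=
  (\matrix_(x, y) (if x == v then F v y else (x == y)%:R - F x y))%R.

(** Row [v] is the only one without an identity term, which forces [v] into [G]; in the other rows,
    those outside [G] force [s] to fix them, and those in [G] contribute (-1)^(#|G| - 1). *)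
Lemma sum_sign_det : (\sum_G \sum_(s | cfg0 G s) sign G s = \det cfg_mx)%R.
Proof.
rewrite /determinant; under eq_bigr => G _ do rewrite big_mkcond.
rewrite exchange_big /=; apply: eq_bigr => s _.
pose a x := (if x == v then 0 else (x == s x)%:R : int)%R.
pose b x := (if x == v then F v (s x) else - F x (s x))%R.
rewrite (eq_bigr (fun x => (b x + a x)%R)); last first.
  by move=> x _; rewrite mxE /a /b; case: eqP => [->|_]; rewrite ?addr0 // addrC.
rewrite bigA_distr big_distrr /=; apply: eq_bigr => G _.
have Pi_v : v \notin G -> (\prod_x (if x \in G then b x else a x) = 0)%R.
  by move=> vG; rewrite (bigD1 v) //= (negbTE vG) /a eqxx mul0r.
case vG : (v \in G); last first.
  by rewrite Pi_v ?vG // mulr0 /cfg0 vG.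
case ps : (perm_on G s); last first.
  have /existsP [x /andP [xG sx]] : [exists x, (x \notin G) && (s x != x)].
    apply: contraFT ps => /existsPn H.
    apply/subsetP => x; rewrite inE => sx; apply: contraT => xG.
    by move: (H x); rewrite xG sx.
  rewrite (bigD1 x) //= (negbTE xG) /a /cfg0 ps andbF.
  have -> : x == v = false by apply: contraNF xG => /eqP ->.
  by rewrite eq_sym (negbTE sx) mul0r mulr0.
case gs : [forall x in G, g x == target s x]; last first.
  have /existsP [x /andP [xG gx]] : [exists x in G, g x != target s x].
    by rewrite -negb_forall_in gs.
  rewrite (bigD1 x) //= xG /b /cfg0 gs !andbF.
  move: gx; rewrite /target => /negbTE gx.
  by case: (x =P v) => [xv|_] /=; last rewrite gx oppr0 mul0r mulr0 //; rewrite xv in gx *;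
    rewrite gx mul0r mulr0.
rewrite /cfg0 vG ps gs /= (bigD1 v) //= vG {1}/b eqxx.
move/forall_inP: gs => gs.
have := gs v vG; rewrite /target => ->; rewrite mul1r.
rewrite (eq_bigr (fun x => if x \in G then -1 else 1)%R); last first.
  move=> x xv; rewrite /a /b (negbTE xv); case: ifP => xG.
    by have := gs x xG; rewrite /target => ->.
  by rewrite (out_perm ps) ?xG // eqxx.
rewrite -big_mkcondr /= (eq_bigl (fun x => x \in G :\ v)); last first.
  by move=> x; rewrite !inE andbC.
rewrite prodr_const /sign (cardsD1 v G) vG -signr_odd !oddD oddb.
rewrite -[X in (_ * X)%R]signr_odd -signr_addb.
by move: (odd #|G :\ v|) (odd_perm s) => [] [].
Qed.

Definition cyclic (x : 'I_n) := exists m, 0 < m /\ iter m g x = x.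

Lemma cfg0_fix_iter G s j : cfg0 G s -> (s ^+ j)%g v \in G /\ exists i, (s ^+ j)%g v = iter i g v.
Proof.
case/and3P => vG ps /forall_inP gs; elim: j => [|j [jG [i ij]]].
  by rewrite expg0 perm1; split=> //; exists 0.
rewrite expgSr permM; split; first by rewrite (perm_closed _ ps).
have /eqP := gs _ jG; rewrite /target; case: eqP => [-> _|_ <-]; first by exists 0.
by exists i.+1; rewrite ij.
Qed.

Lemma cfg0_iter G s i : cfg0 G s -> iter i g v \in G.
Proof.
case/and3P => vG ps /forall_inP gs; elim: i => [|i iG] //.
rewrite iterS (eqP (gs _ iG)) /target; case: ifP => // _.
by rewrite (perm_closed _ ps).
Qed.

(* The root: the predecessor of [v] for the permutation. *)
Lemma cfg0_root G s (r := (s^-1)%g v) :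
  cfg0 G s -> [/\ r \in G, g r = r & exists i, r = iter i g v].
Proof.
move=> c; have [j jE] : exists j, r = (s ^+ j)%g v.
  have : r \in porbit s v by rewrite porbit_sym; apply/porbitP; exists 1; rewrite expg1 permKV.
  by case/porbitP => j ->; exists j.
have [jG ji] := cfg0_fix_iter j c; rewrite -jE in jG ji; split => //.
case/and3P: c => _ _ /forall_inP /(_ _ jG) /eqP ->.
by rewrite /target /r permKV eqxx.
Qed.

(* Two blocks with the same image are the root and its predecessor, which both lie on the [g]-orbit of [v]. *)
Lemma cfg0_collision G s x y :
  cfg0 G s -> x \in G -> y \in G -> g x = g y -> x != y ->
  (exists i, x = iter i g v) /\ (exists i, y = iter i g v).
Proof.
move=> c; wlog sx : x y / s x = v => [W|].
  move=> xG yG gxy xy; case: (s x =P v) => [sx|sx]; first exact: W.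
  case: (s y =P v) => [sy|sy]; first by rewrite and_comm; apply: W; rewrite // eq_sym.
  case/and3P: c => _ _ /forall_inP gs; move: gxy.
  rewrite (eqP (gs x xG)) (eqP (gs y yG)) /target.
  by move/eqP/negbTE: sx => ->; move/eqP/negbTE: sy => -> /perm_inj /eqP; rewrite (negbTE xy).
move=> xG yG gxy xy.
have xr : x = (s^-1)%g v by rewrite -sx permK.
have [_ gr [i ri]] := cfg0_root c.
rewrite xr; split; first by exists i.
have sy : s y != v.
  by apply: contraNneq xy => sy; apply/eqP/(@perm_inj _ s); rewrite sx sy.
have syx : s y = x.
  case/and3P: c => _ _ /forall_inP gs; move: (eqP (gs y yG)).
  by rewrite -gxy xr gr /target (negbTE sy).
have : y \in porbit s v.
  rewrite porbit_sym; apply/porbitP; exists 2; rewrite expgS expg1 permM syx sx //.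
by case/porbitP => j ->; case: (cfg0_fix_iter j c).
Qed.

(** A collision only involves points of the [g]-orbit of [v], which lie in every [G]. Hence
    injectivity holds for all the configurations of [v] or for none, and restricting the signed sum
    to it keeps the whole determinant or nothing. *)
Lemma inj_on_cfg0 G s G' s' :
  (forall x y, h x = h y -> g x = g y) ->
  cfg0 G s -> inj_on G -> cfg0 G' s' -> inj_on G'.
Proof.
move=> hg c /forall_inP hG c'; apply/forall_inP => x xG'; apply/forall_inP => y yG'.
apply/implyP => /eqP hxy; apply: contraT => xy.
have [[i xi] [j yj]] := cfg0_collision c' xG' yG' (hg _ _ hxy) xy.
have xG : x \in G by rewrite xi (cfg0_iter _ c).
have yG : y \in G by rewrite yj (cfg0_iter _ c).
by move/forall_inP: (hG x xG) => /(_ y yG); rewrite hxy eqxx /= (negbTE xy).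
Qed.

(** A vector of the left kernel is built from the cycle C of [c]. As [g] permutes C, its indicator
    is annihilated by every column but [v], where it leaves minus the number t of fixed points in C.
    Row [r] of the root is plus or minus the unit vector at [v], the sign depending on whether [r]
    is [v], so that adding or subtracting t times this row restores 0. *)
Lemma det_cfg_mx0 G s c : cfg0 G s -> cyclic c -> c != (s^-1)%g v -> (\det cfg_mx = 0)%R.
Proof.
move=> cs [m [m0 mc]] cr; have [rG gr [i0 ri0]] := cfg0_root cs.
set r := (s^-1)%g v in cr rG gr ri0.
pose C := [set x | fconnect g c x].
have CP x : reflect (exists i, x = iter i g c) (x \in C).
  by rewrite inE; apply: (iffP (iter_findex _)) || apply: (iffP idP) => [/iter_findex <-|[i ->]];
    [exists (findex g c x)|exact: fconnect_iter].
have iterm x : x \in C -> iter m g x = x.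
  by case/CP => i ->; rewrite -iterD addnC iterD mc.
have gC x : x \in C -> g x \in C.
  by case/CP => i ->; apply/CP; exists i.+1.
have gi : {in C &, injective g}.
  move=> x y xC yC gxy; rewrite -(iterm x xC) -(iterm y yC).
  by case: m m0 => // m' _ in mc iterm *; rewrite !iterSr gxy.
have gCE : g @: C = C.
  by apply/eqP; rewrite eqEcard card_in_imset // leqnn andbT; apply/subsetP => _ /imsetP [x xC ->]; exact: gC.
have iterr i : iter i g r = r by elim: i => //= i ->.
have rC : r \notin C.
  apply/negP => /CP [i ri]; move/eqP: cr; apply.
  have iler : i <= i * m by rewrite leq_pmulr.
  have <- : iter (i * m) g c = c.
    elim: (i) => // q IH; rewrite mulSn iterD IH //.
  by rewrite -(subnK iler) iterD -ri iterr.
have vC : v \notin C.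
  apply: contra rC => /CP [i vi]; apply/CP; exists (i0 + i).
  by rewrite iterD -vi.
apply/eqP/det0P.
pose t := (\sum_(x in C) (g x == x)%:R : int)%R.
exists (\row_x ((x \in C)%:R + (if x == r then (if r == v then t else - t) else 0)))%R.
  apply/eqP => /rowP /(_ c); rewrite !mxE (negbTE cr) addr0.
  by have -> : c \in C by apply/CP; exists 0.
apply/rowP => y; rewrite !mxE.
under eq_bigr => x _ do rewrite !mxE mulrDl.
rewrite big_split /= [X in (_ + X)%R](bigD1 r) //= eqxx [X in (_ + (_ + X))%R]big1 ?addr0; last first.
  by move=> x /negbTE -> /=; rewrite mul0r.
rewrite (eq_bigr (fun x => if x \in C then ((x == y)%:R - (g x == (if y == v then x else y))%:R)%R else 0%R)); last first.
  move=> x _; case xC : (x \in C); last by rewrite mul0r.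
  by rewrite mul1r; case: (x =P v) => // xv; rewrite -xv xC in vC.
rewrite -big_mkcond /= sumrB.
have -> : (\sum_(x in C) (x == y)%:R = (y \in C)%:R :> int)%R.
  case yC : (y \in C); last first.
    by rewrite big1 // => x xC; case: eqP => // xy; rewrite xy yC in xC.
  by rewrite (bigD1 y) //= eqxx big1 ?addr0 // => x /andP [_ /negbTE ->].
case: (y =P v) => [->|/eqP yv].
  rewrite (negbTE vC) sub0r -/t; case: (r =P v) => [rv|_].
    by rewrite -rv gr eqxx mulr1 addNr.
  by rewrite gr !eqxx sub0r mulrN1 opprK addNr.
have -> : (\sum_(x in C) (g x == y)%:R = (y \in C)%:R :> int)%R.
  rewrite -(big_imset (fun z => (z == y)%:R%R : int)) //= gCE.
  case yC : (y \in C); last first.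
    by rewrite big1 // => x xC; case: eqP => // xy; rewrite xy yC in xC.
  by rewrite (bigD1 y) //= eqxx big1 ?addr0 // => x /andP [_ /negbTE ->].
rewrite subrr add0r gr; case: (r =P v) => [rv|_].
  by rewrite -rv gr rv eq_sym (negbTE yv) mulr0.
by rewrite subrr mulr0.
Qed.

(** A cycle of [s] off the one of [v] never takes the value [v], so it follows [g] and consists of
    cyclic points; but the root lies on the cycle of [v]. *)
Lemma cfg0_unique_cyclic G s :
  cfg0 G s -> (forall c, cyclic c -> c = (s^-1)%g v) -> G = porbit s v.
Proof.
move=> cs uniq; have [vG ps /forall_inP gs] := and3P cs.
apply/setP => x; apply/idP/idP; last first.
  by case/porbitP => j ->; case: (cfg0_fix_iter j cs).
move=> xG; apply: contraT => xv.
have sx j : (s ^+ j)%g x = iter j g x /\ (s ^+ j)%g x \in G.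
  elim: j => [|j [IH jG]]; first by rewrite expg0 perm1.
  rewrite expgSr permM (perm_closed _ ps); split=> //.
  rewrite iterS -IH (eqP (gs _ jG)) /target; case: eqP => // sv.
  by case/negP: xv; rewrite porbit_sym; apply/porbitP; exists j.+1; rewrite expgSr permM.
have : cyclic x.
  by exists #[s]%g; rewrite order_gt0; split=> //; have [<- _] := sx #[s]%g; rewrite expg_order perm1.
by move/uniq => xr; case/negP: xv; rewrite xr porbit_sym; apply/porbitP; exists 1; rewrite expg1 permKV.
Qed.

Lemma sign_porbit s G : perm_on G s -> G = porbit s v -> sign G s = 1%R.
Proof.
move=> ps GE.
have vG : v \in G by rewrite GE porbit_id.
have fixs x : x \notin G -> porbit s x = [set x].
  move=> xG; apply/setP => y; rewrite inE; apply/porbitP/eqP => [[i ->]|->]; last by exists 0; rewrite expg0 perm1.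
  by elim: i => [|i IH]; rewrite ?expg0 ?perm1 // expgSr permM IH (out_perm ps).
have E : porbits s = G |: [set [set x] | x in ~: G].
  apply/setP => Y; rewrite !inE; apply/imsetP/orP => [[x _ ->]|].
    case xG : (x \in G); [left|right].
      by apply/eqP; rewrite GE; apply/eqP; rewrite eq_porbit_mem -GE.
    by apply/imsetP; exists x; rewrite ?inE ?xG // fixs ?xG.
  case=> [/eqP ->|/imsetP [x]]; first by exists v.
  by rewrite inE => xG ->; exists x => //; rewrite fixs.
have c : #|porbits s| = (n - #|G|).+1.
  rewrite E cardsU1 (_ : _ \notin _ = true) /=; last first.
    apply/imsetP => -[x]; rewrite inE => xG Gx; case/negP: xG; rewrite Gx inE eqxx //.
  by rewrite card_imset; [rewrite cardsCs setCK card_ord|exact: set1_inj].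
have le : #|G| <= n by rewrite -[X in _ <= X]card_ord max_card.
rewrite /sign -signr_odd !oddD oddb /odd_perm c card_ord /= oddB //.
by case: (odd n); case: (odd #|G|).
Qed.

Lemma signed_sum_unique G s :
  cfg0 G s -> (forall c, cyclic c -> c = (s^-1)%g v) ->
  (\sum_G \sum_(s | cfg0 G s) sign G s = 1)%R.
Proof.
move=> cs uniq.
have GE := cfg0_unique_cyclic cs uniq.
have H G' s' : cfg0 G' s' -> G' = G /\ s' = s.
  move=> cs'; have [r1 g1 _] := cfg0_root cs; have [r2 g2 _] := cfg0_root cs'.
  have fixc x : g x = x -> cyclic x by move=> gx; exists 1.
  have rr : (s'^-1)%g v = (s^-1)%g v by apply: uniq; exact: fixc.
  have GE' := cfg0_unique_cyclic cs' (fun c cc => etrans (uniq c cc) (esym rr)).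
  have [/and3P [_ ps /forall_inP gs] /and3P [_ ps' /forall_inP gs']] := (cs, cs').
  have GG : G' = G.
    apply/eqP; rewrite eqEsubset; apply/andP; split; apply/subsetP => x.
      by rewrite GE' => /porbitP [j ->]; case: (cfg0_fix_iter j cs') => _ [i ->]; exact: cfg0_iter cs.
    by rewrite GE => /porbitP [j ->]; case: (cfg0_fix_iter j cs) => _ [i ->]; exact: cfg0_iter cs'.
  split=> //; apply/permP => x; case xG : (x \in G); last first.
    by rewrite (out_perm ps) ?xG // (out_perm ps') ?GG ?xG.
  have svr (p : {perm 'I_n}) : (p x == v) = (x == (p^-1)%g v) by rewrite (canF_eq (permK p)).
  have := gs x xG; rewrite /target svr; case: (x =P _) => [xr|xr] /eqP gx.
    by rewrite xr -{1}rr !permKV.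
  have := gs' x; rewrite GG => /(_ xG); rewrite /target svr rr; case: (x =P _) => // _ /eqP.
  by rewrite gx.
rewrite (bigD1 G) //= (bigD1 s) //= !big1 ?addr0.
- by apply: sign_porbit GE; case/and3P: cs.
- by move=> G' GG; rewrite big1 // => s' /H [] G'G; rewrite G'G eqxx in GG.
- by move=> s' /andP [/H [_ ->]]; rewrite eqxx.
Qed.

Lemma signed_sum (b : bool) :
  (forall x y, h x = h y -> g x = g y) ->
  (b <-> (exists! x, cyclic x) /\ exists G s, cfg0 G s && inj_on G) ->
  (\sum_G \sum_(s | cfg0 G s && inj_on G) sign G s = b%:R)%R.
Proof.
move=> hg bP; case: (boolP [exists G, exists s, cfg0 G s && inj_on G]); last first.
  move=> /existsPn H; rewrite big1 => [|G _]; last first.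
    by rewrite big1 // => s cs; move/existsPn: (H G) => /(_ s); rewrite cs.
  case: b bP => // -[/(_ isT) [_ [G [s cs]]] _].
  by move/existsPn: (H G) => /(_ s); rewrite cs.
case/existsP => G /existsP [s /andP [cs iG]].
have [rG gr [i ri]] := cfg0_root cs.
have -> : (\sum_G \sum_(s | cfg0 G s && inj_on G) sign G s
  = \sum_G \sum_(s | cfg0 G s) sign G s)%R.
  apply: eq_bigr => G' _; apply: eq_bigl => s'.
  by case cs': (cfg0 G' s') => //=; rewrite (inj_on_cfg0 hg cs iG cs').
case: b bP => bP.
  have [[x [xc xu]] _] := bP.1 isT.
  rewrite (signed_sum_unique cs) // => c /xu <-; apply: xu; exists 1 => //=.
have /existsNP [c /not_implyP [cc /eqP cr]] : ~ forall c, cyclic c -> c = (s^-1)%g v.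
  move=> u; suff: false by []; apply/bP; split; last by exists G, s; rewrite cs.
  exists ((s^-1)%g v); split; first by exists 1.
  by move=> c /u.
by rewrite sum_sign_det (det_cfg_mx0 cs cc cr).
Qed.

End Fun.
End SignedSum.

(** * The sign-reversing involution *)

Lemma sum_involution0 (T : finType) (P : pred T) (F : T -> int) (f : T -> T) :
  (forall x, P x -> P (f x)) -> (forall x, P x -> f (f x) = x) ->
  (forall x, P x -> F (f x) = - F x)%R -> (\sum_(x | P x) F x = 0)%R.
Proof.
move=> Pf ff Ff; set S := (\sum_(_ | _) _)%R.
suff : (S = - S)%R by lia.
rewrite {1}/S (reindex_onto f f) //= -sumrN; apply: eq_big => [x|x Px].
  apply/andP/idP => [[Pfx /eqP <-]|Px]; first exact: Pf.
  by rewrite Pf // ff.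
by apply: Ff; case/andP: Px => /Pf + /eqP ffx; rewrite ffx.
Qed.

Section Swap.
Variables (n : nat) (I : finType) (k : nat) (L : I -> nat -> bool).
Hypothesis k_gt0 : 0 < k.
Implicit Types (A : transitions n) (i : I).

Definition gmap A i x := walk A (L i) 0 x k.
Definition hmap A i x := walk A (L i) 0 x k.-1.
Definition last_arc A i x := (hmap A i x, L i k.-1).

Lemma gmapE A i x : gmap A i x = A (last_arc A i x).
Proof. by rewrite /gmap -{1}(prednK k_gt0). Qed.

Lemma hmap_gmap A i x y : hmap A i x = hmap A i y -> gmap A i x = gmap A i y.
Proof. by rewrite !gmapE /last_arc => ->. Qed.

Notation conf := ('I_n * {set 'I_n} * {perm 'I_n})%type.
Notation cv c := (c.1.1).
Notation cG c := (c.1.2).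
Notation cs c := (c.2).

Definition cfg_ok A i (c : conf) :=
  cfg0 (cv c) (gmap A i) (cG c) (cs c) && inj_on (hmap A i) (cG c).

Notation bigconf := (transitions n * {ffun I -> conf})%type.
Implicit Types X : bigconf.

Definition valid X := [forall i, cfg_ok X.1 i (X.2 i)].
Definition bigsign X : int := (\prod_i sign (cG (X.2 i)) (cs (X.2 i)))%R.

(* The last arc of the block of [x] is read only once, by the last letter of this block. *)
Definition free X i x := (x \in cG (X.2 i)) &&
  [forall i', forall y in cG (X.2 i'), forall j : 'I_k,
    ((walk X.1 (L i') 0 y j, L i' j) == last_arc X.1 i x) ==>
    ((i' == i) && (y == x) && (j == k.-1 :> nat))].

Lemma freeP X i x i' y j : free X i x -> y \in cG (X.2 i') -> j < k ->
  (walk X.1 (L i') 0 y j, L i' j) = last_arc X.1 i x ->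
  [/\ i' = i, y = x & j = k.-1].
Proof.
move=> /andP [_ /forallP /(_ i') /forall_inP H] yG jk E.
have /forallP /(_ (Ordinal jk)) /= := H y yG; rewrite E eqxx /=.
by case/andP => /andP [/eqP -> /eqP ->] /eqP ->.
Qed.

Definition residual X := [forall i, #|[set x | free X i x]| <= 1].

(* Exchanging the targets of two free last arcs multiplies the permutation by a transposition,
   which reverses the sign. *)
Definition swap_at (p : I * 'I_n * 'I_n) X : bigconf :=
  let: (i, x, y) := p in
  let s' := (tperm x y * cs (X.2 i))%g in
  ([ffun e => if e == last_arc X.1 i x then target (cv (X.2 i)) s' x
              else if e == last_arc X.1 i y then target (cv (X.2 i)) s' y else X.1 e],
   [ffun i' => ((X.2 i').1, if i' == i then s' else cs (X.2 i'))]).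

Section SwapAt.
Variables (X : bigconf) (i : I) (x y : 'I_n).
Hypothesis vX : valid X.
Hypotheses (fx : free X i x) (fy : free X i y) (xy : x != y).
Let X' := swap_at (i, x, y) X.
Let s' := (tperm x y * cs (X.2 i))%g.

Lemma swap_fst i' : (X'.2 i').1 = (X.2 i').1.
Proof. by rewrite ffunE. Qed.

Lemma swap_snd i' : cs (X'.2 i') = if i' == i then s' else cs (X.2 i').
Proof. by rewrite ffunE. Qed.

Lemma free_in z : free X i z -> z \in cG (X.2 i).
Proof. by case/andP. Qed.

Lemma last_arc_neq : (last_arc X.1 i x == last_arc X.1 i y) = false.
Proof.
apply/negP => /eqP [hxy]; case/negP: xy.
have /andP [_ /forall_inP /(_ x (free_in fx)) /forall_inP] := forallP vX i.
by move=> /(_ y (free_in fy)); rewrite hxy eqxx.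
Qed.

Lemma swap_last_x : X'.1 (last_arc X.1 i x) = target (cv (X.2 i)) s' x.
Proof. by rewrite ffunE eqxx. Qed.

Lemma swap_last_y : X'.1 (last_arc X.1 i y) = target (cv (X.2 i)) s' y.
Proof. by rewrite ffunE eq_sym last_arc_neq eqxx. Qed.

Lemma swap_arc e : e != last_arc X.1 i x -> e != last_arc X.1 i y -> X'.1 e = X.1 e.
Proof. by rewrite ffunE => /negbTE -> /negbTE ->. Qed.

(** A free arc is read only at the end of its own block, so the exchange changes no block before its
    last arc. *)
Lemma swap_walk i' z m : z \in cG (X.2 i') -> m <= k.-1 ->
  walk X'.1 (L i') 0 z m = walk X.1 (L i') 0 z m.
Proof.
move=> zG mk; apply: eq_walk_transitions => j jm; rewrite add0n.
have jk : j < k.-1 by exact: leq_trans mk.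
have jk' : j < k by apply: leq_trans jk (leq_pred _).
apply: swap_arc; apply/eqP => E.
  by case: (freeP fx zG jk' E) => _ _ jE; rewrite jE ltnn in jk.
by case: (freeP fy zG jk' E) => _ _ jE; rewrite jE ltnn in jk.
Qed.

Lemma swap_hmap i' z : z \in cG (X.2 i') -> hmap X'.1 i' z = hmap X.1 i' z.
Proof. by move=> zG; rewrite /hmap swap_walk. Qed.

Lemma swap_last_arc i' z : z \in cG (X.2 i') -> last_arc X'.1 i' z = last_arc X.1 i' z.
Proof. by move=> zG; rewrite /last_arc swap_hmap. Qed.

Lemma swap_free i' z : free X' i' z = free X i' z.
Proof.
rewrite /free swap_fst; case zG: (z \in _) => //=.
apply: eq_forallb => i2; rewrite swap_fst; apply: eq_forallb_in => y2 yG.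
apply: eq_forallb => j; rewrite swap_walk ?swap_last_arc //.
by rewrite -ltnS (prednK k_gt0).
Qed.

Lemma swap_perm_on : perm_on (cG (X.2 i)) s'.
Proof.
have /andP [/and3P [_ ps _] _] := forallP vX i.
apply: perm_onM => //; apply: subset_trans (tperm_on x y) _.
by rewrite subUset !sub1set (free_in fx) (free_in fy).
Qed.

Lemma swap_valid : valid X'.
Proof.
apply/forallP => i'; have /andP [/and3P [vG ps /forall_inP gs] /forall_inP hin] := forallP vX i'.
rewrite /cfg_ok /cfg0 swap_fst swap_snd; apply/andP; split; last first.
  apply/forall_inP => z zG; apply/forall_inP => u uG; rewrite !swap_hmap //.
  by move/forall_inP: (hin z zG) => /(_ u uG).
apply/and3P; split=> //; first by case: eqP => // ->; exact: swap_perm_on.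
apply/forall_inP => z zG; rewrite gmapE swap_last_arc //.
case: (last_arc X.1 i' z =P last_arc X.1 i x) => [E|nx].
  have [i'i zx _] : [/\ i' = i, z = x & k.-1 = k.-1].
    by apply: (freeP fx zG _ E); rewrite prednK.
  by rewrite E swap_last_x i'i eqxx zx.
case: (last_arc X.1 i' z =P last_arc X.1 i y) => [E|ny].
  have [i'i zx _] : [/\ i' = i, z = y & k.-1 = k.-1].
    by apply: (freeP fy zG _ E); rewrite prednK.
  by rewrite E swap_last_y i'i eqxx zx.
rewrite swap_arc ?(introN eqP) // -gmapE (eqP (gs z zG)) /target.
case: (i' =P i) => [i'i|//]; rewrite /s' permM tpermD -?i'i //.
  by apply/eqP => zx; apply: nx; rewrite i'i zx.
by apply/eqP => zx; apply: ny; rewrite i'i zx.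
Qed.

Lemma swapK : swap_at (i, x, y) X' = X.
Proof.
rewrite /swap_at !swap_last_arc ?free_in // swap_snd eqxx swap_fst.
have -> : (tperm x y * s')%g = cs (X.2 i) by rewrite /s' mulgA tperm2 mul1g.
have /andP [/and3P [_ _ /forall_inP gs] _] := forallP vX i.
rewrite [RHS]surjective_pairing; congr (_, _); apply/ffunP => e; rewrite !ffunE.
  case: eqP => [->|nx]; first by rewrite -(eqP (gs x (free_in fx))) gmapE.
  case: eqP => [->|ny]; first by rewrite -(eqP (gs y (free_in fy))) gmapE.
  by [].
rewrite [RHS]surjective_pairing /=; congr (_, _).
by case: eqP => [->|].
Qed.

Lemma swap_sign : bigsign X' = (- bigsign X)%R.
Proof.
rewrite /bigsign (bigD1 i) //= [in RHS](bigD1 i) //= -mulNr; congr (_ * _)%R; last first.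
  by apply: eq_bigr => i' /negbTE ii; rewrite swap_fst swap_snd ii.
rewrite swap_fst swap_snd eqxx /sign -signr_odd -[in RHS]signr_odd !oddD !oddb.
rewrite odd_permM odd_tperm xy.
by case: (odd_perm _); case: (odd _).
Qed.

End SwapAt.

(** The choice depends on freeness alone, which the exchange preserves: the same pair is picked
    again, and [swap] undoes itself. *)
Definition swap_pick X := [pick p : I * 'I_n * 'I_n |
  [&& free X p.1.1 p.1.2, free X p.1.1 p.2 & p.1.2 != p.2]].

Definition swap X := if swap_pick X is Some p then swap_at p X else X.

Lemma residualPn X : ~~ residual X -> exists i x y, [&& free X i x, free X i y & x != y].
Proof.
case/forallPn => i; rewrite -ltnNge => /card_gt1P [x [y [+ + xy]]].
by rewrite !inE => fx fy; exists i, x, y; rewrite fx fy.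
Qed.

Lemma residual_swap_at X i x y : valid X -> free X i x -> free X i y -> x != y ->
  residual (swap_at (i, x, y) X) = residual X.
Proof.
move=> vX fx fy xy; apply: eq_forallb => i'; congr (_ <= 1).
by apply: eq_card => z; rewrite !inE swap_free.
Qed.

Lemma sum_residual :
  (\sum_(X | valid X) bigsign X = \sum_(X | valid X && residual X) bigsign X)%R.
Proof.
suff H0 : (\sum_(X | valid X && ~~ residual X) bigsign X = 0)%R.
  by rewrite (bigID residual) /= H0 addr0.
apply: (sum_involution0 (f := swap)) => X /andP [vX nr].
- rewrite /swap /swap_pick; case: pickP => [[[i x] y] /= /and3P [fx fy xy]|none].
    by rewrite (swap_valid vX fx fy xy) residual_swap_at.
  by rewrite vX nr.
- rewrite {2}/swap; case E: (swap_pick X) => [[[i x] y]|]; last by rewrite /swap E.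
  have /and3P [/= fx fy xy] : [&& free X i x, free X i y & x != y].
    by move: E; rewrite /swap_pick; case: pickP => // p pP [pE]; move: pP; rewrite pE.
  have pE : swap_pick (swap_at (i, x, y) X) = swap_pick X.
    by apply: eq_pick => -[[i' x'] y'] /=; rewrite !(swap_free fx fy).
  by rewrite /swap pE E; exact: swapK.
- rewrite /swap /swap_pick; case: pickP => [[[i x] y] /= /and3P [fx fy xy]|none].
    exact: swap_sign.
  have [i [x [y fxy]]] := residualPn nr.
  by have := none (i, x, y); rewrite /= fxy.
Qed.

End Swap.

Notation conf n := ('I_n * {set 'I_n} * {perm 'I_n})%type.
Notation cv c := (c.1.1).
Notation cG c := (c.1.2).
Notation cs c := (c.2).
Notation bigconf n I := (transitions n * {ffun I -> conf n})%type.

Lemma sum_prod_signed (n : nat) (I : finType) k (L : I -> nat -> bool)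
    (mk : I -> transitions n -> 'I_n -> bool) :
  (forall i A v, \sum_G \sum_(s | cfg0 v (gmap k L A i) G s && inj_on (hmap k L A i) G) sign G s
     = (mk i A v)%:R)%R ->
  (\sum_A \prod_i #|[set v | mk i A v]|%:R = \sum_(X : bigconf n I | valid k L X) bigsign X)%R.
Proof.
move=> mkE; rewrite [RHS]big_mkcond /=.
rewrite (reindex (fun p : transitions n * {ffun I -> conf n} => (p.1, p.2))) /=; last first.
  by exists id => [[]|[]].
rewrite -(pair_bigA _ (fun A f => if valid k L (A, f) then bigsign (A, f) else 0%R)) /=.
apply: eq_bigr => A _.
rewrite (eq_bigr (fun i => \sum_(c : conf n)
    (if cfg_ok k L A i c then sign (cG c) (cs c) else 0))%R); last first.
  move=> i _; rewrite -sum1dep_card natr_sum big_mkcond /=.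
  rewrite -(pair_bigA _ (fun (a : 'I_n * {set 'I_n}) (s : {perm 'I_n}) =>
     if cfg_ok k L A i (a, s) then sign a.2 s else 0%R)) /=.
  rewrite -(pair_bigA _ (fun (v : 'I_n) (G : {set 'I_n}) => \sum_(s : {perm 'I_n})
     if cfg_ok k L A i (v, G, s) then sign G s else 0%R)%R) /=.
  apply: eq_bigr => v _; transitivity ((mk i A v)%:R%R : int); first by case: (mk i A v).
  by rewrite -mkE; apply: eq_bigr => G _; rewrite big_mkcond.
rewrite bigA_distr_bigA /=; apply: eq_bigr => f _.
case: ifP => [/forallP /= ok|/negbT /forallPn [i /= /negbTE ni]].
  by apply: eq_bigr => i _; rewrite ok.
by rewrite (bigD1 i) //= ni mul0r.
Qed.

(** * Main configurations *)

Section Tokens.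
Variables (n : nat) (I : finType) (k : nat) (L : I -> nat -> bool).
Hypothesis k_gt0 : 0 < k.
Hypothesis L_per : forall i j, L i (j + k) = L i j.
Implicit Types (X : bigconf n I) (i : I).

Definition read_arc X i x (j : nat) := (walk X.1 (L i) 0 x j, L i j).

Definition main X := [&& valid k L X,
  [forall i, cG (X.2 i) == [set cv (X.2 i)]] &
  [forall p : I * 'I_k, forall q : I * 'I_k,
     (read_arc X p.1 (cv (X.2 p.1)) p.2 == read_arc X q.1 (cv (X.2 q.1)) q.2) ==> (p == q)]].

Lemma main_sign X : main X -> bigsign X = 1%R.
Proof.
case/and3P => /forallP vX /forallP G1 _; rewrite /bigsign big1 // => i _.
have /andP [/and3P [_ ps _] _] := vX i.
suff -> : cs (X.2 i) = 1%g by rewrite /sign odd_perm1 (eqP (G1 i)) cards1.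
apply/permP => x; rewrite perm1; case: (x =P cv (X.2 i)) => [xv|xv]; last first.
  by apply: (out_perm ps); rewrite (eqP (G1 i)) inE; apply/eqP.
have := perm_closed x ps; rewrite (eqP (G1 i)) !inE xv eqxx.
by move/eqP.
Qed.

Lemma main_residual X : main X -> residual k L X.
Proof.
case/and3P => _ /forallP G1 _; apply/forallP => i.
apply: leq_trans (_ : #|cG (X.2 i)| <= 1); last by rewrite (eqP (G1 i)) cards1.
by apply: subset_leq_card; apply/subsetP => x; rewrite inE => /andP [].
Qed.

Lemma main_perm X i : main X -> cs (X.2 i) = 1%g.
Proof.
case/and3P => /forallP vX /forallP G1 _.
have /andP [/and3P [_ ps _] _] := vX i.
apply/permP => x; rewrite perm1; case: (x =P cv (X.2 i)) => [xv|xv]; last first.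
  by apply: (out_perm ps); rewrite (eqP (G1 i)) inE; apply/eqP.
have := perm_closed x ps; rewrite (eqP (G1 i)) !inE xv eqxx.
by move/eqP.
Qed.

Lemma main_closed X i : main X -> gmap k L X.1 i (cv (X.2 i)) = cv (X.2 i).
Proof.
move=> mX; have /and3P [/forallP vX _ _] := mX.
have /andP [/and3P [vG _ /forall_inP gs] _] := vX i.
by rewrite (eqP (gs _ vG)) /target main_perm // perm1 eqxx.
Qed.

(** The vertices visited by the blocks determine #|I| * k distinct arcs together with their targets.
    The n^(#|I| * k) choices of these vertices compensate exactly for the arcs so prescribed. *)
Lemma card_main : #|[pred X | main X]| <= n ^ (n * 2).
Proof.
pose f (X : bigconf n I) : {ffun I * 'I_k -> 'I_n} :=
  [ffun p : I * 'I_k => walk X.1 (L p.1) 0 (cv (X.2 p.1)) p.2].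
pose arcs (z : {ffun I * 'I_k -> 'I_n}) (p : I * 'I_k) := (z p, L p.1 p.2).
pose Q z := injectiveb (arcs z).
have H := @card_fiber _ _ f (fun X => main X) (fun z => Q z) (n ^ (n * 2 - #|I| * k)).
case: (posnP #|[pred X | main X]|) => [->//|/card_gt0P [X0]]; rewrite inE => mX0.
have le : #|I| * k <= n * 2.
  have inj : injective (arcs (f X0)).
    move=> p q; rewrite /arcs /f !ffunE => E; apply/eqP.
    have /and3P [_ _ /forallP /(_ p) /forallP /(_ q) /implyP] := mX0.
    by apply; rewrite /read_arc E.
  by have := leq_card _ inj; rewrite !card_prod !card_ord card_bool.
apply: leq_trans (H _ _) _ => [X mX|z Qz|].
- apply/injectiveP => p q; rewrite /arcs /f !ffunE => E; apply/eqP.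
  have /and3P [_ _ /forallP /(_ p) /forallP /(_ q) /implyP] := mX.
  by apply; rewrite /read_arc E.
- move/injectiveP: Qz => Qz.
  pose D := [set arcs z p | p in [set: I * 'I_k]].
  have Dc : #|D| = #|I| * k by rewrite card_imset // cardsT card_prod card_ord.
  pose phi e := odflt e.1 (omap (fun p : I * 'I_k =>
     z (p.1, Ordinal (ltn_pmod p.2.+1 k_gt0))) [pick p | arcs z p == e]).
  have := card_prescribed D phi; rewrite Dc card_prod !card_ord card_bool => <-.
  rewrite -(@card_in_image _ _ fst).
    apply: subset_leq_card; apply/subsetP => A /imageP [X]; rewrite inE => /andP [mX /eqP fX] ->.
    rewrite inE; apply/forall_inP => e /imsetP [p _ ->]; apply/eqP.
    rewrite /phi; case: pickP => [q /eqP /Qz ->|/(_ p)]; last by rewrite eqxx.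
    rewrite /= -fX /arcs /f !ffunE /=.
    case: (ltnP p.2.+1 k) => [lt|ge].
      by rewrite modn_small.
    have kE : p.2.+1 = k by apply/eqP; rewrite eqn_leq ge ltn_ord.
    rewrite [X in X %% _]kE modnn /= -{2}(main_closed p.1 mX) /gmap.
    transitivity (walk X.1 (L p.1) 0 (cv (X.2 p.1)) p.2.+1); first by [].
    by congr (walk _ _ _ _ _).
  move=> X Y; rewrite !inE => /andP [mX /eqP fX] /andP [mY /eqP fY] XY.
  rewrite (surjective_pairing X) (surjective_pairing Y) XY; congr (_, _).
  have /and3P [_ /forallP GX _] := mX; have /and3P [_ /forallP GY _] := mY.
  apply/ffunP => i; rewrite (surjective_pairing (X.2 i)) (surjective_pairing (Y.2 i)).
  rewrite (surjective_pairing (X.2 i).1) (surjective_pairing (Y.2 i).1).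
  rewrite (eqP (GX i)) (eqP (GY i)) !main_perm //.
  suff -> : cv (X.2 i) = cv (Y.2 i) by [].
  by have /ffunP /(_ (i, Ordinal k_gt0)) := etrans fX (esym fY); rewrite !ffunE.
apply: leq_trans (_ : n ^ (#|I| * k) * n ^ (n * 2 - #|I| * k) <= _); last first.
  by rewrite -expnD subnKC.
rewrite leq_mul2r; apply/orP; right; apply: leq_trans (max_card _) _.
by rewrite card_ffun card_prod !card_ord.
Qed.

End Tokens.

(** A cyclic sequence of k distinct vertices, closed up along the word, is a main configuration for
    any choice of the other arcs. *)
Lemma card_main1 (n k : nat) (L : unit -> nat -> bool) : 0 < k ->
  n ^_ k * n ^ (n * 2 - k) <= #|[pred X : bigconf n unit | main k L X]|.
Proof.
move=> k_gt0; pose l := L tt.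
pose z0 (z : {ffun 'I_k -> 'I_n}) := z (Ordinal k_gt0).
pose nxt (z : {ffun 'I_k -> 'I_n}) (j : 'I_k) := z (Ordinal (ltn_pmod j.+1 k_gt0)).
pose P (p : {ffun 'I_k -> 'I_n} * transitions n) :=
  injectiveb p.1 && [forall j : 'I_k, p.2 (p.1 j, l j) == nxt p.1 j].
have -> : n ^_ k * n ^ (n * 2 - k) = #|[pred p | P p]|.
  rewrite -sum1_card (eq_bigl P) // /P.
  rewrite -(pair_big_dep (fun z : {ffun 'I_k -> 'I_n} => injectiveb z)
    (fun z (A : transitions n) => [forall j : 'I_k, A (z j, l j) == nxt z j]) (fun _ _ => 1)) /=.
  rewrite (eq_bigr (fun=> n ^ (n * 2 - k))) => [|z /injectiveP zi]; last first.
    rewrite sum1_card; pose D := [set (z j, l j) | j in [set: 'I_k]].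
    pose phi e := odflt e.1 (omap (nxt z) [pick j | (z j, l j) == e :> 'I_n * bool]).
    have inj : injective (fun j : 'I_k => (z j, l j)) by move=> j j' [/zi].
    have Dc : #|D| = k by rewrite card_imset // cardsT card_ord.
    have phiE j : phi (z j, l j) = nxt z j.
      rewrite /phi; case: pickP => [q /eqP /inj -> //|/(_ j)]; by rewrite eqxx.
    have := card_prescribed D phi; rewrite Dc card_prod !card_ord card_bool => <-.
    apply: eq_card => A; rewrite !inE; apply/forallP/forall_inP => [H e /imsetP [j _ ->]|H j].
      by rewrite phiE.
    by rewrite -phiE; apply: H; apply: imset_f.
  by rewrite sum_nat_const -cardsE card_inj_ffuns !card_ord.
pose F (p : {ffun 'I_k -> 'I_n} * transitions n) : bigconf n unit :=
  (p.2, [ffun=> (z0 p.1, [set z0 p.1], 1%g)]).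
have walkP p (j : 'I_k) : P p -> walk p.2 l 0 (z0 p.1) j = p.1 j.
  case/andP => _ /forallP H; case: j => j jk /=; elim: j jk => [|j IH] jk /=.
    by rewrite /z0; congr (p.1 _); apply: val_inj.
  rewrite (IH (ltnW jk)) add0n.
  rewrite (eqP (H (Ordinal (ltnW jk)))) /nxt; congr (p.1 _); apply: val_inj => /=.
  by rewrite modn_small.
have Finj : {in [pred p | P p] &, injective F}.
  move=> p q; rewrite !inE => Pp Pq [E2 /ffunP /(_ tt)]; rewrite !ffunE => -[E1 _].
  rewrite (surjective_pairing p) (surjective_pairing q) E2; congr (_, _).
  by apply/ffunP => j; rewrite -!walkP // E1 E2.
rewrite -(card_in_image Finj); apply: subset_leq_card; apply/subsetP => X.
case/imageP => p; rewrite !inE => Pp ->.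
have gE : gmap k L p.2 tt (z0 p.1) = z0 p.1.
  rewrite gmapE // /last_arc /hmap.
  have lt : k.-1 < k by rewrite prednK.
  rewrite -/l (walkP p (Ordinal lt) Pp).
  case/andP: Pp => _ /forallP /(_ (Ordinal lt)) /eqP -> /=; rewrite /nxt /z0.
  by congr (p.1 _); apply: val_inj; rewrite /= prednK // modnn.
apply/and3P; split.
- apply/forallP => -[]; rewrite /cfg_ok /cfg0 !ffunE /=; apply/andP; split.
    rewrite set11 perm_on1 /=; apply/forall_inP => x; rewrite inE => /eqP ->.
    by rewrite /target perm1 eqxx gE.
  by apply/forall_inP => x /set1P ->; apply/forall_inP => y /set1P ->; rewrite !eqxx.
- by apply/forallP => i; rewrite !ffunE /=.
- apply/forallP => -[[] j]; apply/forallP => -[[] j']; apply/implyP => /eqP.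
  rewrite /read_arc !ffunE /= => -[]; rewrite -/l !walkP // => + _.
  by case/andP: Pp => /injectiveP zi _ /zi ->.
Qed.

(** * Vertices left by both letters *)

Section Branch.
Variables (n : nat) (I : finType) (k : nat) (L : I -> nat -> bool).
Hypothesis k_gt0 : 0 < k.
Hypothesis L_per : forall i j, L i (j + k) = L i j.
Hypothesis sep : forall i i' s s',
  (forall m, m < k -> L i (s + m) = L i' (s' + m)) -> i = i' /\ s = s' %[mod k].
Variable X : bigconf n I.
Hypothesis vX : valid k L X.
Implicit Type i : I.
Local Notation A := X.1.

(* [tok i z s]: some block of word [i] of the configuration is at [z] when it reads its [s]-th letter. *)
Definition tok i z s := exists x j,
  [/\ x \in cG (X.2 i), j < k, z = walk A (L i) 0 x j & s = j %[mod k]].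

Lemma tok_start i x : x \in cG (X.2 i) -> tok i x 0.
Proof. by move=> xG; exists x, 0. Qed.

Lemma gmap_in i x : x \in cG (X.2 i) -> gmap k L A i x \in cG (X.2 i).
Proof.
move=> xG; have /andP [c _] := forallP vX i.
have /and3P [_ ps /forall_inP gs] := c.
rewrite (eqP (gs x xG)) /target; case: eqP => // _.
by rewrite (perm_closed _ ps).
Qed.

Lemma tok_step i z s : tok i z s -> tok i (A (z, L i s)) s.+1.
Proof.
move=> [x [j [xG jk zE sj]]].
have Ls : L i s = L i j by rewrite -(per_mod (L_per i)) sj (per_mod (L_per i)).
case: (ltnP j.+1 k) => [jk'|ge].
  exists x, j.+1; split=> //; first by rewrite zE Ls.
  by rewrite -addn1 -(modnDml s) sj modnDml addn1.
have kE : k = j.+1 by apply/eqP; rewrite eqn_leq ge jk.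
exists (gmap k L A i x), 0; split=> //; first exact: gmap_in.
  by rewrite zE Ls /gmap kE.
by rewrite -addn1 -(modnDml s) sj modnDml addn1 -kE modnn mod0n.
Qed.

Lemma tok_walk i z s m : tok i z s -> tok i (walk A (L i) s z m) (s + m).
Proof.
move=> t; elim: m => [|m IH]; first by rewrite addn0.
by rewrite addnS /=; exact: tok_step.
Qed.

Lemma tok_mod i z s s' : s = s' %[mod k] -> tok i z s -> tok i z s'.
Proof. by move=> E [x [j [xG jk zE sj]]]; exists x, j; rewrite -E. Qed.

Lemma block_inj i x x' j : x \in cG (X.2 i) -> x' \in cG (X.2 i) -> j <= k.-1 ->
  walk A (L i) 0 x j = walk A (L i) 0 x' j -> x = x'.
Proof.
move=> xG xG' jk E; have /andP [_ /forall_inP /(_ x xG) /forall_inP /(_ x' xG')] := forallP vX i.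
by rewrite /hmap -(subnKC jk) !walkD E eqxx => /eqP.
Qed.

Definition branch := [set z | `[< exists i s, tok i z s /\ L i s >]
                           && `[< exists i s, tok i z s /\ ~~ L i s >]].

Lemma same_letter i z s i' s' : tok i z s -> tok i' z s' -> z \notin branch -> L i s = L i' s'.
Proof.
rewrite inE negb_and => t t' /orP [] /asboolPn H.
  by case E: (L i s); [case: H; exists i, s|case E': (L i' s') => //; case: H; exists i', s'].
case E: (L i s); last by case: H; exists i, s; rewrite E.
by case E': (L i' s') => //; case: H; exists i', s'; rewrite E'.
Qed.

Lemma flow_together i z s i' s' M : tok i z s -> tok i' z s' ->
  (forall m, m < M -> walk A (L i) s z m \notin branch) ->
  forall m, m <= M -> walk A (L i') s' z m = walk A (L i) s z m /\
    (m < M -> L i (s + m) = L i' (s' + m)).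
Proof.
move=> t t' nb; elim=> [|m IH] mM.
  by split=> // M0; rewrite !addn0; apply: same_letter t t' (nb 0 M0).
have [E /(_ mM) EL] := IH (ltnW mM).
have E' : walk A (L i') s' z m.+1 = walk A (L i) s z m.+1 by rewrite /= E EL.
split=> // mM'; have := tok_walk m.+1 t'; rewrite E' => t2.
exact: same_letter (tok_walk m.+1 t) t2 (nb _ mM').
Qed.

(** Outside [branch] the vertex determines the letter read, so two tokens at [z] move together and
    read the same k letters, which identify the word and the phase. *)
Lemma tok_unique i z s i' s' : tok i z s -> tok i' z s' ->
  (forall m, m < k -> walk A (L i) s z m \notin branch) -> i = i' /\ s = s' %[mod k].
Proof.
move=> t t' nb; apply: sep => m mk.
by have [_ ->] := flow_together t t' nb (ltnW mk).
Qed.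

(** Without branch vertices, a vertex is visited by a single word at a single phase; all last arcs
    are then free, and residuality leaves one block per word. *)
Lemma residual_nobranch : residual k L X -> branch = set0 -> main k L X.
Proof.
move=> /forallP res b0.
have uniq i z s i' s' : tok i z s -> tok i' z s' -> i = i' /\ s = s' %[mod k].
  by move=> t t'; apply: (tok_unique t t') => m _; rewrite b0 inE.
have fr i x : x \in cG (X.2 i) -> free k L X i x.
  move=> xG; rewrite /free xG; apply/forallP => i'; apply/forall_inP => y yG.
  apply/forallP => j; apply/implyP => /eqP [E _].
  have tx : tok i (hmap k L A i x) k.-1 by exists x, k.-1; split; rewrite ?prednK.
  have ty : tok i' (hmap k L A i x) j by exists y, j; rewrite E; split.
  have [ii] := uniq _ _ _ _ _ tx ty.
  rewrite !modn_small ?prednK // => kj; rewrite -ii eqxx -kj eqxx andbT /=.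
  rewrite -ii -kj in E yG; rewrite (block_inj yG xG (leqnn _) E) eqxx //.
have G1 i : cG (X.2 i) = [set cv (X.2 i)].
  have /andP [/and3P [vG _ _] _] := forallP vX i.
  apply/eqP; rewrite eq_sym eqEcard sub1set vG cards1.
  apply: leq_trans (res i); apply: subset_leq_card; apply/subsetP => x xG.
  by rewrite inE fr.
rewrite /main vX /=; apply/andP; split; first by apply/forallP => i; rewrite G1.
apply/forallP => -[i j]; apply/forallP => -[i' j']; apply/implyP => /eqP [/= E _].
have t : tok i (walk A (L i) 0 (cv (X.2 i)) j) j by exists (cv (X.2 i)), j; split; rewrite ?G1 ?inE.
have t' : tok i' (walk A (L i) 0 (cv (X.2 i)) j) j'.
  by exists (cv (X.2 i')), j'; rewrite E; split; rewrite ?G1 ?inE.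
have [-> jj] := uniq _ _ _ _ _ t t'.
by rewrite !modn_small // in jj; rewrite xpair_eqE eqxx /=; apply/eqP/val_inj.
Qed.

End Branch.

(** * Exploration of residual configurations *)

Lemma card_cover (T U : finType) (P : pred T) (Q : pred U) (R : T -> U -> Prop) b :
  (forall x, P x -> exists2 y, Q y & R x y) ->
  (forall y, Q y -> #|[pred x | P x && `[< R x y >]]| <= b) ->
  #|P| <= #|Q| * b.
Proof.
move=> PQ Hb; case: (pickP P) => [x0 Px0|P0]; last by rewrite eq_card0.
have [y0 _ _] := PQ x0 Px0.
pose f x := odflt y0 [pick y | Q y && `[< R x y >]].
have fP x : P x -> Q (f x) /\ R x (f x).
  move=> /PQ [y Qy Rxy]; rewrite /f; case: pickP => [z /andP [Qz /asboolP]//|/(_ y)].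
  by rewrite Qy; case/negP; apply/asboolP.
apply: (@card_fiber _ _ f) => [x /fP []//|y Qy].
apply: leq_trans (Hb y Qy); apply: subset_leq_card; apply/subsetP => x; rewrite !inE.
by case/andP => Px /eqP <-; rewrite Px; apply/asboolP; case: (fP x Px).
Qed.

Section Explore.
Variables (n : nat) (I : finType) (L : I -> nat -> bool).
Implicit Types (A : transitions n) (D : {set 'I_n * bool}) (vis : {set 'I_n}).

(* A chain [(z, i, s, m)] follows the letters of word [i] from phase [s], starting at [z]:
   it discovers [m] new vertices and its last arc ends at a vertex that is already known. *)
Notation chain := ('I_n * I * nat * nat)%type.
Implicit Types (c : chain) (ch : seq chain).

Definition chain_vertex A c p := walk A (L c.1.1.2) c.1.2 c.1.1.1 p.
Definition chain_arc A c p := (chain_vertex A c p, L c.1.1.2 (c.1.2 + p)).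
Definition new_vertices A c := [seq chain_vertex A c p | p <- iota 1 c.2].
Definition new_arcs A c := [seq chain_arc A c p | p <- iota 0 c.2.+1].

Definition sat_chain A D vis c :=
  [&& uniq (new_arcs A c), all [predC D] (new_arcs A c),
      uniq (new_vertices A c), all [predC vis] (new_vertices A c) &
      (chain_vertex A c c.2.+1 \in vis) || (chain_vertex A c c.2.+1 \in new_vertices A c)].

Definition add_arcs A D c := D :|: [set e in new_arcs A c].
Definition add_vertices A vis c := vis :|: [set x in new_vertices A c].

Lemma in_add_arcs A D c e : (e \in add_arcs A D c) = (e \in D) || (e \in new_arcs A c).
Proof. by rewrite in_setU in_set. Qed.

Lemma in_add_vertices A vis c x :
  (x \in add_vertices A vis c) = (x \in vis) || (x \in new_vertices A c).
Proof. by rewrite in_setU in_set. Qed.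

Fixpoint sat A D vis ch :=
  if ch is c :: ch' then
    sat_chain A D vis c && sat A (add_arcs A D c) (add_vertices A vis c) ch'
  else true.

Definition final_arcs A D ch := foldl (add_arcs A) D ch.
Definition final_vertices A vis ch := foldl (add_vertices A) vis ch.

Definition chain_next A c : chain := (A (c.1.1.1, L c.1.1.2 c.1.2), c.1.1.2, c.1.2.+1, c.2.-1).

Lemma chain_vertex_next A c p : chain_vertex A c p.+1 = chain_vertex A (chain_next A c) p.
Proof. by rewrite /chain_vertex walk1. Qed.

Lemma new_vertices_next A c : 0 < c.2 ->
  new_vertices A c = chain_vertex A c 1 :: new_vertices A (chain_next A c).
Proof.
case: c => [[[z i] s] [|m]] // _; rewrite /new_vertices /=; congr (_ :: _).
rewrite (iotaDl 1 1 m : iota 2 m = _) -map_comp; apply: eq_map => p /=.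
by rewrite -chain_vertex_next.
Qed.

Lemma new_arcs_next A c : 0 < c.2 ->
  new_arcs A c = chain_arc A c 0 :: new_arcs A (chain_next A c).
Proof.
case: c => [[[z i] s] [|m]] // _; set c := (z, i, s, m.+1).
transitivity (chain_arc A c 0 :: [seq chain_arc A c p | p <- iota 1 m.+1]); first by [].
congr (_ :: _); rewrite (iotaDl 1 0 m.+1 : iota 1 m.+1 = _) -map_comp; apply: eq_map => p.
by rewrite /= /chain_arc chain_vertex_next /= addnS addSn.
Qed.

Lemma sat_next A D vis c ch : 0 < c.2 -> sat A D vis (c :: ch) ->
  [/\ chain_arc A c 0 \notin D, A (chain_arc A c 0) \notin vis &
      sat A (chain_arc A c 0 |: D) (A (chain_arc A c 0) |: vis) (chain_next A c :: ch)].
Proof.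
move=> c0 /= /andP [/and5P []].
have e1 : chain_vertex A c 1 = A (chain_arc A c 0) by [].
rewrite new_arcs_next // new_vertices_next // (chain_vertex_next A c c.2) e1.
rewrite -[in X in _ || X](prednK c0) -[in X in X || _](prednK c0).
set e := chain_arc A c 0; set c' := chain_next A c.
move Ena: (new_arcs A c') => na; move Env: (new_vertices A c') => nv.
move=> /= /andP [ee ue] /andP [eD aD] /andP [tt ut] /andP [tv av] last sat'; split=> //.
apply/andP; split.
  apply/and5P; rewrite Ena Env; split=> //.
  - apply/allP => f fc; move: (allP aD f fc); rewrite /= !inE negb_or => ->.
    by rewrite andbT; apply: contraNneq ee => <-.
  - apply/allP => y yc; move: (allP av y yc); rewrite /= !inE negb_or => ->.
    by rewrite andbT; apply: contraNneq tt => <-.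
  - by move: last; rewrite /= !inE; case/or3P => ->; rewrite ?orbT.
move: sat'; rewrite /add_arcs /add_vertices new_arcs_next // new_vertices_next //.
rewrite (_ : D :|: _ = (e |: D) :|: [set f in new_arcs A c']); last first.
  by apply/setP => f; rewrite !inE orbA [(f \in D) || _]orbC.
rewrite (_ : vis :|: _ = (A e |: vis) :|: [set x in new_vertices A c']) //.
by apply/setP => f; rewrite !inE orbA [(f \in vis) || _]orbC.
Qed.

Definition chain_sum ch := \sum_(c <- ch) c.2.

Definition update (T : eqType) (U : Type) (phi : T -> U) e t := fun e' => if e' == e then t else phi e'.

(** The arcs are revealed along the chains. An arc to a new vertex is allowed its n targets, while
    the last arc of each chain must end among at most [Vm] known vertices: a factor [Vm] / n per
    chain. *)
Lemma count_sat ch D vis (phi : 'I_n * bool -> 'I_n) Vm :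
  #|vis| + chain_sum ch <= Vm ->
  #|[pred A : transitions n | [forall e in D, A e == phi e] && sat A D vis ch]| * n ^ size ch
    <= n ^ (n * 2 - #|D|) * Vm ^ size ch.
Proof.
have [N] := ubnP (chain_sum ch + size ch).
elim: N ch D vis phi => // N IH [|[[[z i] s] m] ch] D vis phi leN leV.
  rewrite /= !muln1; have := card_prescribed D phi.
  rewrite card_prod !card_ord card_bool => <-.
  by apply: subset_leq_card; apply/subsetP => A; rewrite !inE andbT.
set c := (z, i, s, m); pose e := (z, L i s).
have cA A : chain_arc A c 0 = e by rewrite /chain_arc /chain_vertex /= addn0.
case: (boolP (e \in D)) => eD.
  rewrite [#|[pred _ | _]|](_ : _ = 0) //; apply: eq_card0 => A; rewrite !inE; apply/negP => /andP [_] /= /andP [/and5P [_]].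
  by rewrite /new_arcs /= cA eD.
have Dlt : #|D| < n * 2.
  apply: leq_trans (_ : #|e |: D| <= _); first by rewrite cardsU1 eD.
  by have := max_card (mem (e |: D)); rewrite card_prod card_ord card_bool.
have De : n * 2 - #|D| = (n * 2 - #|e |: D|).+1 by rewrite cardsU1 eD add1n -subnSK.
have e1 : n ^ size (c :: ch) = n ^ size ch * n by rewrite expnSr.
have e2 : Vm ^ size (c :: ch) = Vm * Vm ^ size ch by rewrite expnS.
have e3 : n ^ (n * 2 - #|D|) = n ^ (n * 2 - #|e |: D|) * n by rewrite De expnSr.
have split_e (P : pred (transitions n)) (Q : pred 'I_n) : (forall A, P A -> Q (A e)) ->
    #|P| = \sum_(t | Q t) #|[pred A : transitions n | P A && (A e == t)]|.
  move=> PQ; rewrite -sum1_card (partition_big (fun A => A e) Q) //.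
  by apply: eq_bigr => t _; rewrite sum1_card.
have agree A t : [forall e in D, A e == phi e] -> A e = t ->
    [forall f in e |: D, A f == update phi e t f].
  move=> /forall_inP H At; apply/forall_inP => f; rewrite /update !inE.
  by case: eqP => [-> _|_ /= /H //]; rewrite At.
case: m => [|m] in c cA leN leV e1 e2 *.
  rewrite (split_e _ (mem vis)) => [|A]; last first.
    rewrite !inE => /andP [_] /= /andP [/and5P [_ _ _ _]].
    by rewrite /new_vertices /= in_nil orbF /chain_vertex /= addn0.
  rewrite big_distrl /= e3 e2.
  apply: leq_trans (_ : \sum_(t in vis) (n ^ (n * 2 - #|e |: D|) * Vm ^ size ch * n) <= _); last first.
    have vV : #|vis| <= Vm := leq_trans (leq_addr _ _) leV.
    rewrite sum_nat_const (leq_trans (leq_mul vV (leqnn _))) //.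
    by rewrite leq_eqVlt; apply/orP; left; apply/eqP; ring.
  apply: leq_sum => t tv; rewrite e1 mulnA leq_mul2r; apply/orP; right.
  have lN : chain_sum ch + size ch < N by move: leN; rewrite /chain_sum big_cons /=; lia.
  have lV : #|vis| + chain_sum ch <= Vm by move: leV; rewrite /chain_sum big_cons.
  apply: leq_trans (IH ch (e |: D) vis (update phi e t) lN lV).
  rewrite leq_mul2r; apply/orP; right; apply: subset_leq_card; apply/subsetP => A; rewrite !inE.
  case/andP => /andP [ag /= /andP [_ st]] /eqP At; rewrite (agree A t) //=.
  move: st; rewrite /add_arcs /add_vertices /new_arcs /new_vertices /= cA.
  rewrite (_ : _ :|: [set e' in _] = e |: D); last by apply/setP => f; rewrite !inE orbC.
  by rewrite (_ : _ :|: [set x in _] = vis) //; apply/setP => f; rewrite !inE orbF.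
rewrite (split_e _ predT) // big_distrl /= e3.
apply: leq_trans (_ : \sum_(t : 'I_n) (n ^ (n * 2 - #|e |: D|) * Vm ^ size (c :: ch)) <= _); last first.
  by rewrite sum_nat_const card_ord leq_eqVlt; apply/orP; left; apply/eqP; ring.
apply: leq_sum => t _.
case: (boolP (t \in vis)) => tv.
  rewrite [#|[pred _ | _]|](_ : _ = 0) //; apply: eq_card0 => A; rewrite !inE; apply/negP => /andP [/andP [_ st] /eqP At].
  by have [] // := sat_next _ st; rewrite cA At tv.
pose c' : chain := (t, i, s.+1, m).
have lN : chain_sum (c' :: ch) + size (c' :: ch) < N by move: leN; rewrite /chain_sum !big_cons /=; lia.
have lV : #|t |: vis| + chain_sum (c' :: ch) <= Vm.
  by move: leV; rewrite cardsU1 tv add1n /chain_sum !big_cons /=; move: #|vis| => w; lia.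
apply: leq_trans (IH (c' :: ch) (e |: D) (t |: vis) (update phi e t) lN lV).
rewrite leq_mul2r; apply/orP; right; apply: subset_leq_card; apply/subsetP => A; rewrite !inE.
case/andP => /andP [ag st] /eqP At; rewrite (agree A t) //=.
have [] // := sat_next _ st; rewrite cA At => _ _.
by rewrite /chain_next /= -/e At.
Qed.

End Explore.

(** * Short chains explore the whole residual configuration *)

Section Completeness.
Variables (n : nat) (I : finType) (k : nat) (L : I -> nat -> bool).
Hypothesis k_gt0 : 0 < k.
Hypothesis L_per : forall i j, L i (j + k) = L i j.
Hypothesis sep : forall i i' s s',
  (forall m, m < k -> L i (s + m) = L i' (s' + m)) -> i = i' /\ s = s' %[mod k].
Variable X : bigconf n I.
Hypothesis vX : valid k L X.
Hypothesis rX : residual k L X.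
Implicit Type i : I.
Local Notation A := X.1.
Local Notation tok := (tok k L X).
Local Notation branch := (branch k L X).

Definition used (e : 'I_n * bool) := exists i s, tok i e.1 s /\ L i s = e.2.

Variable K : {set 'I_n}.
Hypothesis branchK : branch \subset K.

(** Invariant of the exploration. A vertex outside [K] is not a branch vertex, so its only used arc
    is revealed together with it; only the arcs that leave [K] may still be pending. *)
Definition explored (D : {set 'I_n * bool}) (vis : {set 'I_n}) :=
  [/\ K \subset vis, forall e, e \in D -> [/\ e.1 \in vis, A e \in vis & used e]
    & forall e, e.1 \in vis -> e.1 \notin K -> used e -> e \in D].

Lemma free_unique i x : x \in cG (X.2 i) ->
  (forall i' s', tok i' (hmap k L A i x) s' -> i = i' /\ k.-1 = s' %[mod k]) -> free k L X i x.
Proof.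
move=> xG uniq; rewrite /free xG; apply/forallP => i'; apply/forall_inP => y yG.
apply/forallP => j; apply/implyP => /eqP [E _].
have ty : tok i' (hmap k L A i x) j by exists y, j; rewrite E; split.
have [ii] := uniq _ _ ty.
rewrite !modn_small ?prednK // => kj; rewrite -ii eqxx -kj eqxx andbT /=.
by rewrite -ii -kj in E yG; rewrite (block_inj vX yG xG (leqnn _) E).
Qed.

(** If 3k new vertices followed one another, the phase k - 1 would occur twice among the first 2k of
    them. Each time, the next k vertices avoid [branch], so the arc read there is a free last arc of
    word [i]: two free arcs, against residuality. *)
Lemma chain_exists D vis z i s : explored D vis -> z \in K -> tok i z s ->
  (z, L i s) \notin D ->
  exists2 m, m < 3 * k & sat_chain L A D vis (z, i, s, m) /\
    explored (add_arcs L A D (z, i, s, m)) (add_vertices L A vis (z, i, s, m)).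
Proof.
move=> [Kvis ID Ivis] zK tz zD; pose y p := walk A (L i) s z p.
have ty p : tok i (y p) (s + p) by exact: tok_walk.
pose hit p := (y p.+1 \in vis) || (y p.+1 \in [seq y q | q <- iota 1 p]).
have new_lt P : (forall p, p < P -> ~~ hit p) -> forall q p, q < p -> p <= P -> y q != y p.
  move=> nh q [//|p]; rewrite ltnS => qp pP; have := nh p pP; rewrite negb_or => /andP [yv].
  case: q qp => [_|q qp]; first by move=> _; apply: contraNneq yv => <-; exact: subsetP Kvis _ zK.
  by apply: contraNneq => <-; apply: map_f; rewrite mem_iota; lia.
have ex : exists m, (m < 3 * k) && hit m.
  apply: contrapT => nex.
  have nh p : p < 3 * k -> ~~ hit p by move=> pk; apply/negP => h; apply: nex; exists p; rewrite pk.
  have neq := new_lt _ nh.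
  have nv p : 0 < p <= 3 * k -> y p \notin vis.
    by case: p => // p pk; have := nh p pk; rewrite negb_or => /andP [].
  have nb p : 0 < p <= 3 * k -> y p \notin branch.
    by move=> /nv; apply: contra => /(subsetP branchK) /(subsetP Kvis).
  have fr p : 0 < p <= 2 * k -> s + p = k.-1 %[mod k] -> exists2 x, free k L X i x & hmap k L A i x = y p.
    move=> pk sp; have [x [j [xG jk yE sj]]] := ty p.
    have jE : j = k.-1 by move: sj; rewrite sp !modn_small ?prednK.
    have hE : hmap k L A i x = y p by rewrite yE jE.
    exists x => //; apply: free_unique => // i' s'; rewrite hE => t'.
    rewrite -sp; apply: (tok_unique k_gt0 L_per sep vX (ty p) t') => m mk.
    rewrite -walkD; apply: nb; case/andP: pk => p1 pk.
    by rewrite addn_gt0 p1 /= addnC (mulSn 2) leq_add // ltnW.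
  (* The first positive position at phase k - 1: modulo k, (s + 2)(k - 1) is -(s + 2). *)
  pose p0 := ((s.+2 * k.-1) %% k).+1.
  have p0k : p0 <= k by rewrite ltn_pmod.
  have sp0 : s + p0 = k.-1 %[mod k].
    rewrite /p0 addnS -addSn modnDmr -[RHS](modnMDl s.+1); congr (_ %% _); nia.
  have r1 : 0 < p0 <= 2 * k by move: p0k; rewrite /p0; lia.
  have r2 : 0 < p0 + k <= 2 * k by move: p0k; rewrite /p0; lia.
  have sp1 : s + (p0 + k) = k.-1 %[mod k] by rewrite addnA modnDr.
  have [x fx hx] := fr p0 r1 sp0; have [x' fx' hx'] := fr (p0 + k) r2 sp1.
  have := forallP rX i; rewrite leqNgt => /negP; apply; apply/card_gt1P.
  exists x, x'; rewrite !inE fx fx'; split=> //.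
  have : y p0 != y (p0 + k).
    apply: neq; first by rewrite -addn1 leq_add2l.
    by rewrite addnC (mulSn 2) leq_add2l; case/andP: r1.
  by apply: contraNneq => xx; rewrite -hx -hx' xx.
pose m := ex_minn ex.
have [mk hm mmin] : [/\ m < 3 * k, hit m & forall p, p < m -> ~~ hit p].
  rewrite /m; case: ex_minnP => m' /andP [mk hm] mmin; split=> // p pm.
  by apply/negP => hp; have := mmin p; rewrite hp (ltn_trans pm mk) => /(_ isT); rewrite leqNgt pm.
have neq := new_lt m mmin.
have yinj p q : p <= m -> q <= m -> y p = y q -> p = q.
  move=> pm qm E; case: (ltngtP p q) => // lt; first by have := neq _ _ lt qm; rewrite E eqxx.
  by have := neq _ _ lt pm; rewrite E eqxx.
have nv p : 0 < p <= m -> y p \notin vis.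
  by case: p => // p pk; have := mmin p pk; rewrite negb_or => /andP [].
set c := (z, i, s, m).
have vE p : chain_vertex L A c p = y p by [].
exists m => //; split.
  apply/and5P; split.
  - rewrite map_inj_in_uniq ?iota_uniq // => p q; rewrite !mem_iota add0n !ltnS => pm qm [E _].
    exact: (yinj p q pm qm E).
  - apply/allP => e /mapP [p]; rewrite mem_iota /= add0n ltnS => pm ->.
    case: p pm => [_|p pm]; first by rewrite /chain_arc /chain_vertex /= addn0.
    by apply/negP => /ID [/=]; rewrite vE (negbTE (nv _ _)).
  - rewrite map_inj_in_uniq ?iota_uniq // => p q; rewrite !mem_iota add1n !ltnS => /andP [_ pm] /andP [_ qm] E.
    exact: (yinj p q pm qm E).
  - by apply/allP => e /mapP [p]; rewrite mem_iota add1n ltnS => pm ->; exact: nv.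
  - exact: hm.
have uE p : used (chain_arc L A c p) by exists i, (s + p); split; first exact: ty.
have newE x : x \in new_vertices L A c = [exists p : 'I_m, x == y p.+1].
  apply/mapP/existsP => [[p]|[p /eqP ->]]; last by exists p.+1; rewrite ?mem_iota //= add1n ltnS ltn_ord.
  rewrite mem_iota add1n ltnS; case: p => // p /= lt ->.
  by exists (Ordinal lt).
have vis' p : p <= m.+1 -> y p \in add_vertices L A vis c.
  rewrite in_add_vertices leq_eqVlt ltnS => /orP [/eqP ->|]; last case: p => [_|p pm].
  - exact: hm.
  - by rewrite (subsetP Kvis _ zK).
  by rewrite newE; apply/orP; right; apply/existsP; exists (Ordinal pm).
split.
- exact: subset_trans Kvis (subsetUl _ _).
- move=> e; rewrite in_add_arcs => /orP [/ID [ev Av ue]|]; first by rewrite !in_add_vertices ev Av.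
  move=> /mapP [p]; rewrite mem_iota add0n ltnS => /= pm ->; split; last exact: uE.
    exact: (vis' p (leqW pm)).
  exact: (vis' p.+1 pm).
move=> e; rewrite in_add_vertices in_add_arcs => /orP [ev eK ue|]; first by rewrite Ivis.
rewrite newE => /existsP [p /eqP e1] eK [i' [s' [t' E]]].
apply/orP; right; apply/mapP; exists p.+1; first by rewrite mem_iota /= add0n ltnS.
rewrite (surjective_pairing e) /chain_arc vE e1 -E; congr (_, _).
have := ty p.+1; rewrite -e1 => t; apply: (same_letter t' t).
by apply: contra eK => /(subsetP branchK).
Qed.

Lemma chains_exist (src : seq ('I_n * I * nat)) D vis : explored D vis ->
  (forall c, c \in src -> c.1.1 \in K /\ tok c.1.2 c.1.1 c.2) ->
  uniq [seq (c.1.1, L c.1.2 c.2) | c <- src] ->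
  (forall c, c \in src -> (c.1.1, L c.1.2 c.2) \notin D) ->
  exists2 ms, size ms = size src /\ all (fun m => m < 3 * k) ms &
    [/\ sat L A D vis (zip src ms),
        explored (final_arcs L A D (zip src ms)) (final_vertices L A vis (zip src ms)) &
        forall c, c \in src -> (c.1.1, L c.1.2 c.2) \in final_arcs L A D (zip src ms)].
Proof.
elim: src D vis => [|[[z i] s] src IH] D vis inv sK us sD; first by exists [::].
have [zK tz] := sK _ (mem_head _ _).
have [m mk [sc inv']] := chain_exists inv zK tz (sD _ (mem_head _ _)).
case/andP: us => us0 us.
have [Kvis ID _] := inv.
have sD' c : c \in src -> (c.1.1, L c.1.2 c.2) \notin add_arcs L A D (z, i, s, m).
  move=> cin; rewrite in_add_arcs; apply/norP; split; first by apply: sD; rewrite inE cin orbT.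
  apply/mapP => -[[|p]]; rewrite mem_iota add0n ltnS /= => pm.
    rewrite /chain_arc /chain_vertex /= addn0 => E; case/negP: us0.
    by apply/mapP; exists c.
  move=> [E _]; have [cK _] := sK c (mem_behead (s := _ :: _) cin).
  case/and5P: sc => _ _ _ /allP av _.
  have := av (chain_vertex L A (z, i, s, m) p.+1); rewrite /= -E.
  rewrite (subsetP Kvis _ cK) => H; apply: notF; apply: H.
  by rewrite E; apply: map_f; rewrite mem_iota add1n ltnS.
have [ms [sz ml] [st inv2 fin]] := IH _ _ inv' (fun c cin => sK c (mem_behead (s := _ :: _) cin)) us sD'.
exists (m :: ms); first by rewrite /= sz mk.
split; [by rewrite /= sc|exact: inv2|].
move=> c; rewrite inE => /orP [/eqP ->|]; last exact: fin.
have sub : forall ch (D' : {set 'I_n * bool}), D' \subset final_arcs L A D' ch.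
  by elim=> //= c' ch IHch D'; apply: subset_trans (IHch _); exact: subsetUl.
apply: (subsetP (sub (zip src ms) (add_arcs L A D (z, i, s, m)))); rewrite in_add_arcs; apply/orP; right.
apply/mapP; exists 0; first by rewrite mem_iota.
by rewrite /chain_arc /chain_vertex /= addn0.
Qed.

Hypothesis vK : forall i, cv (X.2 i) \in K.
Hypothesis freeK : forall i x, free k L X i x -> x \in K.

Lemma arc_follow D vis i z s : explored D vis ->
  (forall e, e.1 \in K -> used e -> e \in D) ->
  tok i z s -> z \in vis ->
  forall m, walk A (L i) s z m \in vis /\ (walk A (L i) s z m, L i (s + m)) \in D.
Proof.
move=> [Kvis ID Ivis] KD tz zv.
have step z' s' : tok i z' s' -> z' \in vis -> (z', L i s') \in D /\ A (z', L i s') \in vis.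
  move=> tz' zv'; have u : used (z', L i s') by exists i, s'.
  have eD : (z', L i s') \in D.
    by case: (boolP (z' \in K)) => zK; [exact: KD|exact: Ivis].
  by split=> //; have [] := ID _ eD.
elim=> [|m [wv wD]]; first by rewrite addn0; split=> //; case: (step z s tz zv).
have t := tok_walk k_gt0 L_per vX m tz.
have [_ wv'] := step _ _ t wv; split=> //.
by rewrite addnS; case: (step _ _ (tok_step k_gt0 L_per vX t) wv').
Qed.

(** A block on the cycle of the mark is reached from the mark. Any other one lies on a cycle of the
    map of its word: either its walk meets [branch], and going round the cycle from there comes back
    to it, or its last arc is free and it starts in [K]. *)
Lemma block_reached D vis i x : explored D vis ->
  (forall e, e.1 \in K -> used e -> e \in D) ->
  x \in cG (X.2 i) -> x \in vis.
Proof.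
move=> inv KD xG; have [Kvis _ _] := inv.
have giter q y : iter q (gmap k L A i) y = walk A (L i) 0 y (q * k) by rewrite walk_iter.
have tokG y : y \in cG (X.2 i) -> tok i y 0 by exact: tok_start.
have reach y q : y \in cG (X.2 i) -> y \in vis -> iter q (gmap k L A i) y \in vis.
  by move=> yG yv; rewrite giter; case: (arc_follow inv KD (tokG y yG) yv (q * k)).
have /andP [c _] := forallP vX i.
have [vG ps /forall_inP gs] := and3P c.
have vv := subsetP Kvis _ (vK i).
case: (boolP (x \in porbit (cs (X.2 i)) (cv (X.2 i)))) => [/porbitP [j ->]|xv].
  by have [_ [q ->]] := cfg0_fix_iter j c; apply: reach.
have sx j : (cs (X.2 i) ^+ j)%g x = iter j (gmap k L A i) x /\ (cs (X.2 i) ^+ j)%g x \in cG (X.2 i).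
  elim: j => [|j [IH jG]]; first by rewrite expg0 perm1.
  rewrite expgSr permM (perm_closed _ ps); split=> //.
  rewrite iterS -IH (eqP (gs _ jG)) /target; case: eqP => // sv.
  by case/negP: xv; rewrite porbit_sym; apply/porbitP; exists j.+1; rewrite expgSr permM.
pose o := #[cs (X.2 i)]%g.
have xo q : iter (q * o) (gmap k L A i) x = x.
  elim: q => // q IH; rewrite mulSn iterD IH.
  by have [<- _] := sx o; rewrite expg_order perm1.
case: (boolP `[< exists m, walk A (L i) 0 x m \in branch >]) => [/asboolP [m mb]|/asboolPn nb].
  have t := tok_walk k_gt0 L_per vX m (tokG x xG).
  have [] := arc_follow inv KD t (subsetP Kvis _ (subsetP branchK _ mb)) (m * o * k - m) => + _.
  rewrite -walkD subnKC; last by rewrite -mulnA leq_pmulr // muln_gt0 order_gt0 k_gt0.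
  by rewrite -giter xo.
apply: (subsetP Kvis); apply: (freeK (i := i)); apply: free_unique => // i' s' t'.
have th : tok i (hmap k L A i x) k.-1 by exists x, k.-1; split; rewrite ?prednK.
apply: (tok_unique k_gt0 L_per sep vX th t') => m mk.
by apply/negP => b; apply: nb; exists (k.-1 + m); rewrite walkD.
Qed.

End Completeness.

(** The root is the fixed point where the [g]-orbit of [v] ends, the same for both; on the rest of
    [G] the permutation is [g]. *)
Lemma cfg0_perm_unique n (v : 'I_n) g G s s' : cfg0 v g G s -> cfg0 v g G s' -> s = s'.
Proof.
move=> c c'; have [_ gr [a ra]] := cfg0_root c; have [_ gr' [b rb]] := cfg0_root c'.
have fixr r j : g r = r -> iter j g r = r by move=> gE; elim: j => //= j ->.
have rr : (s'^-1)%g v = (s^-1)%g v.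
  case: (leqP a b) => [ab|/ltnW ba].
    by rewrite rb -(subnK ab) iterD -ra fixr.
  by rewrite [RHS]ra -(subnK ba) iterD -rb fixr.
have [/and3P [_ ps /forall_inP gs] /and3P [_ ps' /forall_inP gs']] := (c, c').
apply/permP => x; case xG : (x \in G); last first.
  by rewrite (out_perm ps) ?xG // (out_perm ps') ?xG.
have svr (p : {perm 'I_n}) : (p x == v) = (x == (p^-1)%g v) by rewrite (canF_eq (permK p)).
have := gs x xG; rewrite /target svr; case: (x =P _) => [xr|xr] /eqP gx.
  by rewrite xr -{2}rr !permKV.
have := gs' x xG; rewrite /target svr rr; case: (x =P _) => // _ /eqP.
by rewrite gx.
Qed.

Lemma cfg0_cycle n (v : 'I_n) g G s x : cfg0 v g G s -> x \in G ->
  ~~ fconnect g v x -> exists2 q, 0 < q & iter q g x = x.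
Proof.
move=> c xG xv; have [vG ps /forall_inP gs] := and3P c.
have xp : x \notin porbit s v.
  apply: contra xv => /porbitP [j ->]; have [_ [i ->]] := cfg0_fix_iter j c.
  exact: fconnect_iter.
have sx j : (s ^+ j)%g x = iter j g x /\ (s ^+ j)%g x \in G.
  elim: j => [|j [IH jG]]; first by rewrite expg0 perm1.
  rewrite expgSr permM (perm_closed _ ps); split=> //.
  rewrite iterS -IH (eqP (gs _ jG)) /target; case: eqP => // sv.
  by case/negP: xp; rewrite porbit_sym; apply/porbitP; exists j.+1; rewrite expgSr permM.
by exists #[s]%g; rewrite ?order_gt0 //; have [<- _] := sx #[s]%g; rewrite expg_order perm1.
Qed.

(** * Configurations with given transitions and chains *)

Section Fiber.
Variables (n : nat) (I : finType) (k : nat) (L : I -> nat -> bool) (l0 : nat).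
Hypothesis k_gt0 : 0 < k.
Hypothesis L_per : forall i j, L i (j + k) = L i j.
Hypothesis win : forall i j, (forall t, t < l0 -> L i (j + t) = L i t) -> k %| j.
Variables (A : transitions n) (K : {set 'I_n}).
Notation chain := ('I_n * I * nat * nat)%type.
Implicit Types (c : chain) (ch : seq chain) (D : {set 'I_n * bool}) (vis : {set 'I_n}).

Lemma new_vertices_inj c p q : uniq (new_vertices L A c) ->
  0 < p <= c.2 -> 0 < q <= c.2 -> chain_vertex L A c p = chain_vertex L A c q -> p = q.
Proof.
move=> u; case: p q => [//|p] [//|q] /= pm qm E.
have sz : size (new_vertices L A c) = c.2 by rewrite size_map size_iota.
have := nth_uniq (chain_vertex L A c 0) (i := p) (j := q) _ _ u.
rewrite sz => /(_ pm qm).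
by rewrite !(nth_map 0) ?size_iota // !nth_iota // !add1n E eqxx => /esym /eqP ->.
Qed.

Lemma in_new_arcs c e : reflect (exists2 p, p <= c.2 & e = chain_arc L A c p) (e \in new_arcs L A c).
Proof.
apply: (iffP mapP) => [[p]|[p pc ->]]; last by exists p; rewrite // mem_iota.
by rewrite mem_iota add0n ltnS => /= pm ->; exists p.
Qed.

Lemma in_new_vertices c x :
  reflect (exists2 p, 0 < p <= c.2 & x = chain_vertex L A c p) (x \in new_vertices L A c).
Proof.
apply: (iffP mapP) => [[p]|[p pc ->]]; last by exists p; rewrite // mem_iota add1n ltnS.
by rewrite mem_iota add1n ltnS => pm ->; exists p.
Qed.

Lemma final_arcs_old ch D vis y e : sat L A D vis ch -> {in ch, forall c, c.1.1.1 \in K} ->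
  y \in vis -> y \notin K -> e \in final_arcs L A D ch -> e.1 = y -> e \in D.
Proof.
elim: ch D vis => //= c ch IH D vis /andP [sc st] cK yv yK eD ey.
have := IH _ _ st (fun c' c'in => cK c' (mem_behead (s := _ :: _) c'in)) _ yK eD ey.
rewrite in_add_vertices yv in_add_arcs => /(_ isT) /orP [//|/in_new_arcs [p pm eE]].
have eV : e.1 = chain_vertex L A c p by rewrite eE.
case: p pm eE eV => [|p] pm eE eV.
  by case/negP: yK; rewrite -ey eV; exact: cK (mem_head _ _).
case/and5P: sc => _ _ _ /allP av _; have := av (chain_vertex L A c p.+1).
rewrite /= -eV ey yv => H; suff : false by []; apply: H; rewrite -ey eV; apply/in_new_vertices.
by exists p.+1.
Qed.

(** A vertex discovered by a chain has no other revealed arc than the one by which this chain leaves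
    it. A walk on revealed arcs therefore has to follow the chain. *)
Lemma forced_arc ch D vis c p e : sat L A D vis ch -> {in ch, forall c, c.1.1.1 \in K} ->
  K \subset vis -> (forall e, e \in D -> e.1 \in vis) ->
  c \in ch -> 0 < p <= c.2 -> e \in final_arcs L A D ch -> e.1 = chain_vertex L A c p ->
  e = chain_arc L A c p.
Proof.
elim: ch D vis => //= c' ch IH D vis /andP [sc st] cK Kv Dv cin pm eD ey.
have cK' : {in ch, forall c, c.1.1.1 \in K} by move=> c2 c2in; apply: cK; rewrite inE c2in orbT.
have nvis : c = c' -> chain_vertex L A c p \notin vis.
  move=> cE; case/and5P: sc => _ _ _ /allP /(_ (chain_vertex L A c p)) /= av _.
  by apply: av; rewrite -cE; apply/in_new_vertices; exists p.
move: cin; rewrite inE => /orP [/eqP cE|cin]; last first.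
  apply: (IH _ _ st cK' _ _ cin pm eD ey).
    by apply: subset_trans Kv _; exact: subsetUl.
  move=> e'; rewrite in_add_arcs in_add_vertices => /orP [/Dv -> //|/in_new_arcs [[|q] qm ->]].
    by rewrite (subsetP Kv) //; exact: cK (mem_head _ _).
  by apply/orP; right; apply/in_new_vertices; exists q.+1.
have {}nvis := nvis cE; rewrite -{}cE in sc st cK eD.
have yK : chain_vertex L A c p \notin K by apply: contra nvis => /(subsetP Kv).
have : e \in add_arcs L A D c.
  apply: (final_arcs_old st cK' _ yK eD ey).
  by rewrite in_add_vertices; apply/orP; right; apply/in_new_vertices; exists p.
rewrite in_add_arcs => /orP [/Dv|/in_new_arcs [q qm eE]].
  by rewrite ey (negbTE nvis).
have eV : e.1 = chain_vertex L A c q by rewrite eE.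
case: q qm eE eV => [|q] qm eE eV.
  by case/negP: yK; rewrite -ey eV; exact: cK (mem_head _ _).
rewrite eE; congr chain_arc; case/and5P: sc => _ _ u _ _.
by apply: (new_vertices_inj u) => //; rewrite -eV -ey.
Qed.

Lemma final_vertex ch vis x : x \in final_vertices L A vis ch ->
  x \in vis \/ exists2 c, c \in ch & x \in new_vertices L A c.
Proof.
elim: ch vis => [|c ch IH] vis /=; first by left.
case/IH => [|[c' c'in xc]]; last by right; exists c'; rewrite ?inE ?c'in ?orbT.
by rewrite in_add_vertices => /orP [->|xc]; [left|right; exists c; rewrite ?mem_head].
Qed.

Variable ch : seq chain.
Hypothesis sat_ch : sat L A set0 K ch.
Hypothesis ch_K : {in ch, forall c, c.1.1.1 \in K}.
Local Notation D := (final_arcs L A set0 ch).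
Local Notation vis := (final_vertices L A K ch).

Lemma forced c p e : c \in ch -> 0 < p <= c.2 -> e \in D -> e.1 = chain_vertex L A c p ->
  e = chain_arc L A c p.
Proof. by apply: (forced_arc sat_ch ch_K (subxx _)) => e'; rewrite inE. Qed.

Lemma chain_follow c p l x : c \in ch -> 0 < p -> x = chain_vertex L A c p ->
  (forall m, (walk A l 0 x m, l m) \in D) ->
  forall t, p + t <= c.2 -> walk A l 0 x t = chain_vertex L A c (p + t) /\
    l t = L c.1.1.2 (c.1.2 + (p + t)).
Proof.
move=> cin p0 xE xD; elim=> [|t IH] pt.
  rewrite addn0 in pt *; split=> //.
  have := forced cin _ (xD 0) xE; rewrite p0 pt => /(_ isT).
  by rewrite /chain_arc => -[].
have [w lt] := IH (leq_trans (leq_add (leqnn _) (leqnSn _)) pt).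
have w' : walk A l 0 x t.+1 = chain_vertex L A c (p + t.+1).
  by rewrite /= add0n w lt /chain_vertex addnS.
split=> //; have := forced cin _ (xD t.+1) w'.
by rewrite addn_gt0 p0 pt => /(_ isT); rewrite /chain_arc => -[].
Qed.

(** Both walks follow the chain and read its letters, and [l0] letters remain after [p']. So word
    [i] shifted by p' - p starts with the prefix of length [l0] of word [i]; by [win], k divides p'
    - p, and the first block leads to the second. *)
Lemma deep_same i c p p' x x' : c \in ch -> 0 < p -> p <= p' -> p' + l0 <= c.2 ->
  x = chain_vertex L A c p -> x' = chain_vertex L A c p' ->
  (forall m, (walk A (L i) 0 x m, L i m) \in D) ->
  (forall m, (walk A (L i) 0 x' m, L i m) \in D) ->
  exists d, x' = iter d (gmap k L A i) x.
Proof.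
move=> cin p0 pp' pl xE xE' xD xD'.
have dk : k %| p' - p.
  apply: (@win i) => t tl.
  have e1 : p + (p' - p + t) <= c.2.
    by rewrite addnA subnKC // (leq_trans _ pl) // leq_add2l ltnW.
  have e2 : p' + t <= c.2 by rewrite (leq_trans _ pl) // leq_add2l ltnW.
  have [_ ->] := chain_follow cin p0 xE xD e1.
  have [_ ->] := chain_follow cin (leq_trans p0 pp') xE' xD' e2.
  by rewrite (addnA p) subnKC.
have e3 : p + (p' - p) <= c.2 by rewrite subnKC // (leq_trans _ pl) // leq_addr.
have [w _] := chain_follow cin p0 xE xD e3.
have xx : x' = walk A (L i) 0 x (p' - p) by rewrite w subnKC.
by exists ((p' - p) %/ k); rewrite xx -{1}(divnK dk) (walk_iter (L_per i)).
Qed.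

Definition shallow c := [seq chain_vertex L A c p | p <- iota (c.2.+1 - l0) l0].
Definition marked_vertices := K :|: [set x in flatten [seq shallow c | c <- ch]].

(** A block that starts in [K] or near the end of a chain is recorded by its vertex. For one that
    starts deep inside a chain the index of the chain is enough, by [deep_same]. This is where the
    long prefix of the words matters: few bits per chain describe arbitrarily many blocks. *)
Definition key x : 'I_n + 'I_(size ch).+1 :=
  if x \in marked_vertices then inl x
  else inr (inord (find (fun c => x \in new_vertices L A c) ch)).

Lemma card_marked_vertices : #|marked_vertices| <= #|K| + size ch * l0.
Proof.
apply: leq_trans (leq_card_setU _ _) _; rewrite leq_add2l.
rewrite cardsE; apply: leq_trans (card_size _) _.
elim: ch => //= c ch' IH; rewrite size_cat size_map size_iota mulSn leq_add2l //.
Qed.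

Lemma key_same i x x' : x \in vis -> x' \in vis ->
  (forall m, (walk A (L i) 0 x m, L i m) \in D) ->
  (forall m, (walk A (L i) 0 x' m, L i m) \in D) ->
  key x = key x' ->
  (exists d, x' = iter d (gmap k L A i) x) \/ (exists d, x = iter d (gmap k L A i) x').
Proof.
move=> xv xv' xD xD'; rewrite /key; case: ifP => xM; case: ifP => // xM' [].
  by move=> ->; left; exists 0.
have deep y : y \in vis -> y \in marked_vertices = false ->
    [/\ find (fun c => y \in new_vertices L A c) ch < size ch &
      exists2 p, 0 < p & y = chain_vertex L A (nth (y, i, 0, 0)
         ch (find (fun c => y \in new_vertices L A c) ch)) p /\
        p + l0 <= (nth (y, i, 0, 0) ch (find (fun c => y \in new_vertices L A c) ch)).2].
  move=> yv yM; have hs : has (fun c => y \in new_vertices L A c) ch.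
    case: (final_vertex yv) => [yK|[c cin yc]]; first by rewrite inE yK in yM.
    by apply/hasP; exists c.
  rewrite -has_find; split=> //.
  have := nth_find (y, i, 0, 0) hs; set c := nth _ _ _.
  have cin : c \in ch by apply: mem_nth; rewrite -has_find.
  case/in_new_vertices => p /andP [p0 pc] yE; exists p => //; split=> //.
  rewrite leqNgt; apply: contraFN yM => lt; rewrite inE; apply/orP; right.
  rewrite inE; apply/flatten_mapP; exists c => //; rewrite yE; apply: map_f.
  rewrite mem_iota; apply/andP; split; first by rewrite leq_subLR addnC.
  case: (leqP l0 c.2.+1) => h; first by rewrite subnK ?ltnS.
  by apply: leq_trans (leq_addl _ _); exact: leq_trans (leq_ltn_trans pc (ltnSn _)) (ltnW h).
have [f1 [p p0 [xE pl]]] := deep x xv xM; have [f2 [p' p0' [xE' pl']]] := deep x' xv' xM'.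
move/(congr1 (@nat_of_ord _)); rewrite !inordK ?ltnS ?(ltnW f1) ?(ltnW f2) // => ff.
rewrite -ff in f2 xE' pl'; rewrite (set_nth_default (x, i, 0, 0)) // in xE' pl'.
move: xE xE' pl pl'; set c := nth _ _ _ => xE xE' pl pl'.
have cin : c \in ch by apply: mem_nth.
case: (leqP p p') => [pp|/ltnW pp]; [left|right].
  exact: (deep_same cin p0 pp pl' xE xE' xD xD').
exact: (deep_same cin p0' pp pl xE' xE xD' xD).
Qed.

Definition covered (X : bigconf n I) := [/\ valid k L X, X.1 = A, forall i, cv (X.2 i) \in K &
  forall i x, x \in cG (X.2 i) -> x \in vis /\ forall m, (walk A (L i) 0 x m, L i m) \in D].

(** The orbit of the mark is determined by the mark, so only the keys of the other blocks, which lie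
    on cycles, are recorded. *)
Definition keyset (X : bigconf n I) : {ffun I -> 'I_n * {set 'I_n + 'I_(size ch).+1}} :=
  [ffun i => (cv (X.2 i), [set key x | x in cG (X.2 i) & ~~ fconnect (gmap k L A i) (cv (X.2 i)) x])].

Lemma keyset_sub X Y i : covered X -> covered Y -> keyset X = keyset Y ->
  cG (X.2 i) \subset cG (Y.2 i).
Proof.
move=> [vX XA _ cX] [vY YA _ cY] /ffunP /(_ i); rewrite !ffunE => -[vE sE].
have /andP [c _] := forallP vX i; have /andP [c' _] := forallP vY i.
rewrite XA in c; rewrite YA in c'.
apply/subsetP => x xG.
case: (boolP (fconnect (gmap k L A i) (cv (X.2 i)) x)) => [|xv].
  by rewrite vE => /iter_findex <-; exact: cfg0_iter c'.
have : key x \in [set key x | x in cG (X.2 i) & ~~ fconnect (gmap k L A i) (cv (X.2 i)) x].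
  by apply: imset_f; rewrite inE xG.
rewrite sE => /imsetP [x']; rewrite inE => /andP [xG' _] kE.
have gY y d : y \in cG (Y.2 i) -> iter d (gmap k L A i) y \in cG (Y.2 i).
  move=> yG; elim: d => //= d IH; have := gmap_in vY IH.
  by rewrite YA.
have [xvis xD] := cX i x xG; have [xvis' xD'] := cY i x' xG'.
have [[d dE]|[d ->]] := key_same xvis xvis' xD xD' kE; last exact: gY.
(* As [x] is on a cycle of length dividing q, it is reached back from g^d x, after d * q - d further
   blocks. *)
have [q q0 qE] := cfg0_cycle c xG xv.
have xq t : iter (t * q) (gmap k L A i) x = x.
  by elim: t => // t IH; rewrite mulSn iterD IH.
have le : d <= d * q by rewrite leq_pmulr.
by rewrite -(xq d) -(subnK le) iterD -dE; apply: gY.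
Qed.

Lemma keyset_inj X Y : covered X -> covered Y -> keyset X = keyset Y -> X = Y.
Proof.
move=> cX cY E.
have GE i : cG (X.2 i) = cG (Y.2 i).
  by apply/eqP; rewrite eqEsubset (keyset_sub i cX cY E) (keyset_sub i cY cX (esym E)).
move: cX cY => [vX XA _ cX] [vY YA _ cY].
rewrite (surjective_pairing X) (surjective_pairing Y) XA YA; congr (_, _).
apply/ffunP => i; rewrite (surjective_pairing (X.2 i)) (surjective_pairing (Y.2 i)).
rewrite (surjective_pairing (X.2 i).1) (surjective_pairing (Y.2 i).1).
have /ffunP /(_ i) := E; rewrite !ffunE => -[vE _].
rewrite vE GE; congr (_, _).
have /andP [c _] := forallP vX i; have /andP [c' _] := forallP vY i.
by rewrite XA vE GE in c; rewrite YA in c'; exact: cfg0_perm_unique c c'.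
Qed.

Lemma card_covered :
  #|[pred X | `[< covered X >]]| <=
    (#|K| * 2 ^ (#|K| + size ch * l0 + (size ch).+1)) ^ #|I|.
Proof.
pose Ks : {set 'I_n + 'I_(size ch).+1} :=
  [set inl x | x in marked_vertices] :|: [set inr j | j in [set: 'I_(size ch).+1]].
pose Sv := setX K (powerset Ks).
rewrite -(@card_in_image _ _ keyset); last first.
  by move=> X Y; rewrite !inE => /asboolP cX /asboolP cY; exact: keyset_inj.
apply: leq_trans (_ : #|[pred f : {ffun I -> 'I_n * {set 'I_n + 'I_(size ch).+1}} | f \in ffun_on (mem Sv)]| <= _).
  apply: subset_leq_card; apply/subsetP => f /imageP [X]; rewrite inE => /asboolP [_ _ vK cX] ->.
  rewrite inE; apply/ffun_onP => i; rewrite ffunE inE vK /= inE; apply/subsetP => y /imsetP [x _ ->].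
  rewrite inE /key; case: ifP => xM; first by rewrite imset_f.
  by apply/orP; right; apply: imset_f; rewrite inE.
rewrite card_ffun_on; apply: (@leq_trans (#|Sv| ^ #|I|)); first by [].
have Ksc : #|Ks| <= #|K| + size ch * l0 + (size ch).+1.
  apply: leq_trans (leq_card_setU _ _) _.
  rewrite !card_imset ?cardsT ?card_ord ?leq_add2r; first exact: card_marked_vertices.
    by move=> x y [].
  by move=> x y [].
have [->|I0] := posnP #|I|; first by rewrite !expn0.
by rewrite leq_exp2r // /Sv cardsX card_powerset leq_mul2l leq_pexp2l ?orbT.
Qed.

End Fiber.

(** * Encoding and counting the residual configurations *)

Section Residual.
Variables (n : nat) (I : finType) (k : nat) (L : I -> nat -> bool) (l0 : nat).
Hypothesis k_gt0 : 0 < k.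
Hypothesis L_per : forall i j, L i (j + k) = L i j.
Hypothesis sep : forall i i' s s',
  (forall m, m < k -> L i (s + m) = L i' (s' + m)) -> i = i' /\ s = s' %[mod k].
Hypothesis win : forall i j, (forall t, t < l0 -> L i (j + t) = L i t) -> k %| j.
Notation tag := (I * 'I_k * 'I_(3 * k))%type.
Implicit Type X : bigconf n I.

(** Besides the branch vertices, the sources that [block_reached] requires: marks and free blocks.
    Residuality allows at most one of each per word. *)
Definition start_set X :=
  ([set cv (X.2 i) | i in [set: I]] :|: [set x | [exists i, free k L X i x]]) :\: branch k L X.

Lemma card_start_set X : residual k L X -> #|start_set X| <= 2 * #|I|.
Proof.
move=> /forallP rX; apply: leq_trans (subset_leq_card (subsetDl _ _)) _.
apply: leq_trans (leq_card_setU _ _) _; rewrite mul2n -addnn leq_add //.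
  by apply: leq_trans (leq_imset_card _ _) _; rewrite cardsT.
have -> : [set x | [exists i, free k L X i x]] = \bigcup_i [set x | free k L X i x].
  by apply/setP => x; rewrite inE; apply/existsP/bigcupP => [[i fx]|[i _]]; [exists i; rewrite ?inE|rewrite inE; exists i].
apply: leq_trans (_ : \sum_(i : I) #|[set x | free k L X i x]| <= _).
  elim/big_rec2: _ => [|i S T _ IH]; first by rewrite cards0.
  by apply: leq_trans (leq_card_setU _ _) _; rewrite leq_add2l.
by apply: leq_trans (leq_sum _ (fun i _ => rX i)) _; rewrite sum1_card.
Qed.

(** A branch vertex is the source of two chains, one per letter; another source has a single used
    arc. *)
Definition source_vertices (B : {set 'I_n}) (Z : seq 'I_n) := flatten [seq [:: b; b] | b <- enum B] ++ Z.

Lemma size_source_vertices B Z : size (source_vertices B Z) = 2 * #|B| + size Z.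
Proof. by rewrite size_cat cardE; congr (_ + _); elim: (enum B) => //= b s ->; rewrite mulnS. Qed.

Definition chains_of (zs : seq 'I_n) (ts : seq tag) : seq ('I_n * I * nat * nat) :=
  [seq (p.1, p.2.1.1, nat_of_ord p.2.1.2, nat_of_ord p.2.2) | p <- zip zs ts].

(** The branch set, the other sources, and for each chain a tag: the word that it follows, its
    initial phase and its length. *)
Notation code q u := ({set 'I_n} * u.-tuple 'I_n * (2 * q + u).-tuple tag)%type.

Definition code_known q u (c : code q u) := c.1.1 :|: [set x in c.1.2].
Definition code_chains q u (c : code q u) := chains_of (source_vertices c.1.1 c.1.2) c.2.

Definition code_sat q u (y : transitions n * code q u) :=
  (#|y.2.1.1| == q) && sat L y.1 set0 (code_known y.2) (code_chains y.2).

Definition known_max q u := q + u + (2 * q + u) * (3 * k).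

Lemma card_code_known q u (c : code q u) : #|c.1.1| = q -> #|code_known c| <= q + u.
Proof.
move=> cq; apply: leq_trans (leq_card_setU _ _) _; rewrite cq leq_add2l cardsE.
by apply: leq_trans (card_size _) _; rewrite size_tuple.
Qed.

Lemma size_code_chains q u (c : code q u) : #|c.1.1| = q -> size (code_chains c) = 2 * q + u.
Proof.
by move=> cq; rewrite size_map size_zip size_source_vertices cq !size_tuple minnn.
Qed.

Lemma card_code_sat q u : #|[pred y | @code_sat q u y]| * n ^ (2 * q + u) <=
  'C(n, q) * n ^ u * (3 * #|I| * k ^ 2) ^ (2 * q + u) * (n ^ (n * 2) * known_max q u ^ (2 * q + u)).
Proof.
pose F (c : code q u) := #|[pred A : transitions n | sat L A set0 (code_known c) (code_chains c)]|.
have -> : #|[pred y | @code_sat q u y]| = \sum_(c : code q u | #|c.1.1| == q) F c.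
  rewrite -sum1_card (eq_bigl (fun y : transitions n * code q u =>
     (#|y.2.1.1| == q) && sat L y.1 set0 (code_known y.2) (code_chains y.2))) //.
  rewrite (reindex (fun p : code q u * transitions n => (p.2, p.1))) /=; last first.
    by exists (fun p => (p.2, p.1)) => [[]|[]].
  rewrite -(pair_big_dep (fun c : code q u => #|c.1.1| == q)
    (fun c A => sat L A set0 (code_known c) (code_chains c)) (fun _ _ => 1)) /=.
  by apply: eq_bigr => c _; rewrite sum1_card.
rewrite big_distrl /=.
apply: leq_trans (_ : \sum_(c : code q u | #|c.1.1| == q)
    (n ^ (n * 2) * known_max q u ^ (2 * q + u)) <= _).
  apply: leq_sum => c /eqP cq.
  have sum_le : chain_sum (code_chains c) <= (2 * q + u) * (3 * k).
    rewrite -(size_code_chains cq) /chain_sum /code_chains /chains_of size_map.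
    elim: (zip _ _) => [|p s IH]; first by rewrite big_nil.
    rewrite /= big_cons (mulSn (size s)) leq_add //.
    by apply: ltnW; exact: ltn_ord.
  have le : #|code_known c| + chain_sum (code_chains c) <= known_max q u.
    by rewrite leq_add // card_code_known.
  have := count_sat L set0 (fun e => e.1) le.
  rewrite cards0 subn0 (size_code_chains cq); apply: leq_trans; rewrite leq_mul2r.
  apply/orP; right; apply: subset_leq_card; apply/subsetP => A; rewrite !inE => ->.
  by rewrite andbT; apply/forall_inP => e; rewrite inE.
rewrite sum_nat_const leq_mul2r; apply/orP; right.
apply: (@leq_trans #|setX (setX [set B : {set 'I_n} | #|B| == q] [set: u.-tuple 'I_n]) [set: (2 * q + u).-tuple tag]|).
  by apply: subset_leq_card; apply/subsetP => -[[B Z] t]; rewrite !inE /= !andbT.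
rewrite !cardsX !cardsT card_draws !card_tuple !card_prod !card_ord leq_eqVlt; apply/orP; left.
by apply/eqP; congr (_ * _ ^ _); ring.
Qed.

Definition enum_arcs (B : {set 'I_n}) : seq ('I_n * bool) := flatten [seq [:: (b, false); (b, true)] | b <- enum B].

Lemma residual_code X q u : valid k L X -> residual k L X ->
  #|branch k L X| = q -> 0 < q -> #|start_set X| = u ->
  exists2 y : transitions n * code q u, code_sat y &
    covered k L y.1 (code_known y.2) (code_chains y.2) X.
Proof.
move=> vX rX Bq q0 Zu.
set B := branch k L X in Bq; set Z := start_set X in Zu.
pose K := B :|: Z.
have BK : branch k L X \subset K by exact: subsetUl.
have [b bB] : exists b, b \in B by apply/card_gt0P; rewrite Bq.
have k3 : 0 < 3 * k by rewrite muln_gt0.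
have [i0 _] : exists i0 : I, True by move: bB; rewrite inE => /andP [/asboolP [i _] _]; exists i.
have [f fP] : {f : 'I_n * bool -> I * 'I_k & forall e, used k L X e ->
    tok k L X (f e).1 e.1 (f e).2 /\ L (f e).1 (f e).2 = e.2}.
  apply: (choice (P := fun e (y : I * 'I_k) => used k L X e -> tok k L X y.1 e.1 y.2 /\ L y.1 y.2 = e.2)) => e.
  case: (pselect (used k L X e)) => [[i [s [t E]]]|nu]; last by exists (i0, Ordinal k_gt0).
  exists (i, Ordinal (ltn_pmod s k_gt0)) => _ /=; rewrite (per_mod (L_per i)); split=> //.
  by apply: tok_mod t; rewrite modn_mod.
have usedZ z : z \in Z -> exists c, used k L X (z, c).
  rewrite inE => /andP [_]; rewrite inE => /orP [/imsetP [i _ ->]|].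
    have /andP [/and3P [vG _ _] _] := forallP vX i.
    by exists (L i 0), i, 0; split=> //; exact: tok_start.
  rewrite inE => /existsP [i /andP [xG _]].
  by exists (L i 0), i, 0; split=> //; exact: tok_start.
have [g gP] : {g : 'I_n -> bool & forall z, z \in Z -> used k L X (z, g z)}.
  apply: (choice (P := fun z c => z \in Z -> used k L X (z, c))) => z.
  by case: (boolP (z \in Z)) => [/usedZ [c cu]|_]; [exists c|exists true].
pose arcs := enum_arcs B ++ [seq (z, g z) | z <- enum Z].
pose src := [seq (e.1, (f e).1, nat_of_ord (f e).2) | e <- arcs].
have inB e : (e \in enum_arcs B) = (e.1 \in B).
  apply/flatten_mapP/idP => [[b']|eB]; first by rewrite mem_enum !inE => b'B /orP [] /eqP ->.
  by exists e.1; rewrite ?mem_enum // !inE; case: e eB => z [] /= _; rewrite !xpair_eqE eqxx ?orbT.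
have inZ e : (e \in [seq (z, g z) | z <- enum Z]) = (e.1 \in Z) && (e.2 == g e.1).
  apply/mapP/andP => [[z]|[eZ /eqP e2]]; first by rewrite mem_enum => zZ ->.
  by exists e.1; rewrite ?mem_enum // -e2; case: e {eZ e2}.
have arcs_used e : e \in arcs -> used k L X e.
  rewrite mem_cat inB inZ => /orP [eB|/andP [eZ /eqP e2]]; last first.
    by rewrite (surjective_pairing e) e2; exact: gP.
  move: eB; rewrite inE => /andP [/asboolP [i [s [t Ls]]] /asboolP [i' [s' [t' Ls']]]].
  case E: e.2; first by exists i, s; rewrite E Ls.
  by exists i', s'; rewrite E (negbTE Ls').
have arcsK e : e \in arcs -> e.1 \in K.
  by rewrite mem_cat inB inZ in_setU => /orP [->|/andP [-> _]]; rewrite ?orbT.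
have srcE : [seq (c.1.1, L c.1.2 c.2) | c <- src] = arcs.
  rewrite -map_comp -[RHS]map_id; apply/eq_in_map => e /arcs_used /fP [_ /= ->].
  by case: e.
have uarcs : uniq arcs.
  rewrite cat_uniq; apply/and3P; split.
  - rewrite /enum_arcs; elim: (enum B) (enum_uniq B) => //= b' s IH /andP [bs us].
    rewrite !inE !xpair_eqE eqxx /= IH // andbT; apply/andP; split;
      by apply/flatten_mapP => -[b2 b2s]; rewrite !inE !xpair_eqE => /orP [] /andP [/eqP bb _]; rewrite bb b2s in bs.
  - apply/hasPn => e; rewrite inB inZ => /andP [+ _].
    by rewrite in_setD => /andP [].
  - by rewrite map_inj_uniq ?enum_uniq // => z z' [].
have inv0 : explored k L X K set0 K by split=> // [e|e ->] //; rewrite inE.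
have [|||ms [sz msk] [st inv fin]] := chains_exist k_gt0 L_per sep vX rX BK inv0 (src := src).
- move=> c /mapP [e ein ->] /=; split; first exact: arcsK.
  by have [] := fP e (arcs_used e ein).
- by rewrite srcE.
- by move=> c _; rewrite inE.
have arcsD e : e \in arcs -> e \in final_arcs L X.1 set0 (zip src ms).
  by rewrite -srcE => /mapP [c cin ->]; exact: fin.
have KD e : e.1 \in K -> used k L X e -> e \in final_arcs L X.1 set0 (zip src ms).
  rewrite in_setU => /orP [eB|eZ] ue; apply: arcsD; rewrite mem_cat inB ?eB //.
  apply/orP; right; rewrite inZ eZ /=; have [i [s [t Ls]]] := gP _ eZ; have [i' [s' [t' Ls']]] := ue.
  apply/eqP; rewrite -[g e.1]/((e.1, g e.1).2) -Ls -Ls'; apply: (same_letter t' t).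
  by move: eZ; rewrite in_setD => /andP [].
have vK i : cv (X.2 i) \in K.
  rewrite in_setU; case: (boolP (cv (X.2 i) \in B)) => //= vB.
  by rewrite in_setD vB in_setU (imset_f (fun i => cv (X.2 i))).
have fK i x : free k L X i x -> x \in K.
  move=> fx; rewrite in_setU; case: (boolP (x \in B)) => //= xB.
  by rewrite in_setD xB in_setU; apply/orP; right; rewrite inE; apply/existsP; exists i.
pose oz := Ordinal k3.
pose ts : seq tag := [seq ((f p.1).1, (f p.1).2, insubd oz p.2) | p <- zip arcs ms].
have sza : size arcs = 2 * q + u.
  rewrite size_cat size_map -cardE Zu /enum_arcs -Bq cardE; congr (_ + _).
  by elim: (enum B) => //= b' s ->; rewrite mulnS.
have szm : size ms = size arcs by rewrite sz size_map.
have tsP : size ts == 2 * q + u by rewrite size_map size_zip szm minnn sza.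
have ZP : size (enum Z) == u by rewrite -cardE Zu.
pose y : transitions n * code q u := (X.1, (B, Tuple ZP, Tuple tsP)).
have KE : code_known y.2 = K by rewrite /code_known /=; congr (_ :|: _); apply/setP => x; rewrite inE mem_enum.
have chE : code_chains y.2 = zip src ms.
  rewrite /code_chains /= /chains_of /ts /src.
  have -> : source_vertices B (enum Z) = [seq e.1 | e <- arcs].
    rewrite map_cat -map_comp map_id_in //; congr (_ ++ _).
    by rewrite /enum_arcs; elim: (enum B) => //= b' s ->.
  elim: (arcs) (ms) msk => [|e es IH] [|m ms'] //= /andP [mk mk'].
  by rewrite IH // insubdK.
exists y; first by rewrite /code_sat KE chE /= Bq eqxx.
rewrite KE chE; split=> // i x xG.
have xv := block_reached k_gt0 L_per sep vX BK vK fK inv KD xG.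
split=> // m; have [_] := arc_follow k_gt0 L_per vX inv KD (tok_start L k_gt0 xG) xv m.
by rewrite add0n.
Qed.

(** The sources are chosen in 'C(n, q) * n^u ways, whereas the 2q + u chains save n^(2q + u): each
    branch vertex saves one factor n. The last power is the number of configurations per code, from
    [card_covered]. *)
Lemma card_residual q u : 0 < q ->
  #|[pred X | [&& valid k L X, residual k L X, #|branch k L X| == q & #|start_set X| == u]]|
    * n ^ (2 * q + u) <=
  'C(n, q) * n ^ u * (3 * #|I| * k ^ 2) ^ (2 * q + u) * (n ^ (n * 2) * known_max q u ^ (2 * q + u)) *
    ((q + u) * 2 ^ (q + u + (2 * q + u) * l0 + (2 * q + u).+1)) ^ #|I|.
Proof.
move=> q0; have [I0|I0] := posnP #|I|.
  rewrite eq_card0 // => X; rewrite !inE; apply/negP => /and4P [_ _ /eqP bq _].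
  have : 0 < #|branch k L X| by rewrite bq.
  case/card_gt0P => z; rewrite inE => /andP [/asboolP [i _] _].
  by have := card0_eq I0 i; rewrite inE.
have H := @card_cover _ _ (fun X => [&& valid k L X, residual k L X, #|branch k L X| == q & #|start_set X| == u])
  (fun y => @code_sat q u y) (fun X y => covered k L y.1 (code_known y.2) (code_chains y.2) X)
  (((q + u) * 2 ^ (q + u + (2 * q + u) * l0 + (2 * q + u).+1)) ^ #|I|).
apply: leq_trans (_ : #|[pred y | @code_sat q u y]| * ((q + u) * 2 ^ (q + u + (2 * q + u) * l0 + (2 * q + u).+1)) ^ #|I|
  * n ^ (2 * q + u) <= _); last by rewrite mulnAC leq_mul2r card_code_sat orbT.
rewrite leq_mul2r; apply/orP; right; apply: H => [X /and4P [vX rX /eqP Bq /eqP Zu]|[A c] /andP [/eqP cq st]].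
  exact: residual_code.
apply: leq_trans (_ : #|[pred X | `[< covered k L A (code_known c) (code_chains c) X >]]| <= _).
  by apply: subset_leq_card; apply/subsetP => X; rewrite !inE => /andP [].
have cK : {in code_chains c, forall ch, ch.1.1.1 \in code_known c}.
  move=> ch /mapP [p]; move=> pin ->; rewrite inE /=.
  have : p.1 \in source_vertices c.1.1 c.1.2.
    by rewrite -[_ c.1.1 _](@unzip1_zip _ _ _ c.2) ?map_f // size_source_vertices cq !size_tuple.
  rewrite mem_cat => /orP [/flatten_mapP [b]|xZ]; last by rewrite inE xZ orbT.
  by rewrite mem_enum !inE orbb => bB /eqP ->; rewrite bB.
have {}st : sat L A set0 (code_known c) (code_chains c) by [].
apply: leq_trans (card_covered L_per win st cK) _.
rewrite leq_exp2r // leq_mul ?card_code_known // leq_pexp2l //.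
by rewrite (size_code_chains cq) !leq_add ?card_code_known.
Qed.

End Residual.

(** * Number of cycles *)

Section Cycles.
Variables (n : nat) (I : finType) (k : nat) (L : I -> nat -> bool).
Hypothesis k_gt0 : 0 < k.
Hypothesis L_per : forall i j, L i (j + k) = L i j.
Implicit Types (A : transitions n) (i : I) (S : {set 'I_n}).

(* [good i A S x]: [x] is a cyclic point for word [i], and on its cycle the letter [true] is only read in [S]. *)
Definition good i A S x := `[< (exists q, 0 < q /\ walk A (L i) 0 x (q * k) = x) /\
   forall m, L i m -> walk A (L i) 0 x m \in S >].
Definition orb i A x := [set y | `[< exists t, y = walk A (L i) 0 x (t * k) >]].
Definition cycles i A S := [set orb i A x | x in [set x | good i A S x]].
Definition num_cycles A S := \sum_i #|cycles i A S|.

Definition agree S A A' := [forall e : 'I_n * bool, (~~ e.2 || (e.1 \in S)) ==> (A e == A' e)].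

Lemma agreeP S A A' e : agree S A A' -> ~~ e.2 || (e.1 \in S) -> A e = A' e.
Proof. by move=> /forallP /(_ e) /implyP H /H /eqP. Qed.

Lemma agree_sym S A A' : agree S A A' = agree S A' A.
Proof. by apply: eq_forallb => e; rewrite eq_sym. Qed.

Lemma agree_walk S A A' (l : nat -> bool) s x M : agree S A A' ->
  (forall m, m < M -> l (s + m) -> walk A l s x m \in S) ->
  walk A' l s x M = walk A l s x M.
Proof.
move=> ag H; apply: eq_walk_transitions => j jM; apply/esym/(agreeP ag) => /=.
by case E: (l (s + j)) => //=; apply: H.
Qed.

Lemma good_agree i A A' S x : agree S A A' -> good i A S x ->
  good i A' S x /\ orb i A' x = orb i A x.
Proof.
move=> ag /asboolP [[q [q0 qE]] H].
have W M : walk A' (L i) 0 x M = walk A (L i) 0 x M by apply: (agree_walk ag) => m _; exact: H.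
split; first by apply/asboolP; split; [exists q; rewrite W|move=> m Lm; rewrite W; exact: H].
by apply/setP => y; rewrite !inE; apply: asbool_equiv_eq; split=> -[t ->]; exists t; rewrite W.
Qed.

Lemma cycles_agree i A A' S : agree S A A' -> cycles i A S = cycles i A' S.
Proof.
move=> ag; apply/setP => C; apply/imsetP/imsetP => -[x]; rewrite inE => gx ->.
  by have [gx' oE] := good_agree ag gx; exists x; rewrite ?inE.
by rewrite agree_sym in ag; have [gx' oE] := good_agree ag gx; exists x; rewrite ?inE.
Qed.

Lemma orb_walk i A x q : 0 < q -> walk A (L i) 0 x (q * k) = x ->
  forall t, orb i A (walk A (L i) 0 x (t * k)) = orb i A x.
Proof.
move=> q0 qE t.
have add s r : walk A (L i) 0 x ((s + r) * k) = walk A (L i) 0 (walk A (L i) 0 x (s * k)) (r * k).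
  by rewrite mulnDl walkD -[0 + _]/(0 + s * k) walk_per.
have mul s : walk A (L i) 0 x (s * q * k) = x.
  by elim: s => // s IH; rewrite mulSn addnC add IH qE.
apply/setP => y; rewrite !inE; apply: asbool_equiv_eq; split=> -[r ->].
  by exists (t + r); rewrite add.
exists (r + (t * q - t)); rewrite -add addnCA subnKC ?leq_pmulr //.
by rewrite addnC add mul.
Qed.

Definition hits i A S s (t z : 'I_n) := exists m, [/\ walk A (L i) s t m = z, L i (s + m) &
  forall m', m' < m -> L i (s + m') -> walk A (L i) s t m' \in S].

(** The arcs [false] are all revealed, and [S] is the set of the vertices whose arc [true] is. For z
    outside [S], these are the targets of [(z, true)] from which some word comes back to read this
    arc before any other unrevealed one: only they can close a new cycle. *)
Definition entrance A S z := [set t | `[< exists i (j : 'I_k), L i j /\ hits i A S j.+1 t z >]].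

Lemma hits_agree i A A' S s t z : agree S A A' -> hits i A S s t z -> hits i A' S s t z.
Proof.
move=> ag [m [w Lm H]]; exists m; split=> //; first by rewrite (agree_walk ag).
move=> m' m'm L'; rewrite (agree_walk ag) ?H // => p pm; apply: H; exact: ltn_trans m'm.
Qed.

Lemma entrance_agree A A' S z : agree S A A' -> entrance A S z = entrance A' S z.
Proof.
move=> ag; apply/setP => t; rewrite !inE; apply: asbool_equiv_eq.
split=> -[i [j [Lj h]]]; exists i, j; split=> //; apply: hits_agree h => //.
by rewrite agree_sym.
Qed.

Lemma hits_unique i A S s t z z' : z \notin S -> z' \notin S ->
  hits i A S s t z -> hits i A S s t z' -> z = z'.
Proof.
move=> zS zS' [m [w Lm H]] [m' [w' Lm' H']].
case: (ltngtP m m') => [lt|lt|E]; last by rewrite -w -w' E.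
  by case/negP: zS; rewrite -w; exact: H'.
by case/negP: zS'; rewrite -w'; exact: H.
Qed.

Definition weight := \sum_i #|[set j : 'I_k | L i j]|.

Lemma new_cycle i A S z C : C \in cycles i A (z |: S) -> C \notin cycles i A S ->
  exists x (j : 'I_k), [/\ C = orb i A x, good i A (z |: S) x, L i j & walk A (L i) 0 x j = z].
Proof.
case/imsetP => x; rewrite inE => gx -> nC.
have /asboolP [[q [q0 qE]] H] := gx.
have [m [Lm wm]] : exists m, L i m /\ walk A (L i) 0 x m \notin S.
  apply: contrapT => nex; case/negP: nC; apply: imset_f; rewrite inE; apply/asboolP; split.
    by exists q.
  by move=> m Lm; apply: contrapT => wm; apply: nex; exists m; split=> //; apply/negP.
have wz : walk A (L i) 0 x m = z by move: (H m Lm); rewrite !inE (negbTE wm) orbF => /eqP.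
exists (walk A (L i) 0 x (m %/ k * k)), (Ordinal (ltn_pmod m k_gt0)); split.
- by rewrite (orb_walk q0).
- have W M : walk A (L i) 0 (walk A (L i) 0 x (m %/ k * k)) M = walk A (L i) 0 x (m %/ k * k + M).
    by rewrite walkD -[0 + m %/ k * k]/(0 + m %/ k * k) walk_per.
  apply/asboolP; split.
    exists q; split=> //; rewrite W addnC walkD qE.
    by rewrite -[0 + _]/(0 + q * k) walk_per.
  move=> M LM; rewrite W; apply: H; by rewrite addnC per_mul.
- by rewrite /= (per_mod (L_per i)).
- by rewrite /= -wz [in RHS](divn_eq m k) walkD -[0 + m %/ k * k]/(0 + m %/ k * k) walk_per.
Qed.

(** A new cycle reads the letter [true] at [z], and it is determined by a phase at which it does
    so. *)
Lemma card_new_cycles i A S z :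
  #|cycles i A (z |: S)| <= #|cycles i A S| + #|[set j : 'I_k | L i j]|.
Proof.
rewrite -(cardsID (cycles i A S)) leq_add //; first exact: subset_leq_card (subsetIr _ _).
set N := _ :\: _.
pose f C := odflt (Ordinal k_gt0) [pick j : 'I_k | `[< exists x, [/\ C = orb i A x,
   good i A (z |: S) x, L i j & walk A (L i) 0 x j = z] >]].
have fP C : C \in N -> exists x, [/\ C = orb i A x, good i A (z |: S) x, L i (f C) & walk A (L i) 0 x (f C) = z].
  rewrite inE => /andP [C1 C2]; have [x [j H]] := new_cycle C2 C1.
  rewrite /f; case: pickP => [j' /asboolP //|/(_ j)].
  by move/asboolPn => nj; case: nj; exists x.
rewrite -(@card_in_imset _ _ f).
  apply: subset_leq_card; apply/subsetP => _ /imsetP [C CN ->]; rewrite inE.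
  by have [x []] := fP C CN.
move=> C C' CN CN' ff; have [x [CE /asboolP [[q [q0 qE]] _] _ w]] := fP C CN.
have [x' [CE' /asboolP [[q' [q0' qE']] _] _ w']] := fP C' CN'.
rewrite [LHS]CE [RHS]CE' -(orb_walk q0 qE 1) -(orb_walk q0' qE' 1) !mul1n; congr orb.
rewrite -(subnKC (ltnW (ltn_ord (f C)))) !walkD w; congr walk.
by rewrite ff w'.
Qed.

Lemma num_cycles_entrance A S z : z \notin S ->
  num_cycles A (z |: S) <= num_cycles A S + (if A (z, true) \in entrance A S z then weight else 0).
Proof.
move=> zS; case: ifP => tE.
  by rewrite /num_cycles /weight -big_split; apply: leq_sum => i _; exact: card_new_cycles.
rewrite addn0; apply: leq_sum => i _; apply: subset_leq_card; apply/subsetP => C Cz.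
apply: contraFT tE => nC; have [x [j [_ /asboolP [[q [q0 qE]] H] Lj w]]] := new_cycle Cz nC.
rewrite inE; apply/asboolP; exists i, j; split=> //.
have W m : walk A (L i) j.+1 (A (z, true)) m = walk A (L i) 0 x (j.+1 + m).
  by rewrite walkD /= w add0n Lj.
have ex : exists m, (walk A (L i) j.+1 (A (z, true)) m == z) && L i (j.+1 + m).
  exists (q * k).-1; rewrite W addSnnS prednK ?muln_gt0 ?q0 // per_mul // Lj andbT.
  by rewrite addnC walkD qE -[0 + _]/(0 + q * k) walk_per // w.
case: (ex_minnP ex) => m /andP [/eqP wm Lm] mmin; exists m; split=> // m' m'm L'.
have := H _ L'; rewrite -W !inE => /orP [E|//].
by have := mmin m'; rewrite E L' leqNgt m'm => /(_ isT).
Qed.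

(** For a given word, phase and target, the first unrevealed arc met is unique, so it is counted for
    a single z. *)
Lemma sum_entrance A S : \sum_(z | z \notin S) #|entrance A S z| <= weight * n.
Proof.
pose h i (j : 'I_k) t z : nat := L i j && `[< hits i A S j.+1 t z >].
apply: (@leq_trans (\sum_(z | z \notin S) \sum_t \sum_i \sum_(j : 'I_k) h i j t z)).
  apply: leq_sum => z _; rewrite -sum1_card big_mkcond; apply: leq_sum => t _.
  case: ifP => //; rewrite inE => /asboolP [i [j [Lj hj]]].
  rewrite (bigD1 i) //= (bigD1 j) //= /h Lj.
  by have -> : `[< hits i A S j.+1 t z >] = true by apply/asboolP.
rewrite exchange_big /= mulnC -[X in _ <= X * _](card_ord n) -sum_nat_const.
apply: leq_sum => t _; rewrite exchange_big /=; apply: leq_sum => i _.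
rewrite exchange_big /= -sum1_card [X in _ <= X]big_mkcond; apply: leq_sum => j _ /=.
rewrite inE; case Lj: (L i j); last by rewrite big1 // => z _; rewrite /h Lj.
case: (pselect (exists2 z, z \notin S & hits i A S j.+1 t z)) => [[z zS hz]|nz]; last first.
  rewrite big1 // => z zS; rewrite /h Lj; case: asboolP => // hz.
  by case: nz; exists z.
rewrite (bigD1 z) //= big1 ?addn0; first by rewrite /h leq_b1.
move=> z' /andP [zS' zz']; rewrite /h Lj; case: asboolP => // hz'.
by rewrite (hits_unique zS' zS hz' hz) eqxx in zz'.
Qed.

Section Generating.
Variables (F : realFieldType) (x : F).
Hypothesis x_ge1 : (1 <= x)%R.
Local Open Scope ring_scope.

Let rate : F := x ^+ weight * weight%:R.

Lemma rate_ge0 : 0 <= rate.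
Proof. by rewrite mulr_ge0 ?exprn_ge0 ?ler0n // (le_trans ler01). Qed.

Definition set_arc A e t : transitions n := [ffun e' => if e' == e then t else A e'].

Lemma agree_set_arc A S z t : z \notin S -> agree S A (set_arc A (z, true) t).
Proof.
move=> zS; apply/forallP => e; apply/implyP; rewrite ffunE; case: (e =P (z, true)) => [->|_] //=.
by rewrite (negbTE zS).
Qed.

Lemma agree_split A A' S z t : agree S A A' -> A' (z, true) = t ->
  agree (z |: S) (set_arc A (z, true) t) A'.
Proof.
move=> ag At; apply/forallP => e; apply/implyP; rewrite ffunE; case: (e =P (z, true)) => [-> _|ne].
  by rewrite At.
rewrite in_setU1 => H; apply/eqP/(agreeP ag); case/orP: H => [->//|/orP [/eqP ez|->]]; last by rewrite orbT.
by case: e ne ez => z' [] //= ne ez; rewrite ez in ne.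
Qed.

Lemma exists_small_entrance A S : (#|S| < n)%N ->
  exists2 z, z \notin S & (#|entrance A S z| * (n - #|S|) <= weight * n)%N.
Proof.
move=> Sn; have Sc : #|[set z | z \notin S]| = (n - #|S|)%N.
  have -> : [set z | z \notin S] = ~: S by apply/setP => z; rewrite !inE.
  by rewrite cardsCs setCK card_ord.
apply: contrapT => nex; have := sum_entrance A S; rewrite leqNgt => /negP; apply.
have [z0 z0S] : exists z, z \in [set z | z \notin S].
  by apply/card_gt0P; rewrite Sc subn_gt0.
have big z : z \notin S -> (weight * n < #|entrance A S z| * (n - #|S|))%N.
  by move=> zS; rewrite ltnNge; apply/negP => H; apply: nex; exists z.
rewrite -(ltn_pmul2r (m := n - #|S|)) ?subn_gt0 //.
rewrite [in X in (_ < X)%N]big_distrl /=.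
apply: (@leq_trans (\sum_(z | z \notin S) (weight * n).+1)%N).
  rewrite sum_nat_const.
  have -> : #|[pred z | z \notin S]| = (n - #|S|)%N by rewrite -Sc cardsE.
  by rewrite mulnC ltn_pmul2l ?subn_gt0 ?ltnSn.
by apply: leq_sum => z zS; exact: big.
Qed.

(** The arcs [true] are revealed one at a time, in an adaptive order: with u + 1 of them left, there
    is a vertex whose entrance has at most [weight] * n / (u + 1) elements. A target in the entrance
    adds at most [weight] cycles and any other one adds none, whence the factor 1 + [rate] / (u +
    1). *)
Lemma sum_cycles_from u S A0 : (#|S| + u = n)%N ->
  \sum_(A | agree S A0 A) x ^+ num_cycles A setT <=
    n%:R ^+ u * x ^+ num_cycles A0 S * \prod_(i < u) (1 + rate / i.+1%:R).
Proof.
elim: u S A0 => [|u IH] S A0 Su.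
  have -> : S = setT.
    by apply/eqP; rewrite eqEcard subsetT cardsT card_ord /=; apply: eq_leq; rewrite -[LHS]Su addn0.
  rewrite big_ord0 expr0 mul1r mulr1 (bigD1 A0) /=; last by apply/forallP => e; rewrite eqxx implybT.
  rewrite big1 ?addr0 // => A /andP [ag /eqP nA]; case: nA; apply/ffunP => e; apply/esym/(agreeP ag).
  by rewrite inE orbT.
have Sn : (#|S| < n)%N by apply: leq_trans (eq_leq Su); rewrite addnS ltnS leq_addr.
have nS : (n - #|S|)%N = u.+1 by apply/eqP; rewrite -(eqn_add2l #|S|) Su subnKC // ltnW.
have [z zS small] := exists_small_entrance A0 Sn.
pose T := entrance A0 S z; pose c0 := num_cycles A0 S.
have x0 : 0 <= x := le_trans ler01 x_ge1.
rewrite (partition_big (fun A => A (z, true)) predT) //=.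
apply: (@le_trans _ _ (\sum_t n%:R ^+ u * x ^+ (c0 + (if t \in T then weight else 0)) *
   \prod_(i < u) (1 + rate / i.+1%:R))).
  apply: ler_sum => t _; have ag := agree_set_arc A0 t zS.
  apply: (le_trans _ (le_trans (IH (z |: S) (set_arc A0 (z, true) t) _) _)).
  - rewrite [X in X <= _]big_mkcond [X in _ <= X]big_mkcond; apply: ler_sum => A _.
    case: ifP => [/andP [agA /eqP At]|_]; first by rewrite agree_split.
    by case: ifP => // _; exact: exprn_ge0.
  - by rewrite cardsU1 zS add1n addSn -addnS.
  - rewrite ler_wpM2r ?prodr_ge0 // => [i _|]; first by rewrite addr_ge0 // divr_ge0 ?rate_ge0.
    rewrite ler_wpM2l ?exprn_ge0 ?ler0n // ler_weXn2l //.
    have := num_cycles_entrance (set_arc A0 (z, true) t) zS.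
    rewrite -(entrance_agree _ ag) -/T ffunE eqxx /num_cycles.
    by rewrite -(eq_bigr _ (fun i _ => congr1 (fun C : {set {set 'I_n}} => #|C|) (cycles_agree i ag))).
rewrite -mulr_suml -mulr_sumr big_ord_recr /= exprSr.
have rearrange (a b c d e : F) : a * b * c * (d * e) = a * (c * (b * e)) * d by ring.
rewrite rearrange.
rewrite ler_wpM2r ?prodr_ge0 // => [i _|]; first by rewrite addr_ge0 // divr_ge0 ?rate_ge0.
rewrite ler_wpM2l ?exprn_ge0 ?ler0n //.
under eq_bigr => t _ do rewrite exprD.
rewrite -mulr_sumr ler_wpM2l ?exprn_ge0 //.
apply: (@le_trans _ _ (\sum_(t : 'I_n) (1 + (if t \in T then x ^+ weight else 0)))).
  by apply: ler_sum => t _; case: ifP; rewrite ?expr0 ?addr0 // lerDr ler01.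
rewrite big_split /= sumr_const card_ord -big_mkcond sumr_const /= mulrDr mulr1 lerD2l.
have -> : n%:R * (rate / u.+1%:R) = x ^+ weight * (n%:R * (weight%:R / u.+1%:R)).
  by rewrite /rate -!mulrA mulrCA.
rewrite -[_ *+ #|T|]mulr_natr ler_wpM2l ?exprn_ge0 //.
rewrite mulrA ler_pdivlMr ?ltr0Sn // -!natrM ler_nat [(n * _)%N]mulnC -nS.
exact: small.
Qed.

Lemma prod_rate_le (C : nat) : rate <= C%:R -> forall u,
  \prod_(i < u) (1 + rate / i.+1%:R) <= u.+1%:R ^+ C.
Proof.
move=> rC; elim=> [|u IH]; first by rewrite big_ord0 expr1n.
rewrite big_ord_recr /=.
have bern (y : F) m : 0 <= y -> 1 + m%:R * y <= (1 + y) ^+ m.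
  move=> y0; elim: m => [|m IHm]; first by rewrite mul0r addr0.
  rewrite exprS; apply: (le_trans _ (ler_wpM2l _ IHm)); last by rewrite addr_ge0.
  have : 0 <= m%:R * y * y by rewrite !mulr_ge0.
  by rewrite -natr1; nra.
have u0 : 0 < u.+1%:R :> F by rewrite ltr0Sn.
apply: (@le_trans _ _ (u.+1%:R ^+ C * (1 + u.+1%:R^-1) ^+ C)).
  apply: ler_pM => //.
  - by apply: prodr_ge0 => i _; rewrite addr_ge0 // divr_ge0 ?rate_ge0.
  - by rewrite addr_ge0 // divr_ge0 ?rate_ge0.
  apply: le_trans (bern _ C _); last by rewrite invr_ge0 ltW.
  by rewrite lerD2l ler_wpM2r // invr_ge0 ltW.
by rewrite -exprMn mulrDr mulr1 divff ?gt_eqF // natr1.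
Qed.

Hypothesis has_true : forall i, exists j, L i j.

Lemma sum_cycles (C : nat) : (0 < n)%N -> rate <= C%:R ->
  \sum_A x ^+ num_cycles A setT <= (n ^ (n * 2))%:R * n.+1%:R ^+ C.
Proof.
move=> n0 rC.
have nc0 A : num_cycles A set0 = 0%N.
  rewrite /num_cycles big1 // => i _; apply/eqP; rewrite cards_eq0; apply/eqP/setP => Y; rewrite !inE.
  apply/imsetP => -[y]; rewrite inE => /asboolP [_ H] _.
  by have [j /H] := has_true i; rewrite inE.
have x0 : 0 <= x := le_trans ler01 x_ge1.
have nn : 0 < (n ^ n)%:R :> F by rewrite ltr0n expn_gt0 n0.
rewrite -(ler_pM2l nn).
(* Only the arcs [false] of the initial automaton matter, so a sum over all initial automata counts
   each final one n^n times. *)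
have cnt (A : transitions n) : #|[pred A0 | agree set0 A0 A]| = (n ^ n)%N.
  have := @card_prescribed _ _ [set e : 'I_n * bool | ~~ e.2] A.
  have -> : #|[set e : 'I_n * bool | ~~ e.2]| = n.
    have -> : [set e : 'I_n * bool | ~~ e.2] = [set (z, false) | z in [set: 'I_n]].
      apply/setP => e; rewrite inE; apply/idP/imsetP => [|[z _ ->] //].
      by case: e => z [] // _; exists z.
    by rewrite card_imset ?cardsT ?card_ord // => z z' [].
  rewrite card_prod card_ord card_bool muln2 -addnn addnK => <-.
  apply: eq_card => A0; rewrite !inE; apply: eq_forallb => e.
  by rewrite !inE orbF.
have -> : (n ^ n)%:R * \sum_A x ^+ num_cycles A setT = \sum_A0 \sum_(A | agree set0 A0 A) x ^+ num_cycles A setT.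
  rewrite (exchange_big_dep predT) //= mulr_sumr; apply: eq_bigr => A _.
  by rewrite sumr_const cnt mulr_natl.
apply: (@le_trans _ _ (\sum_(A0 : transitions n) (n ^ n)%:R * n.+1%:R ^+ C)).
  apply: ler_sum => A0 _; have e0 : (#|@finset.set0 'I_n| + n = n)%N by rewrite cards0.
  apply: le_trans (sum_cycles_from A0 e0) _.
  by rewrite nc0 expr0 mulr1 natrX ler_wpM2l ?exprn_ge0 ?ler0n // prod_rate_le.
rewrite sumr_const card_ffun card_prod !card_ord card_bool.
by rewrite -(mulr_natl (_ * _)) mulrCA.
Qed.

End Generating.

End Cycles.

(** * Long cycles *)

Section Run.
Variables (n k : nat) (l : nat -> bool) (x0 : 'I_n).
Hypothesis k_gt0 : 0 < k.
Hypothesis l_per : forall j, l (j + k) = l j.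
Variable jump : nat -> option 'I_n.
Implicit Types (A : transitions n) (ts : seq 'I_n) (D : {set 'I_n * bool}).

(* The run reads [l] along successive blocks; [jump] may move it before a block. Its history [ts]
   is the sequence of the targets of the arcs that it followed. *)
Definition current ts :=
  if size ts %% k == 0 then odflt (last x0 ts) (jump (size ts %/ k)) else last x0 ts.

Definition earlier ts := [seq nth x0 ts t | t <- iota 0 (size ts) & t %% k == size ts %% k].

Fixpoint runs A m ts :=
  if m is m'.+1 then
    let t := A (current ts, l (size ts)) in (t \notin earlier ts) && runs A m' (rcons ts t)
  else true.

Definition past_arc ts t := (current (take t ts), l t).

Variable F : realFieldType.
Local Open Scope ring_scope.

(* When a walk reads its [i]-th arc, the [i %/ k] arcs met earlier at the same phase must not have
   the same target. *)
Definition avoid J r : F := \prod_(r <= i < J) (1 - (i %/ k)%:R / n%:R).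

Lemma avoid_ge0 J r : (J <= n)%N -> 0 <= avoid J r.
Proof.
move=> Jn; rewrite /avoid big_nat_cond; apply: prodr_ge0 => i; rewrite andbT => /andP [_ iJ].
have n0 : 0 < n%:R :> F by rewrite ltr0n (leq_trans _ Jn) // (leq_ltn_trans _ iJ).
rewrite subr_ge0 ler_pdivrMr // mul1r ler_nat.
by rewrite (leq_trans (leq_div _ _)) // (leq_trans (ltnW iJ)).
Qed.

Definition history D (phi : 'I_n * bool -> 'I_n) ts :=
  (forall t, (t < size ts)%N -> past_arc ts t \in D /\ phi (past_arc ts t) = nth x0 ts t) /\
  (forall t t', (t < t' < size ts)%N -> t = t' %[mod k] -> nth x0 ts t != nth x0 ts t').

(** An arc read twice at the same phase would repeat a target at this phase, so each arc serves at
    most k steps. *)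
Lemma history_size D phi ts : history D phi ts -> (size ts <= k * #|D|)%N.
Proof.
move=> [H1 H2]; pose f (t : 'I_(size ts)) := (past_arc ts t, Ordinal (ltn_pmod t k_gt0)).
have inj : injective f.
  move=> t t' [eE pE mE]; apply: val_inj => /=.
  have e1 := (H1 t (ltn_ord t)).2; have e2 := (H1 t' (ltn_ord t')).2.
  have E : nth x0 ts t = nth x0 ts t' by rewrite -e1 -e2 /past_arc eE pE.
  case: (ltngtP t t') => // lt.
    by have := H2 t t'; rewrite lt ltn_ord E eqxx => /(_ isT mE).
  by have := H2 t' t; rewrite lt ltn_ord E eqxx => /(_ isT (esym mE)).
have c1 : #|[set f t | t in [set: 'I_(size ts)]]| = size ts.
  by rewrite card_imset // cardsT card_ord.
have c2 : #|setX D [set: 'I_k]| = (k * #|D|)%N by rewrite cardsX cardsT card_ord mulnC.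
apply: leq_trans (eq_leq (esym c1)) _; rewrite -c2.
apply: subset_leq_card; apply/subsetP => _ /imsetP [t _ ->]; rewrite !inE andbT.
exact: (H1 t (ltn_ord t)).1.
Qed.

Lemma past_arc_rcons ts t u : (t < size ts)%N -> past_arc (rcons ts u) t = past_arc ts t.
Proof. by move=> lt; rewrite /past_arc -cats1 takel_cat // ltnW. Qed.

Lemma history_rcons D phi ts t : history D phi ts ->
  (current ts, l (size ts)) \in D -> phi (current ts, l (size ts)) = t -> t \notin earlier ts ->
  history D phi (rcons ts t).
Proof.
move=> [H1 H2] eD pe te; split=> [u|u u']; rewrite size_rcons ltnS.
  rewrite leq_eqVlt => /orP [/eqP ->|lt]; last by rewrite past_arc_rcons // nth_rcons lt; exact: H1.
  by rewrite /past_arc -cats1 take_size_cat // cats1 nth_rcons ltnn eqxx.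
case/andP => uu'; rewrite leq_eqVlt => /orP [/eqP u'E|lt] m.
  rewrite !nth_rcons u'E ltnn eqxx -u'E uu'; apply: contraNneq te => <-.
  by rewrite map_f // mem_filter -u'E m eqxx mem_iota.
by rewrite !nth_rcons lt (ltn_trans uu' lt); apply: H2 => //; rewrite uu'.
Qed.

Lemma size_earlier ts : (size ts %/ k <= size (earlier ts))%N.
Proof.
set T := size ts; rewrite size_map -[X in (X <= _)%N](size_iota 0) -(size_map (fun q => T %% k + q * k)%N).
apply: uniq_leq_size.
  rewrite map_inj_uniq ?iota_uniq // => q q' /eqP.
  by rewrite eqn_add2l eqn_pmul2r // => /eqP.
move=> t /mapP [q]; rewrite mem_iota add0n => /= qT ->.
rewrite mem_filter mem_iota add0n addnC modnMDl modn_mod eqxx /=.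
by rewrite [X in (_ < X)%N](divn_eq T k) ltn_add2r ltn_pmul2r.
Qed.

Lemma uniq_earlier D phi ts : history D phi ts -> uniq (earlier ts).
Proof.
move=> [_ H2]; rewrite map_inj_in_uniq ?filter_uniq ?iota_uniq // => t t'.
rewrite !mem_filter !mem_iota !add0n => /andP [/eqP m /= lt] /andP [/eqP m' /= lt'] E.
case: (ltngtP t t') => // tt.
  by have := H2 t t'; rewrite tt lt' E eqxx => /(_ isT); rewrite m m' => /(_ erefl).
by have := H2 t' t; rewrite tt lt E eqxx => /(_ isT); rewrite m m' => /(_ erefl).
Qed.

(** Rereading a known arc is free of charge. When #|D| arcs are known, a new one has to avoid the
    targets already met at its phase, at least #|D| %/ k of them. By [history_size], k * J steps
    read at least J distinct arcs. *)
Lemma count_runs J m ts D phi : (0 < n)%N -> (J <= n)%N ->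
  (#|D| <= size ts)%N -> (size ts + m = k * J)%N -> history D phi ts ->
  #|[pred A : transitions n | [forall e in D, A e == phi e] && runs A m ts]|%:R
    <= (n ^ (n * 2 - #|D|))%:R * avoid J #|D|.
Proof.
move=> n0 Jn; have n0' : 0 < n%:R :> F by rewrite ltr0n.
elim: m ts D phi => [|m IH] ts D phi Dts tsm hist.
  have JD : (J <= #|D|)%N.
    by rewrite -(leq_pmul2l k_gt0) -tsm addn0; exact: history_size hist.
  rewrite /avoid big_geq // mulr1 ler_nat; have := card_prescribed D phi.
  rewrite card_prod !card_ord card_bool => <-.
  by apply: subset_leq_card; apply/subsetP => A; rewrite !inE andbT.
set e := (current ts, l (size ts)).
case: (boolP (e \in D)) => eD.
  case: (boolP (phi e \in earlier ts)) => te.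
    rewrite [#|[pred _ | _]|](_ : _ = 0%N) ?mulr_ge0 ?ler0n ?avoid_ge0 //.
    apply: eq_card0 => A; rewrite !inE; apply/negP => /andP [/forall_inP /(_ e eD) /eqP Ae] /= /andP [].
    by rewrite -/e Ae te.
  apply: le_trans (IH (rcons ts (phi e)) D phi _ _ _); last exact: history_rcons.
  - rewrite ler_nat; apply: subset_leq_card; apply/subsetP => A; rewrite !inE /=.
    case/andP => ag; rewrite ag -/e; move/forall_inP: (ag) => /(_ e eD) /eqP ->.
    by case/andP.
  - by rewrite size_rcons leqW.
  - by rewrite size_rcons addSnnS.
have Dlt : (#|D| < n * 2)%N.
  apply: leq_trans (_ : (#|e |: D| <= _)%N); first by rewrite cardsU1 eD.
  by have := max_card (mem (e |: D)); rewrite card_prod card_ord card_bool.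
have De : (n * 2 - #|D| = (n * 2 - #|e |: D|).+1)%N by rewrite cardsU1 eD add1n -subnSK.
set P := [pred A : transitions n | _].
have -> : #|P| = (\sum_(t | t \notin earlier ts) #|[pred A : transitions n | P A && (A e == t)]|)%N.
  rewrite -sum1_card (partition_big (fun A : transitions n => A e) (fun t => t \notin earlier ts)); last first.
    by move=> A /andP [_] /= /andP [].
  by apply: eq_bigr => t _; rewrite sum1_card.
rewrite natr_sum.
apply: (@le_trans _ _ (\sum_(t | t \notin earlier ts) (n ^ (n * 2 - #|e |: D|))%:R * avoid J #|e |: D|)).
  apply: ler_sum => t te.
  apply: le_trans (IH (rcons ts t) (e |: D) (update phi e t) _ _ _).
  - rewrite ler_nat; apply: subset_leq_card; apply/subsetP => A; rewrite !inE /=.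
    case/andP => /andP [ag]; rewrite -/e => /andP [_ rA] /eqP At; rewrite At in rA; rewrite rA andbT.
    apply/forall_inP => f; rewrite /update !inE.
    by case: eqP => [-> _|_ /= /(forall_inP ag) //]; rewrite At.
  - by rewrite size_rcons cardsU1 eD add1n ltnS.
  - by rewrite size_rcons addSnnS.
  apply: history_rcons; rewrite ?setU11 ?/update ?eqxx //.
  split; last exact: hist.2.
  move=> u us; have [uD up] := hist.1 u us; rewrite !inE uD orbT; split=> //.
  by case: eqP => // ue; rewrite -ue uD in eD.
rewrite sumr_const -(mulr_natl (_ * _)).
have le_n : (#|[pred t | t \notin earlier ts]| <= n - #|D| %/ k)%N.
  rewrite -(leq_add2r #|[set t in earlier ts]|).
  have -> : (#|[pred t | t \notin earlier ts]| + #|[set t in earlier ts]| = n)%N.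
    rewrite addnC -[in RHS](card_ord n) -(cardC [set t in earlier ts]); congr addn.
    by apply: eq_card => t; rewrite !inE.
  have ec : #|[set t in earlier ts]| = size (earlier ts).
    by rewrite cardsE; apply/card_uniqP; exact: uniq_earlier hist.
  have : (#|D| %/ k <= #|[set t in earlier ts]|)%N.
    by rewrite ec (leq_trans _ (size_earlier ts)) // leq_div2r.
  by move: #|[set t in earlier ts]| (#|D| %/ k)%N => a b; lia.
rewrite De expnS natrM cardsU1 eD add1n.
case: (ltnP #|D| J) => DJ; last first.
  rewrite /avoid !big_geq ?(leqW DJ) // !mulr1 ler_wpM2r ?ler0n // ler_nat.
  by rewrite (leq_trans le_n) // leq_subr.
rewrite /avoid (big_ltn DJ) -/(avoid J #|D|.+1).
have -> (a b c d : F) : a * b * (c * d) = (a * c) * (b * d) by ring.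
rewrite ler_wpM2r ?mulr_ge0 ?ler0n ?avoid_ge0 // mulrBr mulr1 mulrCA divff ?gt_eqF // mulr1.
rewrite -natrB ?ler_nat //.
by rewrite (leq_trans (leq_div _ _)) // (leq_trans (ltnW DJ)).
Qed.

End Run.

(** The jumps are encoded by a list of s pairs (index of a block, new starting point), so that a
    union bound over them costs only (J * n)^s. *)
Definition jump_of J (n s : nat) (p : s.-tuple ('I_J * 'I_n)) (b : nat) : option 'I_n :=
  ohead [seq q.2 | q <- p & nat_of_ord q.1 == b].

Section LongCycles.
Variables (n : nat) (I : finType) (k : nat) (L : I -> nat -> bool).
Hypothesis k_gt0 : 0 < k.
Hypothesis L_per : forall i j, L i (j + k) = L i j.
Variables (A : transitions n) (i : I) (x0 : 'I_n).
Local Notation g := (gmap k L A i).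
Local Notation cyc := (good k L i A setT).
Local Notation orb := (orb k L i A).

Lemma goodP x : reflect (exists2 q, 0 < q & iter q g x = x) (cyc x).
Proof.
rewrite /good; apply: (iffP (asboolP _)) => [[[q [q0 qE]] _]|[q q0 qE]].
  by exists q; rewrite // -(walk_iter (L_per i)).
split; last by move=> m _; rewrite inE.
by exists q; rewrite (walk_iter (L_per i)).
Qed.

Lemma good_iter x t : cyc x -> cyc (iter t g x).
Proof.
move=> /goodP [q q0 qE]; apply/goodP; exists q => //.
by rewrite -iterD addnC iterD qE.
Qed.

Lemma good_inj x y : cyc x -> cyc y -> g x = g y -> x = y.
Proof.
move=> /goodP [q q0 qE] /goodP [q' q0' qE'] gg.
have it z r s : iter r g z = z -> iter (s * r) g z = z.
  by move=> E; elim: s => // s IH; rewrite mulSn iterD IH.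
have e1 := it x q q' qE; have e2 := it y q' q qE'.
have qq : 0 < q' * q by rewrite muln_gt0 q0 q0'.
by rewrite -e1 -e2 mulnC -(prednK (_ : 0 < q * q')) ?[q * q']mulnC // !iterSr gg.
Qed.

Lemma orb_iter x t : cyc x -> orb (iter t g x) = orb x.
Proof.
move=> /asboolP [[q [q0 qE]] _]; rewrite -(walk_iter (L_per i)).
exact: (orb_walk L_per q0).
Qed.

Lemma mem_orb x y : (y \in orb x) = (y \in fingraph.orbit g x).
Proof.
rewrite -fconnect_orbit inE; apply/asboolP/idP => [[t ->]|/iter_findex <-].
  by rewrite (walk_iter (L_per i)); exact: fconnect_iter.
by exists (findex g x y); rewrite (walk_iter (L_per i)).
Qed.

Definition cycle_list rs := flatten [seq fingraph.orbit g x | x <- rs].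

Lemma uniq_cycle_list rs : {in rs, forall x, cyc x} -> uniq [seq orb x | x <- rs] -> uniq (cycle_list rs).
Proof.
elim: rs => //= x rs IH cr /andP [xr ur].
have cr' : {in rs, forall x, cyc x} by move=> y yr; apply: cr; rewrite inE yr orbT.
rewrite cat_uniq orbit_uniq IH // andbT /=; apply/hasPn => y /flatten_mapP [x' x'r].
rewrite -mem_orb => yx'; apply: contra xr; rewrite -mem_orb => yx.
apply/mapP; exists x' => //.
move: yx yx'; rewrite !mem_orb -!fconnect_orbit => /iter_findex yx /iter_findex yx'.
by rewrite -(orb_iter (findex g x y) (cr x (mem_head _ _))) yx -yx' orb_iter // cr'.
Qed.

Lemma cycle_list_step rs b : b < size (cycle_list rs) ->
  nth x0 (cycle_list rs) b \in rs \/
  (0 < b /\ nth x0 (cycle_list rs) b = g (nth x0 (cycle_list rs) b.-1)).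
Proof.
elim: rs b => //= x rs IH b; rewrite size_cat.
have so : size (fingraph.orbit g x) = fingraph.order g x by rewrite size_orbit.
have nt c : c < fingraph.order g x -> nth x0 (fingraph.orbit g x) c = iter c g x.
  by move=> co; rewrite (set_nth_default x) ?so // nth_traject.
rewrite !nth_cat so; case: (ltnP b (fingraph.order g x)) => [bo _|ob lt].
  case: b bo => [|b] bo; first by left; rewrite nt // mem_head.
  right; split=> //=; rewrite (ltn_trans _ bo) //.
  by rewrite !nt // ltnW.
have /IH [yr|[b0 yE]] : b - fingraph.order g x < size (cycle_list rs) by rewrite ltn_subLR.
  by left; rewrite inE yr orbT.
right; split; first by exact: leq_trans (fingraph.order_gt0 _ _) ob.
rewrite yE; congr g; rewrite ifF; last by apply/negbTE; rewrite -leqNgt; lia.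
by congr nth; lia.
Qed.

(** The blocks [y] are read in succession, with a jump wherever [mark] announces that the sequence
    does not continue along [g]. Two equal targets at the same phase would give equal images under
    [g], which the injectivity excludes. *)
Lemma run_of_blocks J s (y : nat -> 'I_n) (mark : pred nat) : 0 < J -> mark 0 ->
  (forall b, b.+1 < J -> ~~ mark b.+1 -> y b.+1 = g (y b)) ->
  (forall b b', b < J -> b' < J -> g (y b) = g (y b') -> b = b') ->
  #|[pred b : 'I_J | mark b]| <= s ->
  exists p : s.-tuple ('I_J * 'I_n), runs k (L i) x0 (jump_of p) A (k * J) [::].
Proof.
move=> J0 mark0 gy ginj ms.
pose lst := [seq (b, y (nat_of_ord b)) | b <- enum 'I_J & mark (nat_of_ord b)].
have szl : size lst <= s.
  rewrite size_map -(card_uniqP (filter_uniq _ (enum_uniq _))); apply: leq_trans ms.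
  by apply: subset_leq_card; apply/subsetP => b; rewrite mem_filter => /andP [].
pose b0 := Ordinal J0.
(* Padding by the first jump, which the list already contains because of [mark0]. *)
have szp : size (lst ++ nseq (s - size lst) (b0, y b0)) == s by rewrite size_cat size_nseq subnKC.
exists (Tuple szp); set jump := jump_of _.
have all_p q : q \in lst ++ nseq (s - size lst) (b0, y b0) -> q.2 = y q.1 /\ mark q.1.
  rewrite mem_cat => /orP [/mapP [b]|]; first by rewrite mem_filter => /andP [yr _] ->.
  by rewrite mem_nseq => /andP [_ /eqP ->].
have jumpE b : b < J -> jump b = if mark b then Some (y b) else None.
  move=> bJ; rewrite /jump /jump_of /=; set p := lst ++ _ in all_p *.
  case: ifP => yr.
    have : (Ordinal bJ, y b) \in [seq q <- p | nat_of_ord q.1 == b].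
      rewrite mem_filter eqxx /p mem_cat; apply/orP; left.
      by apply/mapP; exists (Ordinal bJ); rewrite // mem_filter yr mem_enum.
    case E : [seq q <- p | _] => [//|q r] _ /=; congr Some.
    have : q \in [seq q <- p | nat_of_ord q.1 == b] by rewrite E mem_head.
    by rewrite mem_filter => /andP [/eqP qb /all_p [-> _]]; rewrite qb.
  case E : [seq q <- p | _] => [//|q r].
  have : q \in [seq q <- p | nat_of_ord q.1 == b] by rewrite E mem_head.
  by rewrite mem_filter => /andP [/eqP qb /all_p [_]]; rewrite qb yr.
pose T t := walk A (L i) 0 (y (t %/ k)) (t %% k).+1.
have curE t : t < k * J -> current k x0 jump (mkseq T t) = walk A (L i) 0 (y (t %/ k)) (t %% k).
  move=> tJ; have bJ : t %/ k < J by rewrite ltn_divLR // mulnC.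
  rewrite /current size_mkseq; case: eqP => t0; last first.
    case: t t0 tJ bJ => [|t] t0 tJ bJ; first by rewrite mod0n in t0.
    rewrite -nth_last size_mkseq /= nth_mkseq // /T.
    have [-> ->] : t.+1 %/ k = t %/ k /\ t.+1 %% k = (t %% k).+1; last by [].
    have lt : (t %% k).+1 < k.
      rewrite ltn_neqAle ltn_pmod // andbT; apply/eqP => E; apply: t0.
      by rewrite -addn1 -modnDml addn1 E modnn.
    split; rewrite {1}(divn_eq t k) -addnS; first by rewrite divnMDl // (divn_small lt) addn0.
    by rewrite modnMDl modn_small.
  rewrite t0 /= jumpE //; case: ifP => [//|/negbT yr] /=.
  have tE : t = t %/ k * k by rewrite {1}(divn_eq t k) t0 addn0.
  case: (t %/ k) tE bJ yr => [|b] tE bJ yr; first by rewrite mark0 in yr.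
  rewrite gy // /g tE mulSn -nth_last size_mkseq nth_mkseq; last by rewrite prednK // addn_gt0 k_gt0.
  rewrite /T /gmap.
  have -> : (k + b * k).-1 = b * k + k.-1 by rewrite addnC -subn1 -addnBA // subn1.
  have lt : k.-1 < k by rewrite prednK.
  by rewrite divnMDl // modnMDl (divn_small lt) (modn_small lt) prednK // addn0.
have step t : t < k * J -> A (current k x0 jump (mkseq T t), L i t) = T t.
  by move=> tJ; rewrite curE // /T /= add0n (per_mod (L_per i)).
have fresh t : t < k * J -> T t \notin earlier k x0 (mkseq T t).
  move=> tJ; apply/mapP => -[t']; rewrite mem_filter mem_iota add0n size_mkseq => /andP [/eqP m /= lt].
  rewrite nth_mkseq // /T m => E.
  have tb : t %/ k < J by rewrite ltn_divLR // mulnC.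
  have tb' : t' %/ k < J by apply: leq_ltn_trans tb; rewrite leq_div2r // ltnW.
  have gg : g (y (t %/ k)) = g (y (t' %/ k)).
    have gE z : g z = walk A (L i) (0 + (t %% k).+1) (walk A (L i) 0 z (t %% k).+1) (k - (t %% k).+1).
      by rewrite -walkD subnKC // ltn_pmod.
    by rewrite !gE E.
  have q := ginj _ _ tb tb' gg.
  by move: lt; rewrite (divn_eq t k) (divn_eq t' k) m q ltnn.
have all_runs m t : m + t = k * J -> runs k (L i) x0 jump A m (mkseq T t).
  elim: m t => //= m IH t mt; have tJ : t < k * J by rewrite -mt ltnS leq_addl.
  rewrite size_mkseq step // fresh //=.
  have -> : rcons (mkseq T t) (T t) = mkseq T t.+1 by rewrite /mkseq -[t.+1]addn1 iotaD map_cat cats1.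
  by apply: IH; rewrite addnS.
by apply: (all_runs _ 0); rewrite addn0.
Qed.

(** The cycles are listed one after the other, with a jump at the beginning of each; [g] is
    injective on cyclic points. *)
Lemma exists_run J s : 0 < J -> J <= #|[set x | cyc x]| -> #|cycles k L i A setT| <= s ->
  exists p : s.-tuple ('I_J * 'I_n), runs k (L i) x0 (jump_of p) A (k * J) [::].
Proof.
move=> J0 Jc cs.
pose rep (C : {set 'I_n}) := odflt x0 [pick x | cyc x && (C == orb x)].
have repP C : C \in cycles k L i A setT -> cyc (rep C) /\ C = orb (rep C).
  case/imsetP => x; rewrite inE => cx CE; rewrite /rep; case: pickP => [y /andP [cy /eqP CE'] //|/(_ x)].
  by rewrite cx CE eqxx.
pose rs := [seq rep C | C <- enum (cycles k L i A setT)].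
have crs : {in rs, forall x, cyc x}.
  by move=> z /mapP [C]; rewrite mem_enum => /repP [cx _] ->.
have ors : [seq orb x | x <- rs] = enum (cycles k L i A setT).
  rewrite -map_comp -[RHS]map_id; apply/eq_in_map => C; rewrite mem_enum => /repP [_ CE].
  by rewrite /= -CE.
pose ys := cycle_list rs.
have uys : uniq ys by apply: uniq_cycle_list; rewrite ?ors ?enum_uniq.
have cys y : y \in ys -> cyc y.
  case/flatten_mapP => x xr; rewrite -fconnect_orbit => /iter_findex <-.
  by apply: good_iter; exact: crs.
have Js : J <= size ys.
  apply: leq_trans Jc _; rewrite -(card_uniqP uys); apply: subset_leq_card; apply/subsetP => x.
  rewrite inE => cx; have Cx : orb x \in cycles k L i A setT by apply: imset_f; rewrite inE.
  apply/flatten_mapP; exists (rep (orb x)); first by apply: map_f; rewrite mem_enum.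
  rewrite -mem_orb; have [_ <-] := repP _ Cx; rewrite mem_orb -fconnect_orbit; exact: connect0.
pose y b := nth x0 ys b.
have y0r : y 0 \in rs.
  by have [//|[]] := @cycle_list_step rs 0 (leq_trans J0 Js).
apply: (@run_of_blocks J s y (fun b => y b \in rs)) => //.
- move=> b bJ yr; have [yr'|[//]] := cycle_list_step (leq_trans bJ Js).
  by rewrite /y yr' in yr.
- move=> b b' bJ bJ' gg; have /eqP : y b = y b'.
    by apply: good_inj gg; apply: cys; apply: mem_nth; apply: leq_trans Js.
  by rewrite /y nth_uniq ?(leq_trans _ Js) // => /eqP.
- apply: leq_trans cs; rewrite [X in X <= _]cardE [X in _ <= X]cardE.
  rewrite -[X in X <= _](size_map (fun b : 'I_J => y b)) -[X in _ <= X](size_map rep).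
  apply: uniq_leq_size.
    rewrite map_inj_in_uniq; first exact: enum_uniq.
    move=> b b' _ _ /eqP.
    rewrite nth_uniq ?(leq_trans (ltn_ord _) Js) // => /eqP; exact: val_inj.
  by move=> z /mapP [b]; rewrite mem_enum inE => yr ->.
Qed.

Lemma exists_path_run J s v : 0 < J -> 0 < s ->
  (forall b b', b < J -> b' < J -> iter b.+1 g v = iter b'.+1 g v -> b = b') ->
  exists p : s.-tuple ('I_J * 'I_n), runs k (L i) x0 (jump_of p) A (k * J) [::].
Proof.
move=> J0 s0 inj; apply: (@run_of_blocks J s (fun b => iter b g v) (pred1 0)) => //.
apply: leq_trans s0; rewrite -(card1 (Ordinal J0)); apply: subset_leq_card.
by apply/subsetP => b; rewrite !inE.
Qed.

End LongCycles.

Definition long_run n (I : finType) k (L : I -> nat -> bool) i J s (A : transitions n) :=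
  [exists x0 : 'I_n, exists p : s.-tuple ('I_J * 'I_n), runs k (L i) x0 (jump_of p) A (k * J) [::]].

Lemma card_long_run (F : realFieldType) n (I : finType) k (L : I -> nat -> bool) i J s :
  0 < k -> 0 < J -> J <= n ->
  (#|[pred A : transitions n | long_run k L i J s A]|%:R
   <= (n * (J * n) ^ s)%:R * ((n ^ (n * 2))%:R * avoid n k F J 0) :> F)%R.
Proof.
move=> k0 J0 Jn; have n0 : 0 < n := leq_trans J0 Jn.
pose R (xp : 'I_n * s.-tuple ('I_J * 'I_n)) (A : transitions n) :=
  runs k (L i) xp.1 (jump_of xp.2) A (k * J) [::].
apply: (@le_trans _ _ (\sum_xp #|[pred A : transitions n | R xp A]|%:R)%R).
  rewrite -natr_sum ler_nat -sum1_card.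
  apply: (@leq_trans (\sum_(A in [pred A : transitions n | long_run k L i J s A]) \sum_xp (R xp A : nat))).
    apply: leq_sum => A; rewrite inE => /existsP [x /existsP [p rp]].
    by rewrite (bigD1 (x, p)) //= /R rp.
  rewrite exchange_big /=; apply: leq_sum => p _; rewrite -sum1_card [X in _ <= X]big_mkcond /=.
  by rewrite big_mkcond; apply: leq_sum => A _; rewrite !inE; case: (long_run _ _ _ _ _ _) => //; case: (R p A).
apply: (@le_trans _ _ (\sum_(xp : 'I_n * s.-tuple ('I_J * 'I_n)) (n ^ (n * 2))%:R * avoid n k F J 0)%R); last first.
  by rewrite sumr_const card_prod card_tuple card_prod !card_ord -(mulr_natl (_ * _)%R).
apply: ler_sum => -[x0 p] _.
have h : history k (L i) x0 (jump_of p) set0 (fun e => e.1) [::] by split=> // t t'; rewrite ltn0 andbF.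
have := @count_runs n k (L i) x0 k0 (jump_of p) F J (k * J) [::] set0 (fun e => e.1) n0 Jn.
rewrite cards0 subn0 => /(_ (leqnn _) erefl h); apply: le_trans.
rewrite ler_nat; apply: subset_leq_card; apply/subsetP => A; rewrite !inE => rA; apply/andP; split; last exact: rA.
by apply/forall_inP => e; rewrite inE.
Qed.

(** Only the second half of the product is used. Its factors are at most 1 - h/n, and m >= n/h of
    them make at most 1/2, as (1 - y)(1 + y) <= 1 and (1 + y)^m >= 2 for y = h/n. *)
Lemma avoid_bound (F : realFieldType) n k h m E : 0 < n -> 0 < k -> n <= h * m ->
  E * m <= k * h -> 2 * h <= n ->
  (avoid n k F (2 * (k * h)) 0 <= ((2 ^ E)%:R)^-1)%R.
Proof.
move=> n0 k0 nhm Emk hn.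
have n0' : (0 < n%:R :> F)%R by rewrite ltr0n.
pose y : F := (h%:R / n%:R)%R.
have y0 : (0 <= y)%R by rewrite divr_ge0 ?ler0n.
have y1 : (y <= 1)%R by rewrite ler_pdivrMr // mul1r ler_nat (leq_trans _ hn) // leq_pmull.
have f01 i : i < 2 * (k * h) -> (0 <= 1 - (i %/ k)%:R / n%:R :> F)%R /\ (1 - (i %/ k)%:R / n%:R <= 1 :> F)%R.
  move=> ik; have q0 : (0 <= (i %/ k)%:R / n%:R :> F)%R by rewrite divr_ge0 ?ler0n.
  split; last by rewrite gerBl.
  rewrite subr_ge0 ler_pdivrMr // mul1r ler_nat (leq_trans _ hn) // ltnW //.
  by rewrite ltn_divLR // -mulnA [h * k]mulnC.
have kh : k * h <= 2 * (k * h) by rewrite leq_pmull.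
rewrite /avoid (big_cat_nat (leq0n (k * h)) kh) /=.
apply: (@le_trans _ _ (1 * \prod_(k * h <= i < 2 * (k * h)) (1 - (i %/ k)%:R / n%:R))%R).
  apply: ler_wpM2r.
    rewrite big_nat_cond; apply: prodr_ge0 => i; rewrite andbT => /andP [_ ik].
    by have [] := f01 i ik.
  rewrite big_nat_cond; apply: prodr_ile1 => i; rewrite andbT => /andP [_ ik].
  by have [-> ->] := f01 i (leq_trans ik kh).
rewrite mul1r.
apply: (@le_trans _ _ (\prod_(k * h <= i < 2 * (k * h)) (1 - y))%R).
  rewrite big_nat_cond [X in (_ <= X)%R]big_nat_cond; apply: ler_prod => i.
  rewrite andbT => /andP [ki ik]; have [-> _] := f01 i ik.
  rewrite lerB // ler_wpM2r ?invr_ge0 ?ler0n // ler_nat leq_divRL //.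
  by rewrite mulnC.
rewrite prodr_const_nat mul2n -addnn addnK.
have y1' : (0 <= 1 - y)%R by rewrite subr_ge0.
apply: (@le_trans _ _ ((1 - y) ^+ (m * E))%R).
  by apply: ler_wiXn2l; rewrite // ?gerBl // mulnC.
rewrite exprM natrX -exprVn; apply: lerXn2r; rewrite ?nnegrE ?exprn_ge0 ?invr_ge0 //.
have bern (r : nat) : (1 + r%:R * y <= (1 + y) ^+ r)%R.
  elim: r => [|r IHr]; first by rewrite mul0r addr0.
  rewrite exprS; apply: (le_trans _ (ler_wpM2l _ IHr)); last by rewrite addr_ge0.
  have : (0 <= r%:R * y * y)%R by rewrite mulr_ge0 // mulr_ge0.
  by rewrite -natr1; nra.
have two : (2 <= (1 + y) ^+ m)%R.
  apply: le_trans (bern m); rewrite -[2%R]/(1 + 1)%R lerD2l /y mulrA ler_pdivlMr // mul1r.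
  by rewrite -natrM ler_nat mulnC.
rewrite -[X in (_ <= X)%R]mul1r ler_pdivlMr //.
apply: (@le_trans _ _ ((1 - y) ^+ m * (1 + y) ^+ m)%R).
  by rewrite ler_wpM2l // exprn_ge0.
rewrite -exprMn exprn_ile1 //; last by rewrite -subr_sqr expr1n gerBl sqr_ge0.
by rewrite mulr_ge0 // addr_ge0.
Qed.

(** * Configurations with many blocks *)

Section Large.
Variables (n : nat) (I : finType) (k : nat) (L : I -> nat -> bool).
Hypothesis k_gt0 : 0 < k.
Hypothesis L_per : forall i j, L i (j + k) = L i j.
Implicit Types (X : bigconf n I) (A : transitions n).

Definition total X := \sum_i #|cG (X.2 i)|.

Lemma card_branch X : #|branch k L X| <= k * total X.
Proof.
apply: (@leq_trans (\sum_i #|setX (cG (X.2 i)) [set: 'I_k]|)); last first.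
  rewrite /total big_distrr /=; apply: leq_sum => i _.
  by rewrite cardsX cardsT card_ord mulnC.
pose W i := [set walk X.1 (L i) 0 p.1 (nat_of_ord p.2) | p in setX (cG (X.2 i)) [set: 'I_k]].
apply: (@leq_trans #|\bigcup_i W i|).
  apply: subset_leq_card; apply/subsetP => z; rewrite inE => /andP [/asboolP [i [s [[x [j [xG jk -> _]]] _]]] _].
  apply/bigcupP; exists i => //; apply/imsetP; exists (x, Ordinal jk) => //.
  by rewrite !inE xG.
apply: (@leq_trans (\sum_i #|W i|)).
  elim/big_rec2: _ => [|i S T _ IH]; first by rewrite cards0.
  by apply: leq_trans (leq_card_setU _ _) _; rewrite leq_add2l.
by apply: leq_sum => i _; exact: leq_imset_card.
Qed.

Lemma valid_cycle X i x : valid k L X -> x \in cG (X.2 i) ->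
  ~~ fconnect (gmap k L X.1 i) (cv (X.2 i)) x -> good k L i X.1 setT x.
Proof.
move=> /forallP /(_ i) /andP [c _] xG xv; have [q q0 qE] := cfg0_cycle c xG xv.
by apply/(goodP L_per); exists q.
Qed.

Definition cycle_part X i :=
  [set C in cycles k L i X.1 setT | C \subset cG (X.2 i) :\: [set x | fconnect (gmap k L X.1 i) (cv (X.2 i)) x]].

Lemma cycle_partE X i x : valid k L X -> ~~ fconnect (gmap k L X.1 i) (cv (X.2 i)) x ->
  (x \in cG (X.2 i)) = (good k L i X.1 setT x) && (orb k L i X.1 x \in cycle_part X i).
Proof.
move=> vX xv; have xx : x \in orb k L i X.1 x by rewrite inE; apply/asboolP; exists 0.
apply/idP/andP => [xG|[gx]]; last first.
  by rewrite inE => /andP [_ /subsetP /(_ x xx)]; rewrite inE => /andP [].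
have gx := valid_cycle vX xG xv; split=> //; rewrite inE; apply/andP; split.
  by apply: imset_f; rewrite inE.
apply/subsetP => y; rewrite inE => /asboolP [t ->]; rewrite (walk_iter (L_per i)) -/(gmap k L X.1 i).
rewrite -/(gmap k L X.1 i) !inE; apply/andP; split; last first.
  by elim: t => //= t IH; exact: (gmap_in vX IH).
apply: contra xv => vt; have /(goodP L_per) [q q0 qE] := gx.
have xq r : iter (r * q) (gmap k L X.1 i) x = x by elim: r => // r IH; rewrite mulSn iterD IH.
have le : t <= t * q by rewrite leq_pmulr.
apply: connect_trans vt _; rewrite -{2}(xq t) -(subnK le) iterD; exact: fconnect_iter.
Qed.

(** Off the orbit of its mark, each [G] is a union of cycles of the map of the word. Given the
    transitions, a configuration amounts to the marks and a set of cycles per word. *)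
Lemma card_configs A :
  #|[pred X | valid k L X && (X.1 == A)]| <= n ^ #|I| * 2 ^ num_cycles k L A setT.
Proof.
pose f X : {ffun I -> 'I_n * {set {set 'I_n}}} := [ffun i => (cv (X.2 i), cycle_part X i)].
pose Fm i := [pred y : 'I_n * {set {set 'I_n}} | y.2 \subset cycles k L i A setT].
rewrite -(@card_in_image _ _ f).
  apply: (@leq_trans #|family Fm|).
    apply: subset_leq_card; apply/subsetP => y /imageP [X]; rewrite inE => /andP [vX /eqP XA] ->.
    apply/familyP => i; rewrite ffunE inE /= -XA; apply/subsetP => C; rewrite inE.
    by case/andP.
  rewrite card_family foldrE big_map big_enum /= /num_cycles.
  rewrite (eq_bigr (fun i => n * 2 ^ #|cycles k L i A setT|)) => [|i _]; last first.
    rewrite -card_powerset -[X in _ = X * _]card_ord -cardsT -cardsX.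
    by apply: eq_card => y; rewrite !inE.
  by rewrite big_split /= prod_nat_const expn_sum.
move=> X Y; rewrite !inE => /andP [vX /eqP XA] /andP [vY /eqP YA] /ffunP E.
rewrite (surjective_pairing X) (surjective_pairing Y) XA YA; congr (_, _).
apply/ffunP => i; rewrite (surjective_pairing (X.2 i)) (surjective_pairing (Y.2 i)).
rewrite (surjective_pairing (X.2 i).1) (surjective_pairing (Y.2 i).1).
have := E i; rewrite !ffunE => -[vE cE].
have /andP [c _] := forallP vX i; have /andP [c' _] := forallP vY i.
rewrite XA in c; rewrite YA in c'.
have GE : cG (X.2 i) = cG (Y.2 i).
  apply/setP => x; case: (boolP (fconnect (gmap k L A i) (cv (X.2 i)) x)) => [|xv].
    by move=> /iter_findex <-; rewrite (cfg0_iter _ c) vE (cfg0_iter _ c').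
  rewrite cycle_partE // ?XA // [RHS]cycle_partE // ?YA -?vE //.
  by rewrite cE.
rewrite vE GE; congr (_, _).
by rewrite vE GE in c; exact: cfg0_perm_unique c c'.
Qed.

(** Some word has 2 * (J + 1) blocks. Either the orbit of its mark has more than J points, and it is
    a run by itself, or at least J blocks lie on cycles. *)
Lemma large_total X J s : 0 < #|I| -> valid k L X -> 0 < J -> 0 < s -> 2 * #|I| * J.+1 <= total X ->
  num_cycles k L X.1 setT <= s -> [exists i, long_run k L i J s X.1].
Proof.
move=> I0 vX J0 s0 tX ncs.
have [i Gi] : exists i, 2 * J.+1 <= #|cG (X.2 i)|.
  apply: contrapT => nex.
  have small i : #|cG (X.2 i)| <= 2 * J + 1.
    by rewrite -ltnS leqNgt; apply/negP => H; apply: nex; exists i; lia.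
  have : total X <= #|I| * (2 * J + 1) by rewrite -sum_nat_const; apply: leq_sum.
  by move: tX; nia.
apply/existsP; exists i; apply/existsP; exists (cv (X.2 i)).
set g := gmap k L X.1 i; set v := cv (X.2 i); set P := [set x | fconnect g v x].
have [c _] := andP (forallP vX i).
suff [p rp] : exists p : s.-tuple ('I_J * 'I_n), runs k (L i) v (jump_of p) X.1 (k * J) [::].
  by apply/existsP; exists p.
case: (ltnP J #|P|) => PJ.
  apply: (@exists_path_run n I k L k_gt0 L_per X.1 i v J s v J0 s0) => b b' bJ bJ' E.
  have so : size (fingraph.orbit g v) = fingraph.order g v by rewrite size_orbit.
  have oP : fingraph.order g v = #|P| by rewrite /fingraph.order cardsE.
  have lt a : a < J -> a.+1 < fingraph.order g v by rewrite oP => aJ; exact: leq_ltn_trans PJ.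
  have h a : a < J -> a.+1 < size (fingraph.orbit g v) by move=> aJ; rewrite so lt.
  have := nth_uniq v (h b bJ) (h b' bJ') (orbit_uniq g v).
  by rewrite !nth_traject ?lt // E eqxx => /esym /eqP [].
apply: (@exists_run n I k L k_gt0 L_per X.1 i v J s J0).
  apply: (@leq_trans #|cG (X.2 i) :\: P|).
    have le := subset_leq_card (subsetIr (cG (X.2 i)) P).
    rewrite -(leq_add2l #|cG (X.2 i) :&: P|) cardsID.
    apply: leq_trans (leq_add (leq_trans le PJ) (leqnn J)) _.
    by rewrite addnn -mul2n (leq_trans _ Gi) // leq_pmul2l.
  apply: subset_leq_card; apply/subsetP => x; rewrite !inE => /andP [xv xG].
  exact: (valid_cycle vX xG xv).
by apply: leq_trans ncs; rewrite /num_cycles (bigD1 i) //= leq_addr.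
Qed.

End Large.

Lemma bernoulli (F : realFieldType) (y : F) m : (0 <= y -> 1 + m%:R * y <= (1 + y) ^+ m)%R.
Proof.
move=> y0; elim: m => [|m IHm]; first by rewrite mul0r addr0.
rewrite exprS; apply: (le_trans _ (ler_wpM2l _ IHm)); last by rewrite addr_ge0.
have : (0 <= m%:R * y * y)%R by rewrite !mulr_ge0.
by rewrite -natr1; nra.
Qed.

(** From q^q <= 4^q * q!, a weak Stirling bound that comes from q^q * q! <= (2q)! and 'C(2q, q) <=
    4^q. *)
Lemma leq_bin_expn n q : 'C(n, q) * q ^ q <= 4 ^ q * n ^ q.
Proof.
have qq : q ^ q <= 4 ^ q * q`!.
  have -> : 4 ^ q = 2 ^ (2 * q) by rewrite expnM.
  have h : q ^ q * q`! <= (2 * q)`!.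
    suff hr r : q ^ r * q`! <= (q + r)`! by rewrite mul2n -addnn; exact: hr.
    elim: r => [|r IH]; first by rewrite expn0 mul1n addn0.
    by rewrite expnS addnS factS -mulnA leq_mul // leqW // leq_addr.
  have b : 'C(2 * q, q) <= 2 ^ (2 * q).
    rewrite -[2 ^ _]/((1 + 1) ^ (2 * q)) expnDn.
    have qo : q < (2 * q).+1 by rewrite ltnS leq_pmull.
    by rewrite (bigD1 (Ordinal qo)) //= !exp1n !muln1 leq_addr.
  have f0 := fact_gt0 q.
  rewrite -(leq_pmul2r f0) (leq_trans h) // -(bin_fact (leq_pmull q (isT : 0 < 2))).
  by rewrite [2 * q]mul2n -addnn addnK addnn -mul2n !mulnA !leq_mul2r b !orbT.
have f0 := fact_gt0 q.
rewrite -(leq_pmul2r f0) mulnAC bin_ffact.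
rewrite [_ * q`!]mulnAC mulnC leq_mul //.
rewrite ffact_prod; rewrite -[X in _ <= n ^ X]card_ord -prod_nat_const.
by apply: leq_prod => i _; exact: leq_subr.
Qed.

Lemma leq_sum_exists (T U : finType) (P : pred T) (R : U -> pred T) (f : T -> nat) c :
  (forall x, P x -> exists i, R i x) -> (forall x, P x -> f x <= c) ->
  \sum_(x | P x) f x <= \sum_i #|[pred x | R i x]| * c.
Proof.
move=> PR fc; apply: (@leq_trans (\sum_i \sum_x (if R i x then c else 0))); last first.
  by apply: leq_sum => i _; rewrite -big_mkcond sum_nat_const.
rewrite [X in _ <= X]exchange_big big_mkcond; apply: leq_sum => x _; case: ifP => // Px.
by have [i Ri] := PR x Px; rewrite (bigD1 i) //= Ri (leq_trans (fc x Px)) // leq_addr.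
Qed.

(** * The three kinds of bad residual configurations *)

Section Tail.
Variables (n : nat) (I : finType) (k : nat) (L : I -> nat -> bool).
Hypothesis k_gt0 : 0 < k.
Hypothesis L_per : forall i j, L i (j + k) = L i j.
Hypothesis has_true : forall i, exists j, L i j.
Hypothesis n_gt0 : 0 < n.
Variable F : realFieldType.
Variable kap : nat.
Hypothesis weight_le : weight k L <= kap.
Hypothesis kap_gt0 : 0 < kap.
Local Notation nc A := (num_cycles k L A setT).
Local Open Scope ring_scope.

(** The generating function is taken at x = 2(1 + y) with y = 1/(2 * kap). Where there are at least
    2 * kap * t cycles, the factor (1 + y)^nc is at least 2^t; on the other hand (1 + y)^kap <= 2
    keeps x^kap below 2^(kap + 1). *)
Lemma tail_cycles t :
  \sum_(A : transitions n | (2 * kap * t <= nc A)%N) 2 ^+ nc A <=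
   (n ^ (n * 2))%:R * n.+1%:R ^+ (2 ^ kap.+1 * kap) / 2 ^+ t :> F.
Proof.
set C := (2 ^ kap.+1 * kap)%N.
pose y : F := (2 * kap)%:R^-1; pose x : F := 2 * (1 + y).
have k2 : 0 < (2 * kap)%:R :> F by rewrite ltr0n muln_gt0.
have y0 : 0 <= y by rewrite invr_ge0 ltW.
have y1 : 1 <= 1 + y by rewrite lerDl.
have x1 : 1 <= x by rewrite /x; lra.
have y2 : (1 + y) ^+ kap <= 2.
  have yk : kap%:R * y = 2^-1.
    by rewrite /y natrM invfM mulrCA divff ?mulr1 // gt_eqF // ltr0n.
  have yle : y <= 1 by rewrite /y invf_le1 // ler1n muln_gt0.
  have h (m : nat) : 1 - m%:R * y <= (1 - y) ^+ m.
    elim: m => [|m IH]; first by rewrite mul0r subr0.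
    rewrite exprS; apply: (le_trans _ (ler_wpM2l _ IH)); last by rewrite subr_ge0.
    have : 0 <= m%:R * y * y by rewrite mulr_ge0 // mulr_ge0.
    by rewrite -natr1; nra.
  have p1 : (1 + y) ^+ kap * (1 - y) ^+ kap <= 1.
    rewrite -exprMn exprn_ile1 //; first by rewrite mulr_ge0 ?subr_ge0 // addr_ge0.
    by rewrite mulrC -subr_sqr expr1n gerBl sqr_ge0.
  have := h kap; rewrite yk => hk.
  have e0 : 0 <= (1 + y) ^+ kap by rewrite exprn_ge0 // addr_ge0.
  have : (1 + y) ^+ kap * 2^-1 <= 1.
    apply: le_trans p1; apply: ler_wpM2l => //; apply: le_trans hk; lra.
  by lra.
have rate_le : x ^+ weight k L * (weight k L)%:R <= C%:R.
  apply: (@le_trans _ _ (x ^+ kap * kap%:R)).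
    apply: ler_pM; rewrite ?exprn_ge0 ?ler0n // ?ler_nat //; first by apply: le_trans x1.
    by apply: ler_weXn2l.
  rewrite /C natrM ler_wpM2r ?ler0n // /x exprMn natrX exprSr.
  by rewrite ler_wpM2l // exprn_ge0.
have main := @sum_cycles n I k L k_gt0 L_per F x x1 has_true C n_gt0 rate_le.
rewrite ler_pdivlMr ?exprn_gt0 // mulr_suml; apply: le_trans main.
rewrite big_mkcond /=; apply: ler_sum => A _.
have x0 : 0 <= x by apply: le_trans x1.
case: ifP => [At|_]; last exact: exprn_ge0.
rewrite /x exprMn ler_wpM2l ?exprn_ge0 //.
apply: (@le_trans _ _ ((1 + y) ^+ (2 * kap * t))).
  rewrite exprM; apply: lerXn2r; rewrite ?nnegrE ?exprn_ge0 //; first by lra.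
  by apply: le_trans (bernoulli _ y0); rewrite /y divff ?gt_eqF //.
exact: ler_weXn2l.
Qed.

Variables (l0 : nat).
Hypothesis sep : forall i i' s s',
  (forall m, (m < k)%N -> L i (s + m) = L i' (s' + m)) -> i = i' /\ s = s' %[mod k].
Hypothesis win : forall i j, (forall t, (t < l0)%N -> L i (j + t)%N = L i t) -> (k %| j)%N.
Hypothesis I_gt0 : (0 < #|I|)%N.

Definition bad_residual (X : bigconf n I) := [&& valid k L X, residual k L X & ~~ main k L X].

Definition residual_qu q u (X : bigconf n I) :=
  [&& valid k L X, residual k L X, #|branch k L X| == q & #|start_set k L X| == u].

Lemma card_bad_residual J t : (0 < J)%N -> (0 < t)%N -> (J <= n)%N ->
  (#|[pred X | bad_residual X]|%:R <=
   \sum_(1 <= q < (k * (2 * #|I| * J.+1)).+1) \sum_(u < (2 * #|I|).+1) #|[pred X | residual_qu q u X]|%:R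
   + (n ^ #|I|)%:R * ((n ^ (n * 2))%:R * n.+1%:R ^+ (2 ^ kap.+1 * kap) / 2 ^+ t)
   + (n ^ #|I| * 2 ^ (2 * kap * t) * #|I|)%:R *
      ((n * (J * n) ^ (2 * kap * t))%:R * ((n ^ (n * 2))%:R * avoid n k F J 0)) :> F).
Proof.
move=> J0 t0 Jn; set Q := (k * _)%N; set s := (2 * kap * t)%N.
have s0 : (0 < s)%N by rewrite !muln_gt0 kap_gt0 t0.
(* [isA]: few branch vertices, as there are few blocks. [isB]: many cycles. [isC]: many blocks on
   few cycles, hence a long run. *)
pose isA (X : bigconf n I) := [exists q : 'I_Q, exists u : 'I_(2 * #|I|).+1, residual_qu q.+1 u X].
pose isB (X : bigconf n I) := valid k L X && (s <= nc X.1)%N.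
pose isC (X : bigconf n I) := valid k L X && ((nc X.1 <= s)%N && [exists i, long_run k L i J s X.1]).
have split X : bad_residual X -> [|| isA X, isB X | isC X].
  move=> /and3P [vX rX nm].
  case: (ltnP (total X) (2 * #|I| * J.+1)) => tX; last first.
    case: (leqP s (nc X.1)) => sn; first by rewrite /isB vX sn orbT.
    rewrite /isC vX (ltnW sn) /= (large_total k_gt0 L_per I_gt0 vX J0 s0 tX (ltnW sn)) ?orbT //.
  apply/orP; left.
  have b0 : (0 < #|branch k L X|)%N.
    rewrite card_gt0; apply: contra nm => /eqP; exact: residual_nobranch.
  have bQ : (#|branch k L X| <= Q)%N.
    by apply: leq_trans (card_branch k L X) _; rewrite leq_mul2l (ltnW tX) orbT.
  have uS : (#|start_set k L X| < (2 * #|I|).+1)%N by rewrite ltnS card_start_set.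
  have qQ : (#|branch k L X|.-1 < Q)%N by rewrite prednK.
  apply/existsP; exists (Ordinal qQ); apply/existsP; exists (Ordinal uS).
  by rewrite /residual_qu vX rX /= prednK // !eqxx.
apply: (@le_trans _ _ (#|[pred X | isA X]|%:R + #|[pred X | isB X]|%:R + #|[pred X | isC X]|%:R)).
  rewrite -!natrD ler_nat.
  apply: (@leq_trans #|[predU [predU [pred X | isA X] & [pred X | isB X]] & [pred X | isC X]]|).
    by apply: subset_leq_card; apply/subsetP => X /split; rewrite !inE orbA.
  have cU (P1 P2 : pred (bigconf n I)) : (#|[predU P1 & P2]| <= #|P1| + #|P2|)%N.
    by rewrite -cardUI leq_addr.
  by apply: leq_trans (cU _ _) _; rewrite leq_add2r; exact: cU.
have fibers (P : pred (transitions n)) :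
    (#|[pred X : bigconf n I | valid k L X && P X.1]| <= \sum_(A | P A) n ^ #|I| * 2 ^ nc A)%N.
  rewrite -sum1_card (partition_big (fun X : bigconf n I => X.1) P) => [|X /andP []//] /=.
  apply: leq_sum => A PA; apply: leq_trans (card_configs L_per A).
  rewrite sum1_card; apply: subset_leq_card; apply/subsetP => X; rewrite !inE.
  by case/andP => /andP [-> _] ->.
apply: lerD; first apply: lerD.
- rewrite big_add1 /= big_mkord.
  apply: (@le_trans _ _ (\sum_(q < Q) \sum_(u < (2 * #|I|).+1) #|[pred X | residual_qu q.+1 u X]|)%N%:R); last first.
    by rewrite natr_sum; apply: ler_sum => q _; rewrite natr_sum.
  rewrite ler_nat -sum1_card.
  apply: (@leq_trans (\sum_(X in [pred X | isA X]) \sum_(q < Q) \sum_(u < (2 * #|I|).+1) residual_qu q.+1 u X)%N).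
    apply: leq_sum => X; rewrite inE => /existsP [q /existsP [u rX]].
    by rewrite (bigD1 q) //= (bigD1 u) //= rX.
  rewrite exchange_big /=; apply: leq_sum => q _; rewrite exchange_big /=; apply: leq_sum => u _.
  rewrite -[X in (_ <= X)%N]sum1_card [X in (_ <= X)%N]big_mkcond [X in (X <= _)%N]big_mkcond /=; apply: leq_sum => X _.
  by rewrite !inE; case: (isA X) => //; case: (residual_qu _ _ _).
- apply: (@le_trans _ _ ((\sum_(A | (s <= nc A)%N) n ^ #|I| * 2 ^ nc A)%N)%:R).
    by rewrite ler_nat; exact: (fibers (fun A => s <= nc A)%N).
  rewrite -big_distrr /= natrM ler_wpM2l ?ler0n //; apply: le_trans (tail_cycles t).
  by rewrite natr_sum; apply: ler_sum => A _; rewrite natrX.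
apply: (@le_trans _ _ ((\sum_(A | (nc A <= s)%N && [exists i, long_run k L i J s A]) n ^ #|I| * 2 ^ nc A)%N)%:R).
  by rewrite ler_nat; exact: (fibers (fun A => (nc A <= s)%N && [exists i, long_run k L i J s A])).
apply: (@le_trans _ _ ((\sum_i #|[pred A | long_run k L i J s A]| * (n ^ #|I| * 2 ^ s))%N)%:R).
  rewrite ler_nat; apply: leq_sum_exists => A /andP [ns /existsP //].
  by rewrite leq_mul2l leq_pexp2l ?orbT.
rewrite natr_sum; apply: (@le_trans _ _ (\sum_(i : I) (n ^ #|I| * 2 ^ s)%:R *
   ((n * (J * n) ^ s)%:R * ((n ^ (n * 2))%:R * avoid n k F J 0)))).
  apply: ler_sum => i _; rewrite natrM mulrC ler_wpM2l ?ler0n //.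
  exact: card_long_run.
by rewrite sumr_const -(mulr_natl (_ * _)) mulrA -natrM mulnC.
Qed.

End Tail.

(** * Numerical bounds *)

Lemma expn_regroup (a b c d e k m q : nat) :
  (2 ^ (a + b + c + d) * k ^ e * 2 ^ m * q) ^ q =
  (2 ^ a * k ^ e) ^ q * q ^ q * 2 ^ (b * q) * 2 ^ (c * q + m * q) * (2 ^ d) ^ q.
Proof.
rewrite !expnD (expnM 2 b) (expnM 2 c) (expnM 2 m) !expnMn.
move: (2 ^ a) (2 ^ b) (2 ^ c) (2 ^ d) (k ^ e) (2 ^ m) => x y z t u v.
by move: (x ^ q) (y ^ q) (z ^ q) (t ^ q) (u ^ q) (v ^ q) (q ^ q) => *; ring.
Qed.

Section Small.
Variables (n : nat) (I : finType) (k : nat) (L : I -> nat -> bool) (l0 : nat).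
Hypothesis k_gt0 : 0 < k.
Hypothesis L_per : forall i j, L i (j + k) = L i j.
Hypothesis sep : forall i i' s s',
  (forall m, m < k -> L i (s + m) = L i' (s' + m)) -> i = i' /\ s = s' %[mod k].
Hypothesis win : forall i j, (forall t, t < l0 -> L i (j + t) = L i t) -> k %| j.
Hypothesis I_gt0 : 0 < #|I|.
Hypothesis I_le2 : #|I| <= 2.
Hypothesis n_gt0 : 0 < n.

(** Cost of one branch vertex besides q/n. The exponents 48 of 2 and 18 of k come from the tags and
    the known vertices, 4 from q^u <= 2^(4q), 32 and 12 * l0 from the configurations per code, and 2
    from the binomial coefficient. *)
Definition branch_cost := 2 ^ (48 + 4 + 32 + 2) * k ^ 18 * 2 ^ (12 * l0).

Lemma leq_expl a b r : a <= b -> a ^ r <= b ^ r.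
Proof. by case: r => // r ab; rewrite leq_exp2r. Qed.

(** The number of known vertices, of order k * q, yields q^(2q + u), and the binomial coefficient
    removes only q^q. The remaining q^q is why the bound is used only while [branch_cost] * q is
    small compared with n. *)
Lemma card_residual_qu q u : 0 < q -> u <= 4 ->
  #|[pred X : bigconf n I | residual_qu k L q u X]| * n ^ q <= n ^ (n * 2) * (branch_cost * q) ^ q.
Proof.
move=> q0 u4; have nu : 0 < n ^ (q + u) by rewrite expn_gt0 n_gt0.
rewrite -(leq_pmul2r nu) -mulnA -expnD.
rewrite (_ : q + (q + u) = 2 * q + u); last by rewrite addnA addnn mul2n.
apply: leq_trans (card_residual n k_gt0 L_per sep win u q0) _.
have e1 : (3 * #|I| * k ^ 2) ^ (2 * q + u) <= (6 * k ^ 2) ^ (2 * q + u).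
  by apply: leq_expl; rewrite leq_mul // -[6]/(3 * 2) leq_mul.
have e2 : known_max k q u <= 23 * k * q by rewrite /known_max; nia.
have e3 : (q + u) * 2 ^ (q + u + (2 * q + u) * l0 + (2 * q + u).+1) <= 2 ^ (16 * q + 6 * q * l0).
  have h1 : q + u <= 2 ^ (4 * q).
    apply: (@leq_trans (2 ^ 3 * 2 ^ q)); last by rewrite -expnD leq_pexp2l //; lia.
    by have := ltn_expl q (isT : 1 < 2); lia.
  apply: leq_trans (leq_mul h1 (leqnn _)) _; rewrite -expnD leq_pexp2l //; nia.
have e4 : ((q + u) * 2 ^ (q + u + (2 * q + u) * l0 + (2 * q + u).+1)) ^ #|I| <= 2 ^ (32 * q + 12 * q * l0).
  apply: leq_trans (leq_expl #|I| e3) _; rewrite -expnM leq_pexp2l //; nia.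
have e5 : (6 * k ^ 2) ^ (2 * q + u) * known_max k q u ^ (2 * q + u) <=
    (2 ^ 48 * k ^ 18) ^ q * (q ^ q * q ^ q * 2 ^ (4 * q)).
  rewrite -expnMn; apply: (@leq_trans ((2 ^ 8 * k ^ 3 * q) ^ (2 * q + u))).
    apply: leq_expl; apply: leq_trans (leq_mul (leqnn _) e2) _.
    by rewrite (expnS k 2); move: (k ^ 2) => k2; nia.
  rewrite expnMn; apply: leq_mul.
    apply: (@leq_trans ((2 ^ 8 * k ^ 3) ^ (6 * q))).
      by rewrite leq_pexp2l ?muln_gt0 ?expn_gt0 ?k_gt0 //; lia.
    by rewrite expnM expnMn -!expnM.
  rewrite expnD mul2n -addnn expnD leq_mul2l; apply/orP; right.
  apply: (@leq_trans (q ^ 4)); first by rewrite leq_pexp2l.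
  by rewrite [4 * q]mulnC expnM; apply: leq_expl; apply: ltnW; exact: ltn_expl.
have e6 : 'C(n, q) * q ^ q <= (2 ^ 2) ^ q * n ^ q := leq_bin_expn n q.
apply: (@leq_trans ('C(n, q) * n ^ u * ((2 ^ 48 * k ^ 18) ^ q * (q ^ q * q ^ q * 2 ^ (4 * q))) * n ^ (n * 2) * 2 ^ (32 * q + 12 * q * l0))).
  apply: leq_mul e4; have := leq_trans (leq_mul e1 (leqnn _)) e5.
  move: ('C(n, q)) (n ^ u) ((3 * #|I| * k ^ 2) ^ _) (n ^ (n * 2)) (known_max k q u ^ _) (_ * (q ^ q * _ * _)).
  move=> c nu' a N km Y h; have -> : c * nu' * a * (N * km) = c * nu' * N * (a * km) by ring.
  have -> : c * nu' * Y * N = c * nu' * N * Y by ring.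
  by rewrite leq_mul2l h orbT.
rewrite /branch_cost expn_regroup [12 * l0 * q]mulnAC.
rewrite [n ^ (q + u)]expnD; move: e6.
move: ('C(n, q)) (n ^ u) ((2 ^ 48 * k ^ 18) ^ q) (q ^ q) (2 ^ (4 * q)) (n ^ (n * 2))
  (2 ^ (32 * q + 12 * q * l0)) ((2 ^ 2) ^ q) (n ^ q) => c nu' a qq b N d f nq h.
have -> : c * nu' * (a * (qq * qq * b)) * N * d = (c * qq) * (nu' * a * qq * b * N * d) by ring.
have -> : N * (a * qq * b * d * f) * (nq * nu') = (f * nq) * (nu' * a * qq * b * N * d) by ring.
by rewrite leq_mul2r h orbT.
Qed.

End Small.

Lemma geometric_le (F : realFieldType) (x : F) Q : (0 <= x -> x <= 2^-1 ->
  \sum_(1 <= q < Q.+1) x ^+ q <= 2 * x)%R.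
Proof.
move=> x0 x2; suff : (\sum_(1 <= q < Q.+1) x ^+ q + 2 * x ^+ Q.+1 <= 2 * x)%R.
  by apply: le_trans; rewrite lerDl mulr_ge0 // exprn_ge0.
elim: Q => [|Q IH]; first by rewrite big_geq // add0r expr1.
apply: le_trans IH; rewrite big_nat_recr //= -addrA lerD2l.
have p0 : (0 <= x ^+ Q.+1)%R by rewrite exprn_ge0.
by rewrite [(x ^+ Q.+2)%R]exprS; nra.
Qed.

(** * Choice of the parameters *)

Section Core.
Variables (n : nat) (I : finType) (k : nat) (L : I -> nat -> bool) (m M P kap : nat).
Hypothesis k_gt0 : 0 < k.
Hypothesis L_per : forall i j, L i (j + k) = L i j.
Hypothesis sep : forall i i' s s',
  (forall m, m < k -> L i (s + m) = L i' (s' + m)) -> i = i' /\ s = s' %[mod k].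
Hypothesis win : forall i j, (forall t, t < m -> L i (j + t) = L i t) -> k %| j.
Hypothesis has_true : forall i, exists j, L i j.
Hypothesis I_gt0 : 0 < #|I|.
Hypothesis I_le2 : #|I| <= 2.
Hypothesis weight_le : weight k L <= kap.
Hypothesis kap_gt0 : 0 < kap.
Local Notation S := (2 ^ m).
Hypothesis M48 : 48 <= M.
Hypothesis kap_le : kap + 48 * m <= M * m.
Hypothesis n_ge : S ^ M <= n.
Hypothesis n_lt : n < 2 ^ M * S ^ M.
Hypothesis P_ge : 2 ^ 10 <= P.
Hypothesis k_le : k <= P.
Hypothesis kap_leP : kap <= P.
Hypothesis m_le : m <= P.
Hypothesis bits_le : M * m.+1 <= P.
Hypothesis M_le : 2 ^ (M + 2) <= P.
Hypothesis S_ge : P ^ 30 <= S.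

(** Here n lies between R * S^48 and 2^M * R * S^48, and 2^kap <= R, so [C], [t], [s] and [E] are at
    most R up to powers of P. [t] makes the configurations with many cycles negligible, [b] being a
    bound on log2 n, and [E] pays for the subsets of at most [s] cycles and for the choice of [s]
    jumps. [h] has to satisfy two constraints: E * n is below h^2, of order R^2 * S^56, and k * J
    branch vertices at the cost S^12 each, up to powers of P, stay below n, as 28 + 12 leaves room
    below 48. *)
Let R := S ^ (M - 48).
Let C := 2 ^ kap.+1 * kap.
Let b := M * m.+1.
Let t := b * (C + 2) + m.
Let s := 2 * kap * t.
Let E := s * (2 * b + 1) + 3 * b + 1 + m.
Let h := R * S ^ 28.
Let J := 2 * (k * h).

Let P_pos : 0 < P. Proof. exact: leq_trans P_ge. Qed.
Let P_ge16 : 16 <= P. Proof. by apply: leq_trans P_ge; rewrite (@leq_pexp2l 2 4 10). Qed.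
Let S_pos : 0 < S. Proof. by rewrite expn_gt0. Qed.
Let R_pos : 0 < R. Proof. by rewrite expn_gt0 S_pos. Qed.

Let PS r : r <= 30 -> P ^ r <= S.
Proof. by move=> r30; apply: leq_trans S_ge; rewrite leq_pexp2l. Qed.

Let SM : S ^ M = R * S ^ 48.
Proof. by rewrite /R -expnD subnK. Qed.

Let R_le j : j <= 48 -> R * S ^ j <= n.
Proof. by move=> j48; apply: leq_trans n_ge; rewrite SM leq_mul2l leq_pexp2l ?orbT. Qed.

Let n_gt0 : 0 < n.
Proof. by apply: leq_trans n_ge; rewrite expn_gt0 S_pos. Qed.

Let n4_lt : 4 * n <= P * (R * S ^ 48).
Proof.
rewrite -SM; apply: (@leq_trans (2 ^ (M + 2) * S ^ M)); last by rewrite leq_mul2r M_le orbT.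
by rewrite expnD [2 ^ M * _]mulnC -mulnA leq_mul // ltnW.
Qed.

Let C_le : C <= P ^ 2 * R.
Proof.
have kR : 2 ^ kap <= R.
  rewrite /R -expnM leq_pexp2l // mulnBr; rewrite leq_subRL; last first.
    by rewrite [m * 48]mulnC [m * M]mulnC; apply: leq_trans kap_le; rewrite leq_addl.
  by rewrite addnC [m * 48]mulnC [m * M]mulnC.
rewrite /C expnS; apply: (@leq_trans (2 * R * P)).
  by apply: leq_mul => //; rewrite leq_mul2l.
rewrite [P ^ 2]expnS expn1 mulnAC leq_mul2r; apply/orP; right.
by rewrite leq_mul2r (leq_trans _ P_ge16) ?orbT.
Qed.

Let b_leP : b <= P. Proof. exact: bits_le. Qed.

Let t_le : t <= P ^ 4 * R.
Proof.
rewrite /t; have h1 : b * (C + 2) <= P * (P ^ 2 * R + 2) by rewrite leq_mul // leq_add.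
apply: leq_trans (leq_add h1 m_le) _.
have x0 : 0 < P ^ 2 * R by rewrite muln_gt0 expn_gt0 P_pos R_pos.
have -> : P ^ 4 * R = P * (P * (P ^ 2 * R)) by rewrite (expnS P 3) (expnS P 2) !mulnA.
rewrite -[X in _ + X]muln1 -mulnDr leq_mul2l; apply/orP; right.
apply: (@leq_trans (16 * (P ^ 2 * R))); last by rewrite leq_mul2r P_ge16 orbT.
by move: x0; move: (P ^ 2 * R) => x x0; lia.
Qed.

Let s_le : s <= P ^ 6 * R.
Proof.
rewrite /s; apply: (@leq_trans (2 * P * (P ^ 4 * R))); first by rewrite leq_mul // leq_mul.
rewrite (expnD P 2 4) -[P ^ 2]/(P * P) !mulnA !leq_mul2r.
by rewrite (leq_trans _ P_ge16) ?orbT.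
Qed.

Let E_le : E <= P ^ 9 * R.
Proof.
rewrite /E; have h1 : s * (2 * b + 1) <= P ^ 6 * R * (2 * P + 1).
  by rewrite leq_mul // leq_add // leq_mul.
apply: (@leq_trans (P ^ 6 * R * (2 * P + 1) + 3 * P + 1 + P)).
  by rewrite !leq_add // leq_mul.
have x0 : 0 < P ^ 6 * R by rewrite muln_gt0 expn_gt0 P_pos R_pos.
have -> : P ^ 9 * R = P ^ 6 * R * (P * (P * P)) by rewrite (expnD P 6 3) mulnAC -mulnA [R * _]mulnC mulnA.
move: x0; move: (P ^ 6 * R) => x x0.
apply: (@leq_trans (x * (16 * P))); last by rewrite leq_mul2l mulnC leq_mul2l (leq_trans P_ge16) ?orbT // leq_pmull.
apply: (@leq_trans (x * (2 * P + 1) + x * (3 * P + 1 + P))).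
  by rewrite -!addnA leq_add2l !addnA leq_pmull.
rewrite -mulnDr leq_mul2l; apply/orP; right; have p1 := P_pos; clear -p1; lia.
Qed.

Let h_pos : 0 < h. Proof. by rewrite /h muln_gt0 R_pos expn_gt0 S_pos. Qed.

Let J_gt0 : 0 < J. Proof. by rewrite /J muln_gt0 muln_gt0 k_gt0 h_pos. Qed.

Let t_gt0 : 0 < t.
Proof.
rewrite /t addn_gt0; case: (posnP m) => [m0|_]; last by rewrite orbT.
by move: S_ge; rewrite m0 expn0 => /(leq_trans (leq_pexp2l P_pos (isT : 1 <= 30))); rewrite expn1 => /(leq_trans P_ge16).
Qed.

Let two_k_h : 2 * (k * h) <= R * S ^ 29.
Proof.
rewrite /h (expnS S 28); apply: (@leq_trans (P ^ 2 * (R * S ^ 28))).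
  by rewrite mulnA leq_mul // expnS expn1 leq_mul // (leq_trans _ P_ge16).
by rewrite [R * (_ * _)]mulnCA leq_mul // PS.
Qed.

Let J_le : J <= n. Proof. exact: leq_trans two_k_h (R_le _). Qed.

Let h2_le : 2 * h <= n.
Proof. by apply: leq_trans J_le; rewrite leq_mul2l leq_pmull. Qed.

Let E_h : E * (n %/ h).+1 <= k * h.
Proof.
apply: (@leq_trans h); last by rewrite leq_pmull.
rewrite -(leq_pmul2r h_pos); apply: (@leq_trans (E * (n + h))).
  rewrite -mulnA leq_mul2l mulSn addnC leq_add2r leq_trunc_div orbT //.
apply: (@leq_trans (P ^ 9 * R * (P * (R * S ^ 48)))).
  apply: leq_mul E_le _; apply: leq_trans n4_lt; have hh := h2_le; clear -hh; lia.
have -> : P ^ 9 * R * (P * (R * S ^ 48)) = P ^ 10 * (R * R * S ^ 48).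
  by rewrite (expnSr P 9); ring.
apply: (@leq_trans (S * (R * R * S ^ 48))); first by rewrite leq_mul // PS.
have -> : S * (R * R * S ^ 48) = R * R * S ^ 49 by rewrite (expnS S 48); ring.
have -> : h * h = R * R * S ^ 56 by rewrite /h (expnD S 28 28); ring.
by rewrite leq_mul2l leq_pexp2l ?orbT.
Qed.

Let n_lt_b : n.+1 <= 2 ^ b.
Proof. by apply: leq_trans n_lt _; rewrite /b mulnS expnD (mulnC M m) expnM. Qed.

Let tail_small : n ^ #|I| * n.+1 ^ C * S <= 2 ^ t.
Proof.
have nb : n <= 2 ^ b := ltnW n_lt_b.
apply: (@leq_trans ((2 ^ b) ^ 2 * (2 ^ b) ^ C * S)).
  rewrite leq_mul2r; apply/orP; right; apply: leq_mul; last exact: leq_expl.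
  by apply: leq_trans (leq_expl _ nb) _; rewrite leq_pexp2l ?expn_gt0.
by rewrite -!expnM -!expnD leq_pexp2l // /t mulnDr [b * C + _]addnC.
Qed.

Let long_small : n ^ #|I| * 2 ^ s * #|I| * (n * (J * n) ^ s) * S <= 2 ^ E.
Proof.
have nb : n <= 2 ^ b := ltnW n_lt_b.
apply: (@leq_trans ((2 ^ b) ^ 2 * 2 ^ s * 2 ^ 1 * (2 ^ b * (2 ^ b * 2 ^ b) ^ s) * S)).
  rewrite leq_mul2r; apply/orP; right; apply: leq_mul; [apply: leq_mul => //; rewrite leq_mul2r; apply/orP; right|].
    by apply: leq_trans (leq_expl _ nb) _; rewrite leq_pexp2l ?expn_gt0.
  by apply: leq_mul => //; apply: leq_expl; apply: leq_mul => //; exact: leq_trans J_le nb.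
rewrite -(expnD 2 b b) -!expnM -!expnD leq_pexp2l // /E.
by clear; nia.
Qed.

Let cost_small q : q <= k * (2 * #|I| * J.+1) -> branch_cost k m * q * S <= n.
Proof.
move=> qQ; have D_le : branch_cost k m <= P ^ 27 * S ^ 12.
  rewrite /branch_cost (mulnC 12) [2 ^ (m * 12)]expnM leq_mul2r; apply/orP; right.
  rewrite (expnD P 9 18); apply: leq_mul; last exact: leq_expl.
  apply: leq_trans (leq_expl 9 P_ge); rewrite -expnM; exact: leq_pexp2l.
have q_le : q <= P ^ 4 * (R * S ^ 28).
  apply: leq_trans qQ _.
  have J1 : J.+1 <= 2 * J by rewrite mul2n -addnn -add1n leq_add2r.
  apply: (@leq_trans (P * (4 * (2 * (2 * (P * h)))))).
    apply: leq_mul => //; apply: leq_mul; first by rewrite -[4]/(2 * 2) leq_mul2l.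
    by apply: leq_trans J1 _; rewrite !leq_mul2l /= leq_mul2r k_le orbT.
  rewrite -/h (_ : P * _ = 16 * (P * (P * h))); last by clear; move: h => z; ring.
  have -> : P ^ 4 * h = P * P * (P * (P * h)) by clear; move: h => z; ring.
  by rewrite leq_mul2r; apply/orP; right; apply: (leq_trans P_ge16); rewrite leq_pmull.
apply: (@leq_trans (S * S ^ 12 * (S * (R * S ^ 28)) * S)).
  rewrite leq_mul2r; apply/orP; right; apply: leq_mul.
    by apply: leq_trans D_le _; rewrite leq_mul2r PS ?orbT.
  by apply: leq_trans q_le _; rewrite leq_mul2r PS ?orbT.
apply: leq_trans (R_le (isT : 43 <= 48)).
rewrite (expnD S 15 28) (expnD S 12 3) -[S ^ 3]/(S * (S * S)).
by move: (S ^ 12) (S ^ 28) S R => a c d r; clear; nia.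
Qed.

Let S_ge2 : 2 <= S.
Proof. by apply: leq_trans (PS (isT : 1 <= 30)); rewrite expn1 (leq_trans _ P_ge16). Qed.

(** The constant is 12 = 5 * 2 + 1 + 1: at most five values of u, each with a geometric series of
    ratio 1/S, then the configurations with many cycles and those with a long run. *)
Lemma bad_residual_small (F : realFieldType) :
  (#|[pred X : bigconf n I | bad_residual k L X]|%:R <= (n ^ (n * 2))%:R * (12 / S%:R) :> F)%R.
Proof.
have S0 : (0 < S%:R :> F)%R by rewrite ltr0n.
have N0 : (0 <= (n ^ (n * 2))%:R :> F)%R by rewrite ler0n.
have bb := card_bad_residual k_gt0 L_per has_true n_gt0 F weight_le kap_gt0 sep I_gt0 J_gt0 t_gt0 J_le.
apply: le_trans bb _.
have -> : ((n ^ (n * 2))%:R * (12 / S%:R) = (n ^ (n * 2))%:R * (10 / S%:R) + (n ^ (n * 2))%:R / S%:R + (n ^ (n * 2))%:R / S%:R :> F)%R.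
  by move: (n ^ (n * 2))%:R%R (S%:R : F)%R => x y; ring.
apply: lerD; first apply: lerD.
- apply: (@le_trans _ _ (\sum_(1 <= q < (k * (2 * #|I| * J.+1)).+1) ((n ^ (n * 2))%:R * 5 * (S%:R^-1) ^+ q))%R).
    rewrite big_nat_cond [X in (_ <= X)%R]big_nat_cond; apply: ler_sum => q; rewrite andbT ltnS => /andP [q0 qQ].
    apply: (@le_trans _ _ (\sum_(u < (2 * #|I|).+1) (n ^ (n * 2))%:R * (S%:R^-1) ^+ q)%R); last first.
      rewrite sumr_const card_ord -mulrA -(mulr_natl (_ * _)%R) mulrCA ler_wpM2l // ler_wpM2r //.
        by rewrite exprn_ge0 // invr_ge0 ltW.
      by rewrite ler_nat ltnS -[4]/(2 * 2) leq_mul2l.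
    apply: ler_sum => u _; rewrite exprVn ler_pdivlMr ?exprn_gt0 // -natrX -natrM ler_nat.
    have u4 : u <= 4 by have := ltn_ord u; rewrite ltnS => uI; apply: leq_trans uI _; rewrite -[4]/(2 * 2) leq_mul2l.
    have nq : 0 < n ^ q by rewrite expn_gt0 n_gt0.
    rewrite -(leq_pmul2r nq) mulnAC.
    apply: leq_trans (leq_mul (card_residual_qu k_gt0 L_per sep win I_gt0 I_le2 n_gt0 q0 u4) (leqnn _)) _.
    by rewrite -mulnA -expnMn leq_mul2l leq_expl ?orbT // cost_small.
  rewrite -mulr_sumr -mulrA ler_wpM2l //.
  have -> : (10 / S%:R = 5 * (2 * S%:R^-1) :> F)%R by rewrite mulrA -natrM.
  rewrite ler_wpM2l //; apply: geometric_le; first by rewrite invr_ge0 ltW.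
  by rewrite lef_pV2 ?posrE // ler_nat.
- rewrite mulrA ler_pdivrMr ?exprn_gt0 // mulrAC ler_pdivlMr // -!mulrA mulrCA ler_wpM2l //.
  by rewrite mulrA -!natrX -!natrM ler_nat.
have av : (avoid n k F J 0 <= ((2 ^ E)%:R)^-1)%R.
  by apply: (avoid_bound F n_gt0 k_gt0 _ E_h h2_le); rewrite mulnC ltnW // ltn_ceil.
apply: (@le_trans _ _ ((n ^ #|I| * 2 ^ s * #|I|)%:R * ((n * (J * n) ^ s)%:R * ((n ^ (n * 2))%:R * ((2 ^ E)%:R)^-1)))%R).
  by rewrite !ler_wpM2l.
move: long_small; rewrite -(ler_nat F) [X in (X <= _)%R]natrM [X in (X * _ <= _)%R]natrM.
have : (0 < (2 ^ E)%:R :> F)%R by rewrite ltr0n expn_gt0.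
move: (2 ^ E)%:R%R (_ * #|I|)%:R%R (n * _)%:R%R S%:R%R (n ^ (n * 2))%:R%R S0 N0 => e x y z N z0 n0 e0 le_e.
have -> : (x * (y * (N / e)) = N * (x * y / e))%R by ring.
by rewrite ler_wpM2l // ler_pdivrMr // [leRHS]mulrC ler_pdivlMr.
Qed.

End Core.

(** * Marked trees and configurations *)

Section OrbitCfg.
Variables (n : nat) (g h : 'I_n -> 'I_n) (v : 'I_n).

(** [G] is the orbit of [v]; the permutation follows [g] and sends the final fixed point back to
    [v]. *)
Lemma cfg0_of_orbit t : iter t.+1 g v = iter t g v ->
  (forall i j, i <= t -> j <= t -> h (iter i g v) = h (iter j g v) -> i = j) ->
  exists G s, cfg0 v g G s && inj_on h G.
Proof.
move=> gt hinj.
have D i j : i <= t -> j <= t -> iter i g v = iter j g v -> i = j.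
  by move=> it jt /(congr1 h); exact: hinj.
pose G := [set x | [exists i : 'I_t.+1, x == iter i g v]].
have GP x : reflect (exists2 i, i <= t & x = iter i g v) (x \in G).
  rewrite inE; apply: (iffP existsP) => [[i /eqP ->]|[i it ->]]; first by exists i; rewrite // -ltnS.
  by exists (Ordinal (it : i < t.+1)).
pose F x := if x \in G then (if g x == x then v else g x) else x.
have FE i : i <= t -> F (iter i g v) = if i == t then v else iter i.+1 g v.
  move=> it; rewrite /F; have -> : iter i g v \in G by apply/GP; exists i.
  rewrite -iterS; case: (i =P t) => [->|ne]; first by rewrite gt eqxx.
  case: (iter i.+1 g v =P _) => // /D; rewrite it => H.
  have {}H := H _ isT; have lt : i < t by rewrite ltn_neqAle it andbT; exact/eqP.
  by have := H lt; lia.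
have FG x : (F x \in G) = (x \in G).
  case xG: (x \in G); last by rewrite /F xG.
  case/GP: xG => i it ->; rewrite FE //; apply/GP; case: (i =P t) => ne; first by exists 0.
  by exists i.+1 => //; rewrite ltn_neqAle it andbT; exact/eqP.
have Finj : injective F.
  move=> x y Fxy; have := FG x; rewrite Fxy FG; case yG: (y \in G) => /esym xG; last first.
    by move: Fxy; rewrite /F xG yG.
  case/GP: xG yG Fxy => i it -> /GP [j jt ->]; rewrite !FE //.
  case: (i =P t) => [->|/eqP it']; case: (j =P t) => [->|/eqP jt'] //.
  - by move/(D 0 j.+1 isT); rewrite ltn_neqAle jt jt' => /(_ isT).
  - by move/(D i.+1 0); rewrite ltn_neqAle it it' => /(_ isT isT).
  by move/D; rewrite !ltn_neqAle it it' jt jt' => /(_ isT isT) [->].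
exists G, (perm Finj); apply/andP; split.
  apply/and3P; split.
  - by apply/GP; exists 0.
  - by apply/subsetP => x; rewrite inE permE /F; case: ifP => // _; rewrite eqxx.
  apply/forall_inP => x /GP [i it ->]; rewrite /target permE FE //.
  case: (i =P t) => [->|ne]; first by rewrite eqxx -iterS gt.
  have lt : i < t by rewrite ltn_neqAle it andbT; exact/eqP.
  by rewrite iterS ifF //; apply/eqP => /(D i.+1 0 lt isT).
apply/forall_inP => x /GP [i it ->]; apply/forall_inP => y /GP [j jt ->].
by apply/implyP => /eqP /hinj -> //.
Qed.

Lemma orbit_of_cfg0 G s : cfg0 v g G s -> inj_on h G ->
  exists t, iter t.+1 g v = iter t g v /\
  (forall i j, i <= t -> j <= t -> h (iter i g v) = h (iter j g v) -> i = j).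
Proof.
move=> cfg /forall_inP iG; set p := #|porbit s v|.
have p0 : 0 < p by rewrite /p (cardsD1 v) porbit_id.
have sp : (s ^+ p)%g v = v by rewrite permX iter_porbit.
have E j : j < p -> (s ^+ j)%g v = iter j g v.
  elim: j => [|j IH] jp; first by rewrite expg0 perm1.
  have {}IH := IH (ltnW jp); have [jG _] := cfg0_fix_iter j cfg.
  case/and3P: (cfg) => _ _ /forall_inP /(_ _ jG) /eqP; rewrite /target -permM -expgSr iterS -IH => ->.
  case: ((s ^+ j.+1)%g v =P v) => // sv; have := uniq_traject_porbit s v.
  rewrite -/p -(prednK p0) [traject _ _ _]/= => /andP [/trajectP []]; exists j; first by rewrite -ltnS prednK.
  by rewrite -iterSr -permX sv.
have U i j : i < p -> j < p -> iter i g v = iter j g v -> i = j.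
  move=> ip jp; rewrite -!E // !permX => e.
  have := uniq_traject_porbit s v; rewrite -/p => /(nth_uniq v).
  move=> /(_ i j); rewrite size_traject => /(_ ip jp); rewrite !nth_traject // e eqxx.
  by move/esym/eqP.
exists p.-1; rewrite prednK //; split.
  have pp : p.-1 < p by rewrite prednK.
  have [jG _] := cfg0_fix_iter p.-1 cfg.
  case/and3P: (cfg) => _ _ /forall_inP /(_ _ jG) /eqP; rewrite /target -permM -expgSr prednK //.
  by rewrite sp eqxx E // -iterS prednK.
move=> i j ip jp e; apply: U; first (by rewrite -(prednK p0) ltnS); first by rewrite -(prednK p0) ltnS.
have := iG _ (cfg0_iter i cfg) => /forall_inP /(_ _ (cfg0_iter j cfg)) /implyP.
by rewrite e eqxx => /(_ isT) /eqP.
Qed.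

End OrbitCfg.

Section Words.
Variable n : nat.
Implicit Types (A : automaton n) (w : word) (v : 'I_n).

Definition trans A : transitions n := [ffun p => letter_act A p.2 p.1].
Definition letters w j := nth false w (j %% size w).

Lemma trans_inj : injective trans.
Proof.
move=> [a b] [a' b'] /ffunP e; congr (_, _); apply/ffunP => x.
  by have := e (x, false); rewrite !ffunE.
by have := e (x, true); rewrite !ffunE.
Qed.

Lemma trans_bij : bijective trans.
Proof.
apply: (inj_card_bij trans_inj).
by rewrite card_ffun !card_prod !card_ffun card_bool !card_ord -expnD addnn muln2.
Qed.

Lemma card_automaton : #|automaton n| = n ^ (n * 2).
Proof. by rewrite (bij_eq_card trans_bij) card_ffun card_prod card_bool !card_ord. Qed.

Lemma letters_per w j : letters w (j + size w) = letters w j.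
Proof. by rewrite /letters modnDr. Qed.

Lemma letter_orbitE A w v i : letter_orbit A w v i = walk (trans A) (letters w) 0 v i.
Proof. by elim: i => //= i ->; rewrite ffunE. Qed.

Lemma word_actE A w u : word_act A w u = walk (trans A) (letters w) 0 u (size w).
Proof.
rewrite (@eq_walk _ _ _ (nth false w) 0 0); last by move=> j jw; rewrite /letters modn_small.
elim/last_ind: w => //= w x IH; rewrite /word_act foldl_rcons -/(word_act A w u) IH size_rcons /=.
rewrite ffunE /= nth_rcons ltnn eqxx; congr letter_act.
by apply: eq_walk => j jw; rewrite nth_rcons jw.
Qed.

Lemma word_act_iter A w u q : iter q (word_act A w) u = walk (trans A) (letters w) 0 u (q * size w).
Proof.
rewrite (walk_iter (letters_per w)); apply: eq_iter => x; exact: word_actE.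
Qed.

(** If T is a multiple of k, the repeated vertex starts two blocks; it is cyclic, hence a fixed
    point in a tree. Conversely T = (t + 1) * k: an earlier repeat would propagate, inside its
    block, to the vertex from which the last letter is read, where the blocks up to t are all
    distinct. *)
Lemma marked_wtree0P A w v (k := size w) : 0 < k ->
  marked_wtree0 w (A, v) <->
  (exists! x, cyclic (word_act A w) x) /\
  exists t, iter t.+1 (word_act A w) v = iter t (word_act A w) v /\
    (forall i j, i <= t -> j <= t ->
      walk (trans A) (letters w) 0 (iter i (word_act A w) v) k.-1 =
      walk (trans A) (letters w) 0 (iter j (word_act A w) v) k.-1 -> i = j).
Proof.
move=> k0; rewrite /marked_wtree0 /is_wtree /=.
set g := word_act A w; set l := letters w; set f := trans A.
have orb q j : letter_orbit A w v (q * k + j) = walk f l 0 (iter q g v) j.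
  rewrite letter_orbitE walkD word_act_iter.
  by rewrite -(walk_phase_mod (letters_per w)) add0n modnMl.
have orb0 q : letter_orbit A w v (q * k) = iter q g v by rewrite -[q * k]addn0 orb.
split=> -[tree]; last first.
  case=> t [gt hinj]; split=> //; exists (t.+1 * k); split; last by rewrite modnMl mod0n.
  split; first split; first by rewrite muln_gt0.
    by exists (t * k); rewrite !orb0 iterS gt !modnMl ltn_mul2r k0 ltnSn.
  move=> j [j1 [i [ij eij mij]]]; rewrite leqNgt; apply/negP => jt.
  have ej := divn_eq j k; have ei := divn_eq i k; rewrite mij in ei.
  have qq : i %/ k < j %/ k by rewrite -(ltn_pmul2r k0) -(ltn_add2r (j %% k)) -ei -ej.
  have jq : j %/ k <= t by rewrite -ltnS ltn_divLR.
  have /hinj H : walk f l 0 (iter (i %/ k) g v) k.-1 = walk f l 0 (iter (j %/ k) g v) k.-1.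
    have rk : j %% k <= k.-1 by rewrite -ltnS prednK // ltn_mod.
    rewrite -(subnKC rk) !walkD; congr walk.
    by rewrite -!orb -ei -ej.
  by have := H (leq_trans (ltnW qq) jq) jq; lia.
case=> T [[[T1 [i [iT eT mT]]] Tmin]]; rewrite mod0n => /eqP Tk; split=> //.
have ri : k %| i by rewrite /dvdn mT.
move: (Tk) ri => /dvdnP [q Tq] /dvdnP [r ir].
have rq : r < q by move: iT; rewrite Tq ir ltn_mul2r k0.
have gr : g (iter r g v) = iter r g v.
  move: eT; rewrite Tq ir !orb0 => eT; case: tree => x [_ xu].
  have c1 : cyclic g (iter r g v).
    by exists (q - r); split; [rewrite subn_gt0 | rewrite -iterD subnK // ltnW].
  have c2 : cyclic g (g (iter r g v)).
    case: c1 => m [m0 mr]; exists m; split=> //.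
    by rewrite -iterSr iterS mr.
  exact: etrans (esym (xu _ c2)) (xu _ c1).
exists r; split=> // i' j'; wlog : i' j' / i' <= j' => [H|].
  move=> ir' jr' e; case: (leqP i' j') => ij; first exact: H.
  by apply/esym; apply: H => //; exact: ltnW.
rewrite leq_eqVlt => /orP [/eqP -> //|ij ir' jr' e].
have /Tmin : repeats_at A w v (j' * k + k.-1).
  split; first by case: j' ij {jr' e} => // j' _; rewrite mulSn; lia.
  exists (i' * k + k.-1); split; rewrite ?orb // ?modnMDl //.
  by rewrite ltn_add2r ltn_mul2r k0.
rewrite Tq; have : j'.+1 * k <= q * k by rewrite leq_mul2r (leq_trans _ rq) ?orbT.
by rewrite mulSn; lia.
Qed.

End Words.

Definition marks n w (A : automaton n) := #|[set v | `[< marked_wtree0 w (A, v) >]]|.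

Section Moments.
Variables (n : nat) (I : finType) (k : nat) (W : I -> word).
Hypothesis k_gt0 : 0 < k.
Hypothesis size_W : forall i, size (W i) = k.
Local Notation L := (fun i => letters (W i)).

Lemma sum_marks :
  (\sum_(A : automaton n) \prod_i (marks (W i) A)%:R =
   \sum_(X : bigconf n I | valid k L X) bigsign X)%R.
Proof.
have [f fK Kf] := trans_bij n.
pose mk i B v := `[< marked_wtree0 (W i) (f B, v) >].
rewrite -(@sum_prod_signed n I k L mk) => [|i B v].
  rewrite (reindex f) /=; last by exists (@trans n) => A _; rewrite ?fK ?Kf.
  by apply: eq_bigr => B _; apply: eq_bigr.
have gE : gmap k L B i =1 word_act (f B) (W i).
  by move=> x; rewrite word_actE Kf size_W.
have iE q x : iter q (gmap k L B i) x = iter q (word_act (f B) (W i)) x by apply: eq_iter.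
apply: signed_sum => [x y|]; first exact: hmap_gmap.
have P := @marked_wtree0P n (f B) (W i) v; rewrite size_W Kf in P.
have cE x : cyclic (gmap k L B i) x <-> cyclic (word_act (f B) (W i)) x.
  by split=> -[m [m0 e]]; exists m; rewrite iE in e *.
split=> [/asboolP /(P k_gt0) [[x [xc xu]] [t [gt hinj]]]|[[x [xc xu]] [G [s /andP [cfg iG]]]]].
  split; first by exists x; split=> [|y /cE /xu]; first exact/cE.
  apply: (@cfg0_of_orbit _ _ _ _ t) => [|i' j' it jt]; first by rewrite !iE.
  by rewrite !iE; exact: hinj.
apply/asboolP/(P k_gt0); split; first by exists x; split=> [|y /cE /xu]; first exact/cE.
have [t [gt hinj]] := orbit_of_cfg0 cfg iG; rewrite !iE in gt.
by exists t; split=> // i' j' it jt; have := hinj _ _ it jt; rewrite !iE.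
Qed.

Lemma sum_marks_main :
  (\sum_(A : automaton n) \prod_i marks (W i) A <=
     #|[pred X : bigconf n I | main k L X]| + #|[pred X : bigconf n I | bad_residual k L X]|) /\
  (#|[pred X : bigconf n I | main k L X]| <=
     \sum_(A : automaton n) \prod_i marks (W i) A + #|[pred X : bigconf n I | bad_residual k L X]|).
Proof.
have := sum_marks; rewrite sum_residual // (bigID (main k L)) /=.
set bad := (\sum_(X | _ && ~~ _) _)%R.
rewrite (eq_bigl (main k L)); last first.
  move=> X; case: (boolP (main k L X)) => mX; last by rewrite andbF.
  by rewrite (main_residual mX); case/and3P: mX => ->.
have -> : (\sum_(X : bigconf n I | main k L X) bigsign X = #|[pred X : bigconf n I | main k L X]|%:R)%R.
  by rewrite -sum1_card natr_sum; apply: eq_big => // X; exact: main_sign.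
under eq_bigr => A _ do rewrite -natr_prod.
rewrite -natr_sum => e.
have : (`|bad| <= #|[pred X : bigconf n I | bad_residual k L X]|%:R)%R.
  apply: le_trans (ler_norm_sum _ _ _) _; rewrite -sum1_card natr_sum.
  rewrite (eq_bigl (fun X => X \in [pred X | bad_residual k L X])); last first.
    by move=> X; rewrite inE /bad_residual -andbA.
  apply: ler_sum => X _; rewrite /bigsign normr_prod big1 // => i _.
  by rewrite /sign normrX normrN1 expr1n.
move: e; rewrite !natz; lia.
Qed.

End Moments.

(** * Coded words *)

Lemma bin_central p : 2 ^ (2 * p) <= 'C(2 * p, p) * (2 * p).+1.
Proof.
elim: p => // p IH; have e1 := mul_bin_diag (2 * p).+2 p.
have e2 := mul_bin_down (2 * p).+1 p; rewrite /= in e1 e2.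
rewrite (_ : (2 * p).+1 - p = p.+1) in e2; last by lia.
have c : 'C(2 * p.+1, p.+1) * p.+1 = 2 * (2 * p).+1 * 'C(2 * p, p).
  have -> : 2 * p.+1 = (2 * p).+2 by lia.
  by rewrite mulnC -e1 -mulnA e2 mulnCA; lia.
have c2 : (2 ^ (2 * p.+1)) = 4 * 2 ^ (2 * p) by rewrite mulnS expnD.
rewrite -(leq_pmul2r (ltn0Sn p)) c2 [X in _ <= X]mulnAC c; nia.
Qed.

(** Passing from 2p + e to 2p + e + 1 multiplies the coefficient by (2p + e + 1)/(p + e + 1), which
    is at least 3/2 as long as e < p. *)
Lemma bin_skew p e : e <= p -> 2 ^ (2 * p) * 3 ^ e <= 'C(2 * p + e, p) * (2 * p).+1 * 2 ^ e.
Proof.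
elim: e => [_|e IH ep]; first by rewrite addn0 !muln1 bin_central.
have {}IH := IH (ltnW ep); have := mul_bin_down (2 * p + e).+1 p; rewrite /= -addnS.
rewrite (_ : 2 * p + e.+1 - p = p + e.+1); last by lia.
rewrite !expnS; move: IH ('C(2 * p + e.+1, p)).
move: ('C(2 * p + e, p)) (2 ^ (2 * p)) (3 ^ e) (2 ^ e) => c x y z IH d E.
have {}E : 3 * c <= 2 * d by clear -E ep; nia.
have := leq_mul (leqnn 3) IH; have := leq_mul E (leqnn ((2 * p).+1 * z)).
clear -E; set w := (2 * p).+1; nia.
Qed.

Section CodedWords.
Variables (k m : nat).
Hypothesis m_gt0 : 0 < m.
Hypothesis m_lt : m < k.

Definition forced_true j := (m <= j) && (m %| j) || (j == k.-1).
Definition free_positions := [set j : 'I_k | (m <= j) && ~~ forced_true j].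
(* After the prefix of [m] letters [false], each window of [m] letters inside the word contains a
   [true]: hence the prefix occurs at no other position of the cyclic word. *)
Definition coded_word (X : {set 'I_k}) : word := [seq forced_true (j : 'I_k) || (j \in X) | j <- enum 'I_k].

Lemma size_coded X : size (coded_word X) = k.
Proof. by rewrite size_map size_enum_ord. Qed.

Lemma letters_coded X (j : 'I_k) : letters (coded_word X) j = forced_true j || (j \in X).
Proof.
rewrite /letters size_coded modn_small // (nth_map j) ?size_enum_ord //.
by rewrite nth_ord_enum.
Qed.

Lemma letters_per_coded X j : letters (coded_word X) (j + k) = letters (coded_word X) j.
Proof. by have := letters_per (coded_word X) j; rewrite size_coded. Qed.

Lemma letters_mod_coded X j : letters (coded_word X) (j %% k) = letters (coded_word X) j.
Proof. exact: per_mod (letters_per_coded X) j. Qed.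

Lemma letters_forced_true X j : j < k -> forced_true j -> letters (coded_word X) j.
Proof. by move=> jk fj; rewrite (letters_coded X (Ordinal jk)) fj. Qed.

Lemma coded_prefix (X : {set 'I_k}) j : X \subset free_positions -> j < m -> letters (coded_word X) j = false.
Proof.
move=> /subsetP XF jm; have jk := ltn_trans jm m_lt.
rewrite (letters_coded X (Ordinal jk)) /forced_true /=.
have -> : m <= j = false by rewrite leqNgt jm.
rewrite (_ : j == k.-1 = false); last by apply/eqP; lia.
by apply/negbTE/negP => /XF; rewrite inE /= leqNgt jm.
Qed.

Lemma coded_window X j : (forall t, t < m -> letters (coded_word X) (j + t) = false) -> k %| j.
Proof.
move=> H; have k0 : 0 < k by apply: ltn_trans m_lt.
apply/negPn/negP; rewrite /dvdn; set r := j %% k => r0.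
have rk : r < k by rewrite ltn_mod.
have {}H t : t < m -> r + t < k -> ~~ forced_true (r + t).
  move=> tm rt; apply/negP => /(letters_forced_true X rt).
  by rewrite -letters_mod_coded modnDml letters_mod_coded H.
(* Either the window runs past the end of the word and contains its last letter, or it contains a
   positive multiple of m; both are forced to be [true]. *)
case: (ltnP k (r + m)) => rm.
  have := H (k.-1 - r); rewrite (_ : r + (k.-1 - r) = k.-1); last by lia.
  by rewrite /forced_true eqxx orbT; have -> // : k.-1 < k; [lia | lia].
pose c := (r + m).-1 %/ m.
have c1 : c * m <= (r + m).-1 := leq_trunc_div _ _.
have c2 : (r + m).-1 < c.+1 * m := ltn_ceil _ m_gt0.
have c0 : 0 < c by rewrite divn_gt0 //; lia.
have rc : r <= c * m by rewrite mulSn in c2; lia.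
have := H (c * m - r); rewrite (subnKC rc) /forced_true dvdn_mull // andbT leq_pmull //=.
by have -> // : c * m < k; [lia | lia].
Qed.

(** The prefix locates the beginning of both words: reading from a start of the first one, the
    second one also shows m letters [false], so it is at its start too. *)
Lemma coded_sep (X Y : {set 'I_k}) s s' : X \subset free_positions -> Y \subset free_positions ->
  (forall t, t < k -> letters (coded_word X) (s + t) = letters (coded_word Y) (s' + t)) ->
  X = Y /\ s = s' %[mod k].
Proof.
move=> XF YF H; have k0 : 0 < k by apply: ltn_trans m_lt.
have {}H t : letters (coded_word X) (s + t) = letters (coded_word Y) (s' + t).
  rewrite -letters_mod_coded -modnDmr letters_mod_coded H ?ltn_mod //.
  by rewrite -letters_mod_coded modnDmr letters_mod_coded.
(* The shift by s * (k - 1) brings the phase s to the multiple s * k of k. *)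
pose t0 := s * k.-1; have st0 : s + t0 = s * k by rewrite -mulnS prednK.
have dX : k %| s + t0 by rewrite st0 dvdn_mull.
have LX t : letters (coded_word X) (s + t0 + t) = letters (coded_word X) t.
  by rewrite -letters_mod_coded -modnDml (eqP dX) add0n letters_mod_coded.
have dY : k %| s' + t0.
  by apply: (@coded_window Y) => t tm; rewrite -addnA -H addnA LX coded_prefix.
have LY t : letters (coded_word Y) (s' + t0 + t) = letters (coded_word Y) t.
  by rewrite -letters_mod_coded -modnDml (eqP dY) add0n letters_mod_coded.
split; last by apply/eqP; rewrite -(eqn_modDr t0) (eqP dX) (eqP dY).
apply/setP => j; have : letters (coded_word X) j = letters (coded_word Y) j.
  by rewrite -LX -addnA H addnA LY.
rewrite !letters_coded; case: (boolP (forced_true j)) => // fj _.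
have nF (Z : {set 'I_k}) : Z \subset free_positions -> j \notin Z.
  by move=> /subsetP ZF; apply/negP => /ZF; rewrite inE fj andbF.
by rewrite !(negbTE (nF _ _)).
Qed.

Lemma coded_primitive (X : {set 'I_k}) : X \subset free_positions -> ~ self_conjugate (coded_word X).
Proof.
move=> XF [i []]; rewrite size_coded => /andP [i0 ik] e.
suff : k %| i by rewrite gtnNdvd.
apply: (@coded_window X) => t tm; rewrite -(coded_prefix XF tm).
have tk := ltn_trans tm m_lt.
rewrite /letters size_coded (modn_small tk) -{2}e /rot nth_cat size_drop size_coded.
case: ltnP => h; first by rewrite nth_drop modn_small //; lia.
rewrite nth_take; last by lia.
by congr nth; rewrite -[i + t](subnK (_ : k <= _)) ?modnDr ?modn_small; lia.
Qed.

Lemma card_forced_true : #|[set j : 'I_k | forced_true j]| <= (k %/ m).+2.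
Proof.
have k0 : k.-1 < k by lia.
apply: leq_trans (_ : #|Ordinal k0 |: [set j : 'I_k | m %| j]| <= _).
  apply: subset_leq_card; apply/subsetP => j; rewrite !inE /forced_true => /orP [/andP [_ ->]|/eqP e].
    by rewrite orbT.
  by rewrite -val_eqE /= e eqxx.
rewrite cardsU1 -add1n; apply: leq_add; first exact: leq_b1.
have lt (j : 'I_k) : j %/ m < (k %/ m).+1 by rewrite ltnS leq_div2r // ltnW.
rewrite -[X in _ <= X]card_ord; apply: (@leq_card_in _ _ (fun j => Ordinal (lt j))).
move=> i j; rewrite !inE => /divnK ei /divnK ej /(congr1 val) /= e.
by apply: val_inj; rewrite /= -ei e ej.
Qed.

Lemma card_true_coded X : #|[set j : 'I_k | letters (coded_word X) j]| <= #|X| + (k %/ m).+2.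
Proof.
apply: leq_trans (leq_add (leqnn _) card_forced_true).
apply: leq_trans (_ : #|X :|: [set j : 'I_k | forced_true j]| <= _); last first.
  by rewrite cardsU leq_subr.
by apply: subset_leq_card; apply/subsetP => j; rewrite !inE letters_coded orbC.
Qed.

Lemma card_free_positions : k <= #|free_positions| + (m + (k %/ m).+2).
Proof.
have := cardsC free_positions; rewrite card_ord => {1}<-; rewrite leq_add2l.
apply: leq_trans (_ : #|[set j : 'I_k | j < m] :|: [set j : 'I_k | forced_true j]| <= _).
  apply: subset_leq_card; apply/subsetP => j; rewrite !inE negb_and negbK -ltnNge //.
rewrite cardsU; apply: leq_trans (leq_subr _ _) _; apply: leq_add card_forced_true.
rewrite -[X in _ <= X]card_ord.
apply: leq_trans (leq_imset_card (widen_ord (ltnW m_lt)) _).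
apply: subset_leq_card; apply/subsetP => j; rewrite inE => jm; apply/imsetP.
by exists (Ordinal jm) => //; apply: val_inj.
Qed.

End CodedWords.

Lemma ffact_ge (F : realFieldType) n k j : 0 < n -> k <= n -> j <= k ->
  (n%:R ^+ j * (1 - j%:R * (k%:R / n%:R)) <= (n ^_ j)%:R :> F)%R.
Proof.
move=> n0 kn; have nF : (0 < n%:R :> F)%R by rewrite ltr0n.
elim: j => [_|j IH jk]; first by rewrite mul0r subr0 mulr1.
rewrite ffactnSr natrM natrB ?(leq_trans (ltnW jk)) //.
have c0 : (0 <= n%:R - k%:R :> F)%R by rewrite subr_ge0 ler_nat.
apply: (@le_trans _ _ ((n ^_ j)%:R * (n%:R - k%:R))%R); last first.
  by rewrite ler_wpM2l // lerD2l lerN2 ler_nat ltnW.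
apply: le_trans (ler_wpM2r c0 (IH (ltnW jk))).
have -> : (n%:R - k%:R = n%:R * (1 - k%:R / n%:R) :> F)%R by rewrite mulrBr mulr1 mulrCA divff ?mulr1 // gt_eqF.
rewrite mulrACA -exprSr ler_wpM2l ?exprn_ge0 ?(ltW nF) //.
have y0 : (0 <= k%:R / n%:R :> F)%R by rewrite divr_ge0.
rewrite -natr1; move: (k%:R / n%:R)%R (j%:R : F)%R (ler0n F j) y0 => y z z0 y0.
by have := mulr_ge0 z0 (mulr_ge0 y0 y0); clear; lra.
Qed.

(** * Moments of the number of marks for coded words *)

Section CodedMoments.
Variables (n k m M' P : nat).
Local Notation M := (2 * M').
Local Notation S := (2 ^ m).
Hypothesis M_ge : 134 <= M'.
Hypothesis m_gt0 : 0 < m.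
Hypothesis n_ge : S ^ M <= n.
Hypothesis n_lt : n < 2 ^ M * S ^ M.
Hypothesis P_ge : 2 ^ 10 <= P.
Hypothesis k_le : k <= P.
Hypothesis bits_le : M * m.+1 <= P.
Hypothesis M_le : 2 ^ (M + 2) <= P.
Hypothesis S_ge : P ^ 30 <= S.
Hypothesis k_div : (k %/ m).+2 <= m.
Hypothesis k_ge : (M + 58) * m <= k.

Local Notation p := ((M' - 26) * m).

(** A word has at most p + m letters [true], since at most m of them are forced: two words have at
    most (M - 50) * m, which meets the constraint kap + 48 * m <= M * m, while p remains close
    enough to half of the free positions for [card_codes]. *)
Definition codes := [set X : {set 'I_k} | (X \subset free_positions k m) & #|X| == p].

Let m_lt : m < k. Proof. by clear -M_ge m_gt0 k_ge; nia. Qed.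
Let k_gt0 : 0 < k. Proof. exact: ltn_trans m_lt. Qed.

Lemma codes_free X : X \in codes -> X \subset free_positions k m.
Proof. by rewrite inE => /andP []. Qed.

(** There are at least 2p + 108 * m free positions, so [bin_skew] gives 4^p * (3/2)^(108 * m) up to
    the factor 2p + 1. As 9 >= 8, this is at least 2^((M - 52) * m + 54 * m) = S^(M + 2). One factor
    S absorbs 2p + 1 and the ratio 2^M between n and S^M. *)
Lemma card_codes : n * S <= #|codes|.
Proof.
rewrite cards_draws.
have fr : (M + 56) * m <= #|free_positions k m|.
  have := card_free_positions m_gt0 m_lt; clear -k_div k_ge; nia.
apply: leq_trans (leq_bin2l _ fr).
have -> : (M + 56) * m = 2 * p + 108 * m by clear -M_ge; nia.
have ep : 108 * m <= p by rewrite leq_mul2r; apply/orP; right; clear -M_ge; lia.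
have := bin_skew ep; set c := 'C(_, _) => bs.
have p3 : 2 ^ (162 * m) <= 3 ^ (108 * m).
  have -> : 162 * m = 3 * (54 * m) by lia.
    have -> : 108 * m = 2 * (54 * m) by lia.
    by rewrite (expnM 2 3) (expnM 3 2) leq_expl.
have c_ge : S ^ M * S ^ 2 <= c * (2 * p).+1.
  rewrite -(@leq_pmul2r (2 ^ (108 * m))) ?expn_gt0 //.
  apply: leq_trans bs; apply: leq_trans (leq_mul (leqnn _) p3).
  rewrite -!expnM -!expnD leq_pexp2l //; clear -M_ge; nia.
have pS : (2 * p).+1 * 2 ^ M <= S.
  apply: leq_trans S_ge; apply: (@leq_trans (P ^ 3)); last by rewrite leq_pexp2l // (leq_trans _ P_ge).
  rewrite (expnS P 2) (expnS P 1) expn1 [X in _ <= X]mulnA; apply: leq_mul.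
    have : p <= P by apply: leq_trans bits_le; clear -M_ge; nia.
    have P16 : 16 <= P := leq_trans (@leq_pexp2l 2 4 10 isT isT) P_ge.
    move=> pP; apply: (@leq_trans (16 * P)); last by rewrite leq_mul2r P16 orbT.
    by move: p pP => x xP; clear -P16 xP; lia.
  by apply: leq_trans M_le; rewrite leq_pexp2l // leq_addr.
rewrite -(leq_pmul2r (ltn0Sn (2 * p))); apply: leq_trans c_ge.
apply: (@leq_trans (2 ^ M * S ^ M * S * (2 * p).+1)); first by rewrite !leq_mul2r ltnW ?orbT.
rewrite [2 ^ M * _]mulnC -!mulnA leq_mul2l expnS expn1; apply/orP; right.
by rewrite mulnCA leq_mul2l mulnC pS orbT.
Qed.

Section Family.
Variables (F : realFieldType) (I : finType) (X : I -> {set 'I_k}).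
Hypothesis XF : forall i, X i \in codes.
Hypothesis X_inj : injective X.
Hypothesis I_gt0 : 0 < #|I|.
Hypothesis I_le2 : #|I| <= 2.
Local Notation W := (fun i => coded_word m (X i)).
Local Notation N := ((n ^ (n * 2))%:R : F)%R.

Lemma coded_moment (main_count := #|[pred B : bigconf n I | main k (fun i => letters (W i)) B]|) :
  (((\sum_(A : automaton n) \prod_i marks (W i) A)%N%:R <= main_count%:R + N * (12 / S%:R))%R /\
  (main_count%:R <= (\sum_(A : automaton n) \prod_i marks (W i) A)%N%:R + N * (12 / S%:R))%R).
Proof.
have XF' i := codes_free (XF i).
have bad : ((#|[pred B : bigconf n I | bad_residual k (fun i => letters (W i)) B]|%:R <= N * (12 / S%:R))%R).
  apply: (@bad_residual_small n I k _ m M P ((M - 50) * m)) => //.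
  - by move=> i j; apply: letters_per_coded.
  - by move=> i i' s s' /(coded_sep m_gt0 m_lt (XF' i) (XF' i')) [/X_inj].
  - move=> i j H; apply: (@coded_window _ _ m_gt0 m_lt (X i)) => t tm.
    by rewrite H // coded_prefix.
  - by move=> i; exists k.-1; apply: letters_forced_true; rewrite ?prednK // /forced_true eqxx orbT.
  - apply: (@leq_trans (\sum_(i : I) (p + m))).
      apply: leq_sum => i _; apply: leq_trans (card_true_coded m_gt0 m_lt (X i)) _.
      by have := XF i; rewrite inE => /andP [_ /eqP ->]; rewrite leq_add2l.
    by rewrite sum_nat_const; apply: leq_trans (leq_mul I_le2 (leqnn _)) _; clear -M_ge; nia.
  - by rewrite muln_gt0 m_gt0 andbT; clear -M_ge; lia.
  - by clear -M_ge; lia.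
  - by clear -M_ge; nia.
  - by apply: leq_trans bits_le; clear -M_ge; nia.
  - by apply: leq_trans bits_le; clear -M_ge; nia.
have [] := sum_marks_main n k_gt0 (fun i => size_coded m (X i)).
rewrite -/main_count -!(ler_nat F) !natrD => h1 h2.
by split; [apply: le_trans h1 _ | apply: le_trans h2 _]; rewrite lerD2l.
Qed.

End Family.

Variable F : realFieldType.
Local Notation N := ((n ^ (n * 2))%:R : F)%R.
Local Notation mk X := (marks (coded_word m X)).

Let S_n : S <= n.
Proof. by apply: leq_trans n_ge; rewrite -[X in X <= _]expn1 leq_pexp2l ?expn_gt0 //; clear -M_ge; lia. Qed.
Let n_gt0 : 0 < n. Proof. by apply: leq_trans S_n; rewrite expn_gt0. Qed.
Let S_pos : (0 < S%:R :> F)%R. Proof. by rewrite ltr0n expn_gt0. Qed.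

Lemma sum_mark2 X Y : X \in codes -> Y \in codes -> X != Y ->
  ((\sum_(A : automaton n) mk X A * mk Y A)%N%:R <= N * (1 + 12 / S%:R))%R.
Proof.
move=> XF YF XY; pose Z b := if b then X else Y.
have ZF b : Z b \in codes by case: b.
have Zi : injective Z.
  by move=> [] [] // /eqP; rewrite /Z ?[Y == X]eq_sym (negbTE XY).
have I0 : 0 < #|{: bool}| by rewrite card_bool.
have I2 : #|{: bool}| <= 2 by rewrite card_bool.
have [+ _] := coded_moment F ZF Zi I0 I2.
rewrite (eq_bigr (fun A => mk X A * mk Y A)%N) => [h|A _]; last by rewrite big_bool.
apply: le_trans h _; rewrite mulrDr mulr1 lerD2r ler_nat; exact: card_main.
Qed.

(** In the lower bound, 13 = 12 + 1: replacing n^k by the falling factorial loses a proportion at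
    most k^2/n <= 1/S. *)
Lemma sum_mark1 X : X \in codes ->
  (N * (1 - 13 / S%:R) <= (\sum_(A : automaton n) mk X A)%N%:R)%R /\
  ((\sum_(A : automaton n) mk X A)%N%:R <= N * (1 + 12 / S%:R))%R.
Proof.
move=> XF; have Zi : injective (fun _ : unit => X) by move=> [] [].
have I0 : 0 < #|{: unit}| by rewrite card_unit.
have I2 : #|{: unit}| <= 2 by rewrite card_unit.
have [] := coded_moment F (fun _ : unit => XF) Zi I0 I2.
rewrite (eq_bigr (fun A => mk X A)) => [h1 h2|A _]; last first.
  by rewrite (big_pred1 tt) // => -[].
split; last first.
  by apply: le_trans h1 _; rewrite mulrDr mulr1 lerD2r ler_nat; exact: card_main.
rewrite -lerBlDr in h2; apply: le_trans h2.
have -> : (N * (1 - 13 / S%:R) = N * (1 - S%:R^-1) - N * (12 / S%:R))%R by ring.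
rewrite lerD2r.
have := card_main1 n (fun _ : unit => letters (coded_word m X)) k_gt0.
rewrite -(ler_nat F) => main_ge; apply: le_trans main_ge; rewrite natrM.
have kkS : k * k * S <= n.
  apply: leq_trans (_ : P ^ 2 * S <= _).
    by rewrite leq_mul2r expnS expn1 leq_mul ?orbT.
  apply: leq_trans n_ge; apply: (@leq_trans (S ^ 2)).
    rewrite (expnS S 1) expn1 leq_mul2r; apply/orP; right; apply: leq_trans S_ge.
    by rewrite leq_pexp2l // (leq_trans _ P_ge).
  by rewrite leq_pexp2l ?expn_gt0 //; clear -M_ge; lia.
have kn : k <= n.
  by apply: leq_trans kkS; rewrite -mulnA leq_pmulr // muln_gt0 k_gt0 expn_gt0.
have -> : N = (n%:R ^+ k * (n ^ (n * 2 - k))%:R)%R.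
  by rewrite -natrX -natrM -expnD subnKC // (leq_trans kn) // leq_pmulr.
rewrite mulrAC ler_wpM2r //.
apply: le_trans (ffact_ge F n_gt0 kn (leqnn k)).
rewrite ler_wpM2l ?exprn_ge0 // lerD2l lerN2 mulrA ler_pdivrMr ?ltr0n //.
by rewrite ler_pdivlMl // -!natrM ler_nat mulnC.
Qed.

End CodedMoments.

(** * Second moment *)

Lemma sum_cst (F : realFieldType) (U : finType) (x : F) : (\sum_(i : U) x = #|U|%:R * x)%R.
Proof. by rewrite sumr_const mulr_natl. Qed.

Section SecondMoment.
Variables (F : realFieldType) (Om T : finType) (D B : T -> Om -> F) (Ev : pred Om).
Variables (e p c eta : F).
Local Notation N := (#|Om|%:R : F)%R.
Hypothesis T_gt0 : 0 < #|T|.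
Hypothesis e_ge0 : (0 <= e)%R.
Hypothesis p_ge0 : (0 <= p)%R.
Hypothesis p_le1 : (p <= 1)%R.
Hypothesis eta_gt0 : (0 < eta)%R.
Hypothesis c_ge0 : (0 <= c)%R.
Hypothesis D_ge0 : forall i A, (0 <= D i A)%R.
Hypothesis D_le : forall i A, (D i A <= c)%R.
Hypothesis B_ge0 : forall i A, (0 <= B i A)%R.
Hypothesis c_le : (c <= e * #|T|%:R)%R.
Hypothesis DB : forall i A, Ev A -> (D i A <= B i A)%R.
Hypothesis sum_B : forall i, (\sum_A B i A <= p * \sum_A D i A)%R.
Hypothesis sum_D_ge : forall i, (N * (1 - e) <= \sum_A D i A)%R.
Hypothesis sum_D_le : forall i, (\sum_A D i A <= N * (1 + e))%R.
Hypothesis sum_DD : forall i j, i != j -> (\sum_A D i A * D j A <= N * (1 + e))%R.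

Local Notation K := (#|T|%:R : F)%R.
Let Y A := (\sum_i D i A)%R.

Let K_gt0 : (0 < K)%R. Proof. by rewrite ltr0n. Qed.
Let N_ge0 : (0 <= N)%R. Proof. by rewrite ler0n. Qed.

(** The diagonal terms are only bounded by D^2 <= c * D, where c will be n; [c_le] makes them
    negligible because the family has at least c/e members. *)
Lemma sum_square_dev : (\sum_A (Y A - K) ^+ 2 <= N * K ^+ 2 * (3 * e + e * (1 + e)))%R.
Proof.
have YY : (\sum_A Y A ^+ 2 <= K * (c * (N * (1 + e))) + K ^+ 2 * (N * (1 + e)))%R.
  have -> : (\sum_A Y A ^+ 2 = \sum_i \sum_j \sum_A D i A * D j A)%R.
    rewrite (eq_bigr (fun A => \sum_i \sum_j D i A * D j A)%R) => [|A _].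
      by rewrite exchange_big; apply: eq_bigr => i _; exact: exchange_big.
    by rewrite expr2 big_distrlr.
  apply: (@le_trans _ _ (\sum_(i : T) (c * (N * (1 + e)) + K * (N * (1 + e))))%R); last first.
    by rewrite sum_cst [leLHS]mulrDr expr2 !mulrA.
  apply: ler_sum => i _.
  rewrite (bigD1 i) //=; apply: lerD.
    apply: le_trans (_ : \sum_A c * D i A <= _)%R.
      by apply: ler_sum => A _; rewrite ler_wpM2r.
    by rewrite -mulr_sumr ler_wpM2l.
  apply: (@le_trans _ _ (\sum_(j | j != i) N * (1 + e))%R).
    by apply: ler_sum => j ji; apply: sum_DD; rewrite eq_sym.
  rewrite sumr_const -(mulr_natl (_ * _)%R) ler_wpM2r ?mulr_ge0 ?addr_ge0 // ler_nat.
  exact: max_card.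
have Y1 : (K * (N * (1 - e)) <= \sum_A Y A)%R.
  rewrite exchange_big /= -sum_cst; exact: ler_sum.
rewrite (eq_bigr (fun A => Y A ^+ 2 + (- 2 * K) * Y A + K ^+ 2)%R); last by move=> A _; ring.
rewrite !big_split /= -mulr_sumr sum_cst.
have cc : (K * (c * (N * (1 + e))) <= K * (e * K * (N * (1 + e))))%R.
  by rewrite ler_wpM2l ?(ltW K_gt0) // ler_wpM2r // mulr_ge0 // addr_ge0.
have KY : (K * (K * (N * (1 - e))) <= K * \sum_A Y A)%R by rewrite ler_wpM2l ?(ltW K_gt0).
move: YY cc KY; move: (\sum_A Y A ^+ 2)%R (\sum_A Y A)%R => a b.
by move: K N c => x y z h1 h2 h3; lra.
Qed.

(** On [Ev] the sum Y is at most the sum of the B, so K is at most that sum plus K - Y, and K - Y <=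
    eta * K + (Y - K)^2 / (eta * K). Summing this inequality over all the outcomes plays the role of
    Chebyshev. *)
Lemma card_event_le : (#|Ev|%:R <= N * (p + e + eta + (3 * e + e * (1 + e)) / eta))%R.
Proof.
have amgm x : (x <= eta * K + x ^+ 2 / (eta * K))%R.
  have a0 : (0 < eta * K)%R by rewrite mulr_gt0.
  move: a0; set a := (eta * K)%R => a0; rewrite -(ler_pM2r a0) mulrDl divfK ?gt_eqF //.
  by have := sqr_ge0 (x - a)%R; nra.
have point A : (K * (Ev A)%:R <= \sum_i B i A + (eta * K + (Y A - K) ^+ 2 / (eta * K)))%R.
  have B0 : (0 <= \sum_i B i A)%R by apply: sumr_ge0.
  case: (boolP (Ev A)) => EA; last by rewrite mulr0 !addr_ge0 ?divr_ge0 ?sqr_ge0 ?mulr_ge0 ?(ltW eta_gt0).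
  have YB : (Y A <= \sum_i B i A)%R by apply: ler_sum => i _; exact: DB.
  have := amgm (K - Y A)%R; rewrite -sqrrN opprB mulr1; lra.
have : (\sum_A K * (Ev A)%:R <= \sum_A (\sum_i B i A + (eta * K + (Y A - K) ^+ 2 / (eta * K))))%R.
  by apply: ler_sum => A _; exact: point.
rewrite -mulr_sumr -natr_sum !big_split /= sum_cst.
have -> : \sum_A Ev A = #|Ev|.
  by rewrite -sum1_card [RHS]big_mkcond; apply: eq_bigr => A _; rewrite unfold_in; case: (Ev A).
have BN : (\sum_A \sum_i B i A <= K * (p * (N * (1 + e))))%R.
  rewrite exchange_big /= -sum_cst; apply: ler_sum => i _.
  by apply: le_trans (sum_B i) _; rewrite ler_wpM2l.
have V : (\sum_A (Y A - K) ^+ 2 / (eta * K) <= N * K * ((3 * e + e * (1 + e)) / eta))%R.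
  rewrite -mulr_suml ler_pdivrMr ?mulr_gt0 //; apply: le_trans sum_square_dev _.
  rewrite (_ : N * K * (_ / eta) * (eta * K) = N * K ^+ 2 * ((3 * e + e * (1 + e)) / eta * eta))%R; last by ring.
  by rewrite divfK ?gt_eqF.
move=> h; rewrite -(ler_pM2l K_gt0); apply: le_trans h _.
apply: le_trans (lerD BN (lerD (lexx _) V)) _.
set r := (_ / eta)%R.
have pe : (p * e <= e)%R by rewrite ler_piMl.
have := mulr_ge0 (ltW K_gt0) (mulr_ge0 N_ge0 (_ : 0 <= e - p * e)%R).
by rewrite subr_ge0 => /(_ pe); move: K N => x y h; lra.
Qed.

End SecondMoment.

From mathcomp Require Import all_classical all_reals all_analysis.
Import Order.TTheory GRing.Theory Num.Theory.

Lemma expn60_le m : 600 <= m -> m ^ 60 <= 2 ^ m.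
Proof.
move=> m600; set j := m %/ 60.
have j10 : 10 <= j by rewrite leq_divRL.
have mj : m <= 60 * j.+1 by rewrite mulnC ltnW // ltn_ceil.
have jm : j * 60 <= m := leq_trunc_div m 60.
have lin i : 10 <= i -> 60 * i.+1 <= 2 ^ i.
  elim: i => // i IH; rewrite leq_eqVlt => /orP [/eqP [<-] //|i10].
  have := IH i10; rewrite expnS; lia.
apply: leq_trans (leq_expl 60 (leq_trans mj (lin _ j10))) _.
by rewrite -expnM leq_pexp2l.
Qed.

Lemma log2_expn (R : realType) j : log2 ((2 ^ j)%:R : R) = (j%:R)%R.
Proof.
have l2 : (0 < ln 2 :> R)%R by rewrite ln_gt0 // ltr1n.
by rewrite /log2 natrX lnXn // mulrnAl divff // gt_eqF.
Qed.

Lemma ler_log2 (R : realType) i j : 0 < i -> i <= j -> (log2 (i%:R : R) <= log2 (j%:R : R))%R.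
Proof.
move=> i0 ij; have l2 : (0 < ln 2 :> R)%R by rewrite ln_gt0 // ltr1n.
rewrite /log2 ler_pM2r ?invr_gt0 // ler_ln ?posrE ?ltr0n ?ler_nat //; exact: leq_trans i0 ij.
Qed.

Section CodedFamilies.
Variables (R : realType) (eps : R).
Hypothesis eps_gt0 : (0 < eps)%R.

Definition coded_family n e := exists (T : finType) (w : T -> word),
  [/\ forall i, size (w i) = Num.truncn ((1 + eps) * log2 (n%:R : R))%R /\ ~ self_conjugate (w i),
      (0 < #|T|) /\ (n%:R <= e * #|T|%:R :> R)%R,
      forall i, (((n ^ (n * 2))%:R * (1 - e) <= (\sum_(A : automaton n) marks (w i) A)%N%:R)%R /\
                 ((\sum_(A : automaton n) marks (w i) A)%N%:R <= (n ^ (n * 2))%:R * (1 + e))%R) &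
      forall i j, i != j ->
        ((\sum_(A : automaton n) marks (w i) A * marks (w j) A)%N%:R <= (n ^ (n * 2))%:R * (1 + e))%R].

Lemma coded_families e : (0 < e)%R -> exists n0, forall n, n0 <= n -> coded_family n e.
Proof.
move=> e0.
have ub (x : R) : (0 <= x)%R -> (x <= (Num.truncn x).+1%:R)%R by move=> /truncn_itv /andP [_ /ltW].
(* With M = 2M', the bound eps * M >= 58 gives k >= (1 + eps) * M * m, rounded down, at least (M +
   58) * m. *)
have [M' M134 Meps] : exists2 M', 134 <= M' & (58 <= eps * (2 * M')%:R)%R.
  exists (maxn 134 (Num.truncn (58 / eps)).+1); first exact: leq_maxl.
  rewrite -ler_pdivrMl //; set z := Num.truncn _.
  have := ub (58 / eps)%R; rewrite divr_ge0 ?(ltW eps_gt0) // => /(_ isT); rewrite -/z mulrC.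
  by move/le_trans; apply; rewrite ler_nat; apply: leq_trans (leq_maxr 134 _) _; rewrite leq_pmull.
pose M := 2 * M'.
pose Q := (Num.truncn ((1 + eps) * (2 * M)%:R)%R).+1.
have Q_ge : ((1 + eps) * (2 * M)%:R <= Q%:R)%R.
  by apply: ub; rewrite mulr_ge0 // addr_ge0 // ltW.
have Q_M : 2 * M <= Q.
  rewrite -(ler_nat R); apply: le_trans Q_ge; rewrite -[leLHS]mul1r ler_wpM2r // lerDl ltW //.
pose E := (Num.truncn (13 / e)).+1.
have E_ge : (13 / e <= E%:R)%R.
  by apply: ub; rewrite divr_ge0 // ltW.
(* Lower bound on m. The term 2^10 serves [expn60_le] and the size of P = Q * m, Q + 2 gives (k %/
   m) + 2 <= m and P <= m^2, 2^(M + 2) absorbs the ratio between n and S^M, and E makes 13/S at most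
   e. *)
pose m0 := 2 ^ 10 + Q.+2 + 2 ^ (M + 2) + E.
exists (2 ^ (m0 * M)) => n n_ge0.
have M0 : 0 < M by rewrite /M; clear -M134; lia.
have n0 : 0 < n by apply: leq_trans n_ge0; rewrite expn_gt0.
set l := trunc_log 2 n; pose m := l %/ M.
have m_ge : m0 <= m by rewrite leq_divRL //; exact: trunc_log_max.
have /andP [nl nl'] := trunc_log_bounds (isT : 1 < 2) n0.
have lM : m * M <= l := leq_trunc_div l M.
have lM' : l < m.+1 * M := ltn_ceil l M0.
have m_gt0 : 0 < m by apply: leq_trans m_ge; rewrite /m0 -!addnA addn_gt0 expn_gt0.
have sz10 : 2 ^ 10 <= m by apply: leq_trans m_ge; rewrite /m0 -!addnA leq_addr.
have Qm : Q.+2 <= m by apply: leq_trans m_ge; rewrite /m0; clear; move: (2 ^ 10) (2 ^ (M + 2)) => a b; lia.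
have Mm : 2 ^ (M + 2) <= m by apply: leq_trans m_ge; rewrite /m0; clear; move: (2 ^ 10) (2 ^ (M + 2)) => a b; lia.
have Em : E <= m by apply: leq_trans m_ge; rewrite /m0 leq_addl.
set k := Num.truncn ((1 + eps) * log2 (n%:R : R))%R.
have lg_ge : (l%:R <= log2 (n%:R : R))%R by rewrite -(log2_expn R l) ler_log2 ?expn_gt0.
have lg_le : (log2 (n%:R : R) <= l.+1%:R)%R by rewrite -(log2_expn R l.+1) ler_log2 // ltnW.
have e1 : (0 <= 1 + eps)%R by rewrite addr_ge0 // ltW.
have lg0 : (0 <= (1 + eps) * log2 (n%:R : R))%R by rewrite mulr_ge0 // (le_trans _ lg_ge).
have k_ge : (M + 58) * m <= k.
  rewrite truncn_ge_nat //; apply: le_trans (ler_wpM2l e1 lg_ge).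
  apply: (@le_trans _ _ ((1 + eps) * (m * M)%:R)%R); last by rewrite ler_wpM2l ?ler_nat.
  rewrite (natrM _ (M + 58)) (natrD _ M) (natrM _ m); move: Meps; rewrite -/M.
  by move: (M%:R)%R (m%:R)%R (ler0n R m) => x y y0 h; clear -y0 h; nra.
have k_le : k <= Q * m.
  rewrite -(ler_nat R); have /andP [+ _] := truncn_itv lg0; move/le_trans; apply.
  apply: le_trans (ler_wpM2l e1 lg_le) _.
  apply: (@le_trans _ _ ((1 + eps) * (2 * M * m)%:R)%R).
    by rewrite ler_wpM2l // ler_nat; apply: leq_trans lM' _; clear -m_gt0; nia.
  by rewrite (natrM _ (2 * M)) (natrM _ Q) mulrA ler_wpM2r.
have S_ge : (Q * m) ^ 30 <= 2 ^ m.
  apply: (@leq_trans (m ^ 60)); last by apply: expn60_le; apply: leq_trans sz10.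
  rewrite -[60]/(2 * 30) expnM; apply: leq_expl; rewrite expnS expn1 leq_mul2r; apply/orP; right.
  by clear -Qm; lia.
have Sm : ((13 / (2 ^ m)%:R) <= e :> R)%R.
  rewrite ler_pdivrMr ?ltr0n ?expn_gt0 // mulrC -ler_pdivrMr //; apply: le_trans E_ge _.
  by rewrite ler_nat (leq_trans Em) // ltnW // ltn_expl.
have nS : (2 ^ m) ^ M <= n by rewrite -expnM; apply: leq_trans nl; rewrite leq_pexp2l.
have nS' : n < 2 ^ M * (2 ^ m) ^ M.
  by apply: leq_trans nl' _; rewrite -expnM -expnD leq_pexp2l // -mulSn.
have P10 : 2 ^ 10 <= Q * m by apply: leq_trans sz10 _; rewrite leq_pmull.
have bits : M * m.+1 <= Q * m.
  by apply: leq_trans (leq_mul Q_M (leqnn m)); clear -m_gt0; nia.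
have MP : 2 ^ (M + 2) <= Q * m by apply: leq_trans Mm _; rewrite leq_pmull.
have kd : (k %/ m).+2 <= m.
  by apply: leq_trans Qm; rewrite !ltnS -ltnS ltn_divLR // mulSn; clear -k_le m_gt0; lia.
have mk : m < k by clear -k_ge m_gt0; nia.
pose C := codes k m M'.
have CF (i : {X | X \in C}) := codes_free (valP i).
have card_C := card_codes M134 m_gt0 nS nS' P10 k_le bits MP S_ge kd k_ge.
have S0 : (0 < (2 ^ m)%:R :> R)%R by rewrite ltr0n expn_gt0.
have s1 := sum_mark1 M134 m_gt0 nS nS' P10 k_le bits MP S_ge kd k_ge R.
have s2 := sum_mark2 M134 m_gt0 nS nS' P10 k_le bits MP S_ge kd k_ge R.
have N0 : (0 <= (n ^ (n * 2))%:R :> R)%R by [].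
have e12 : (12 / (2 ^ m)%:R <= e :> R)%R.
  by apply: le_trans Sm; rewrite ler_wpM2r ?invr_ge0 // ler_nat.
exists {X | X \in C}, (fun i => coded_word m (val i)); split.
- by move=> i; split; [exact: size_coded | exact: coded_primitive (CF i)].
- rewrite card_sig; split.
    by apply: leq_trans card_C; rewrite muln_gt0 n0 expn_gt0.
  have e13 : (1 <= e * (2 ^ m)%:R)%R.
    rewrite -ler_pdivrMr //; apply: le_trans Sm; rewrite ler_wpM2r ?invr_ge0 // ?ler1n //.
  apply: (@le_trans _ _ (e * (n * 2 ^ m)%:R)%R); last by rewrite ler_wpM2l ?(ltW e0) // ler_nat.
  by rewrite natrM mulrCA ler_peMr.
- move=> i; have [a b] := s1 _ (valP i); split.
    by apply: le_trans a; rewrite ler_wpM2l // lerD2l lerN2.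
  by apply: le_trans b _; rewrite ler_wpM2l // lerD2l.
move=> i j ij; apply: le_trans (s2 _ _ (valP i) (valP j) ij) _.
by rewrite ler_wpM2l // lerD2l.
Qed.

End CodedFamilies.

(** * Heights and synchronizing words *)
Import numFieldNormedType.Exports.

Section HeightSync.
Variables (n : nat) (A : automaton n) (w : word) (v : 'I_n).
Hypothesis tree : is_wtree w A.

Lemma wtree_rootP : cyclic_point (word_act A w) (wtree_root w (A, v)).
Proof.
have [x [xc _]] := tree; rewrite /wtree_root /=.
exact: (xgetPex v (ex_intro _ x xc)).
Qed.

Lemma wtree_root_uniq x : cyclic_point (word_act A w) x -> x = wtree_root w (A, v).
Proof. by have [y [_ yu]] := tree; move=> /yu <-; apply: yu; exact: wtree_rootP. Qed.

(** The root is a fixed point, by uniqueness of the cyclic point, and every orbit ends in a cycle,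
    hence at the root. *)
Lemma iter_height x : iter (height w (A, v)) (word_act A w) x = wtree_root w (A, v).
Proof.
set g := word_act A w; set r := wtree_root w (A, v).
have gr : g r = r.
  apply: wtree_root_uniq; have [m [m0 e]] := wtree_rootP; exists m; split=> //.
  by rewrite -iterSr iterS e.
have fix_r j : iter j g r = r by elim: j => //= j ->.
have xr : fconnect g x r.
  have /trajectP [i io e] := looping_order g x.
  suff -> : r = iter i g x by exact: fconnect_iter.
  apply/esym/wtree_root_uniq; exists (fingraph.order g x - i); split; first by rewrite subn_gt0.
  by rewrite -iterD subnK // ltnW.
have le : findex g x r <= height w (A, v).
  by apply: (@leq_bigmax _ (fun y => findex g y r)).
by rewrite -(subnK le) iterD iter_findex.
Qed.

Lemma synchronizing_height : synchronizing A (flatten (nseq (height w (A, v)) w)).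
Proof.
exists (wtree_root w (A, v)) => u; rewrite -[RHS](iter_height u).
elim: (height _ _) u => //= H IH u.
by rewrite /word_act foldl_cat -/(word_act A w u) -/(word_act A _ _) IH -iterSr.
Qed.

Lemma shortest_sync_le (R : realType) :
  (shortest_sync R A <= (height w (A, v) * size w)%:R%:E)%E.
Proof.
apply: ereal_inf_lbound; exists (flatten (nseq (height w (A, v)) w)); first exact: synchronizing_height.
by rewrite size_flatten /shape map_nseq sumn_nseq mulnC.
Qed.

End HeightSync.

Lemma card_pred_pair (T U : finType) (Q : pred (T * U)) :
  #|[pred x | Q x]| = \sum_(a : T) #|[set b | Q (a, b)]|.
Proof.
rewrite -sum1_card (eq_bigr (fun a => \sum_(b | Q (a, b)) 1)); last first.
  by move=> a _; rewrite -sum1_card; apply: eq_bigl => b; rewrite inE.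
by rewrite pair_big_dep /=; apply: eq_bigl => -[a b].
Qed.

(** * Domination with a vanishing error *)

Section Domination.
Variables (R : realType) (eps : R).
Hypothesis eps_gt0 : (0 < eps)%R.

(** The probability space and [X] are quantified inside, so that the error depends on n only. *)
Definition sync_dominated (n : nat) (e : R) := forall (d : measure_display) (T : measurableType d)
    (P : probability T R) (X : {RV P >-> R}),
  (forall w : word, size w = Num.truncn ((1 + eps) * log2 (n%:R : R))%R -> ~ self_conjugate w ->
     stoch_dominated
       (unif_tail (fun Av : automaton n * 'I_n => marked_wtree0 w Av)
                  (fun Av => (height w Av)%:R%:E))
       (rv_tail P X)) ->
  stoch_dominated_upto e
    (unif_tail (fun _ : automaton n => True) (fun A => shortest_sync R A))
    (rv_tail P (fun x => (1 + eps) * X x * log2 (n%:R : R)))%R.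

Lemma sync_dominated1 n : sync_dominated n 1%R.
Proof.
move=> d T P X _ t; apply: (@le_trans _ _ 1%E); last by rewrite leeDr // measure_ge0.
rewrite lee_fin; set a := #|_|; set b := #|_|.
have ab : a <= b by apply: subset_leq_card; apply/fintype.subsetP => x; rewrite !inE => /andP [].
case: (posnP b) => [->|b0]; first by rewrite invr0 mulr0.
by rewrite ler_pdivrMr ?ltr0n // mul1r ler_nat.
Qed.

Lemma sync_dominated_family n e eta : 2 <= n -> (0 < e)%R -> (0 < eta)%R -> coded_family eps n e ->
  sync_dominated n (e + eta + (3 * e + e * (1 + e)) / eta)%R.
Proof.
move=> n2 e0 eta0 [I [w [w_ok [I0 I_ge] mom1 mom2]]] d T P X dom t.
set k := Num.truncn _ in w_ok dom.
have lg0 : (0 < (1 + eps) * log2 (n%:R : R))%R.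
  rewrite mulr_gt0 ?addr_gt0 // divr_gt0 // ln_gt0 // ?ltr1n //.
set lg := (_ * log2 _)%R in lg0.
have k_lg : (k%:R <= lg)%R by have /andP [] := truncn_itv (ltW lg0).
pose s := (t / lg)%R.
have -> : rv_tail P (fun x => (1 + eps) * X x * log2 (n%:R : R))%R t = rv_tail P X s.
  congr (P _); apply/seteqP; split=> x /=;
    by rewrite /s ltr_pdivrMr // [((1 + eps) * X x)%R]mulrC -mulrA.
have mX : measurable [set x | (s < X x)%R]%classic.
  have -> : [set x | (s < X x)%R]%classic = (X @^-1` `]s, +oo[)%classic.
    by apply/seteqP; split=> x /=; rewrite in_itv /= andbT.
  exact: measurable_funPTI.
have P_le1 : (rv_tail P X s <= 1)%E := probability_le1 P mX.
have P_ge0 : (0 <= rv_tail P X s)%E := measure_ge0 P _.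
have dom_s i := dom (w i) (w_ok i).1 (w_ok i).2 s.
case: (rv_tail P X s) P_le1 P_ge0 dom_s => [p| |] //; rewrite !lee_fin => p1 p0 dom_s.
pose D i (A : automaton n) : R := ((marks (w i) A)%:R)%R.
pose high i (Av : automaton n * 'I_n) := `[< marked_wtree0 (w i) Av >] && (s%:E < (height (w i) Av)%:R%:E)%E.
pose B i (A : automaton n) : R := (#|[set v | high i (A, v)]|%:R)%R.
pose Ev (A : automaton n) := (t%:E < shortest_sync R A)%E.
have den : #|[pred x : automaton n | `[< True >]]| = #|automaton n|.
  by apply: eq_card => x; rewrite !inE; apply/asboolP.
have num : #|[pred x : automaton n | `[< True >] && (t%:E < shortest_sync R x)%E]| = #|Ev|.
  by apply: eq_card => x; rewrite !inE; case: asboolP.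
have N0 : (0 < #|automaton n|%:R :> R)%R.
  by rewrite ltr0n card_automaton expn_gt0 (ltnW n2).
rewrite /unif_tail den num ler_pdivrMr // mulrC addrA addrA.
have nE : ((n ^ (n * 2))%:R = #|automaton n|%:R :> R)%R by rewrite card_automaton.
rewrite nE in mom1 mom2.
apply: (@card_event_le R (automaton n) I D B Ev e p (n%:R)%R eta) => //.
- exact: ltW.
- move=> i A; rewrite ler_nat; apply: leq_trans (max_card _) _; by rewrite card_ord.
(* Rounding the length down goes in the right direction: height * k > t and k <= [lg] imply height >
   t / [lg]. *)
- move=> i A EA; rewrite ler_nat; apply: subset_leq_card; apply/fintype.subsetP => v.
  rewrite !finset.in_set /high => vm; rewrite vm lte_fin /=.
  have /asboolP [tree _] := vm.
  have := lt_le_trans EA (shortest_sync_le v tree R).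
  rewrite lte_fin (w_ok i).1 -/k /s ltr_pdivrMr // natrM => /lt_le_trans; apply.
  by rewrite ler_wpM2l.
- move=> i; have := dom_s i; rewrite lee_fin /D /B -!natr_sum.
  have -> : #|[pred Av : automaton n * 'I_n | `[< marked_wtree0 (w i) Av >]]| = \sum_(A : automaton n) marks (w i) A.
    exact: (card_pred_pair (fun Av : automaton n * 'I_n => `[< marked_wtree0 (w i) Av >])).
  have -> : #|[pred Av : automaton n * 'I_n | `[< marked_wtree0 (w i) Av >] && (s%:E < (height (w i) Av)%:R%:E)%E]| =
      \sum_(A : automaton n) #|[set v | high i (A, v)]| by exact: (card_pred_pair (high i)).
  set a := \sum_A _; set b := \sum_A _.
  have ab : a <= b.
    apply: leq_sum => A _; apply: subset_leq_card; apply/fintype.subsetP => v.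
    by rewrite !finset.in_set /high => /andP [].
  (* Without any marked tree, the hypothesis is about a quotient by 0; both sums vanish in this
     case. *)
  case: (posnP b) ab => [->|b0 _]; first by rewrite leqn0 => /eqP ->; rewrite mulr0.
  by rewrite ler_pdivrMr // ltr0n.
- by move=> i; have [+ _] := mom1 i; rewrite /D -natr_sum.
- by move=> i; have [_ +] := mom1 i; rewrite /D -natr_sum.
move=> i j ij; have := mom2 i j ij; rewrite natr_sum /D.
by under eq_bigr => A _ do rewrite natrM.
Qed.

Lemma sync_dominated_eventually e : (0 < e)%R -> exists n0, forall n, n0 <= n -> sync_dominated n e.
Proof.
move=> e0; pose eta := (e / 3)%R; have eta0 : (0 < eta)%R by rewrite divr_gt0.
(* For c <= 1, the error of the family is at most c + eta + 5 * c / eta, and c is chosen to bring it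
   below 3 * eta = e. *)
pose c := (Num.min 1 (eta * 2 / (1 + 5 / eta)))%R.
have q0 : (0 < 1 + 5 / eta)%R by rewrite addr_gt0 // divr_gt0.
have c0 : (0 < c)%R by rewrite lt_min ltr01 divr_gt0 // mulr_gt0.
have [n0 H] := coded_families eps_gt0 c0; exists (maxn 2 n0) => n; rewrite geq_max => /andP [n2 nn0].
have := sync_dominated_family n2 c0 eta0 (H n nn0) => dom d T P X hX t.
apply: le_trans (dom d T P X hX t) _; rewrite leeD2l // lee_fin.
have c1 : (c <= 1)%R by rewrite ge_min lexx.
have c2 : (c * (1 + 5 / eta) <= eta * 2)%R by rewrite -ler_pdivlMr // ge_min lexx orbT.
have le5 : ((3 * c + c * (1 + c)) / eta <= c * (5 / eta))%R.
  by rewrite mulrA ler_wpM2r ?invr_ge0 ?(ltW eta0) //; clear -c0 c1; nra.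
have -> : e = (eta * 3)%R by rewrite /eta divfK.
by move: le5 c2; rewrite mulrDr mulr1; lra.
Qed.

End Domination.

Local Open Scope classical_set_scope.
Local Open Scope ring_scope.

Theorem theorem1p3 (R : realType) (eps : R) (heps : 0 < eps) :
  exists delta : nat -> R, delta @ \oo --> (0 : R) /\
    forall (n : nat), (0 < n)%N ->
    forall (d : measure_display) (T : measurableType d) (P : probability T R)
      (X : {RV P >-> R}),
    (forall w : word,
       size w = Num.truncn ((1 + eps) * log2 (n%:R : R)) ->
       ~ self_conjugate w ->
       stoch_dominated
         (unif_tail (fun Av : automaton n * 'I_n => marked_wtree0 w Av)
                    (fun Av => (height w Av)%:R%:E))
         (rv_tail P X)) ->
    stoch_dominated_upto (delta n)
      (unif_tail (fun _ : automaton n => True) (fun A => shortest_sync R A))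
      (rv_tail P (fun x => (1 + eps) * X x * log2 (n%:R : R))).
Proof.
pose cond n (m : 'I_n) := `[< sync_dominated eps n (m.+1%:R)^-1 >].
(* The threshold beyond which an error e is valid is only known to exist. So delta n is the least
   1/(m + 1), with m < n, that is valid at n, or 1 if there is none; the restriction m < n makes
   this a finite minimum, hence attained. *)
pose delta n : R := \big[Num.min/1]_(m < n | cond n m) (m.+1%:R)^-1.
exists delta; split; last first.
  move=> n _; rewrite -/(sync_dominated eps n (delta n)).
  apply: (big_ind (sync_dominated eps n)) => [|x y dx dy|m /asboolP //]; first exact: sync_dominated1.
  by rewrite /Num.min; case: ifP.
apply/cvgrPdist_le => e e0.
have [m me] : exists m, (m.+1%:R)^-1 <= e.
  exists (Num.truncn e^-1); rewrite -[leRHS]invrK lef_pV2 ?posrE ?invr_gt0 //.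
  by have /truncn_itv /andP [_ /ltW] : 0 <= e^-1 by rewrite invr_ge0 ltW.
have m0 : (0 < m.+1%:R^-1 :> R) by rewrite invr_gt0.
have [n0 dom] := sync_dominated_eventually heps m0.
exists (maxn n0 m.+1) => // n /=; rewrite geq_max => /andP [n0n mn].
have d0 : 0 <= delta n by apply: le_bigmin => // i _; rewrite invr_ge0.
rewrite sub0r normrN ger0_norm //; apply: le_trans me.
by apply: (bigmin_inf (Ordinal mn)) => //; apply/asboolP; exact: dom.
Qed.
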